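(* The covering radius of the second order binary Reed--Muller code $RM(2,7)$ of length $2^7=128$ is equal to $40$; that is, $\max_{f\in B_7} nl_2(f)=40$.
   Context: $B_n$ denotes the set of all $n$-variable Boolean functions $f:\mathbb{F}_2^n\to\mathbb{F}_2$. Each $f\in B_n$ is uniquely a polynomial $\sum_{K\subseteq\{1,\dots,n\}}a_K\prod_{k\in K}x_k$ with $a_K\in\mathbb{F}_2$ (algebraic normal form), and $\deg(f)$ is the largest $|K|$ with $a_K\neq 0$. The Hamming distance $d(f,g)$ is the number of $x\in\mathbb{F}_2^n$ with $f(x)\ne g(x)$. $RM(r,n)$ is the set of (truth tables of) all $f\in B_n$ of degree at most $r$. The $r$-order nonlinearity is $nl_r(f)=\min\{d(f,g): g\in B_n,\ \deg(g)\le r\}$. The covering radius of $RM(r,n)$ is $\max_{f\in B_n}nl_r(f)$. *)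

(* Defs.v *)
From mathcomp Require Import all_boot all_order all_algebra.

Set Implicit Arguments.
Unset Strict Implicit.
Unset Printing Implicit Defensive.

Import GRing.Theory.
Local Open Scope ring_scope.

Notation boolfun n := {ffun 'rV['F_2]_n -> 'F_2}.

Definition anf_eval (n : nat) (a : {ffun {set 'I_n} -> 'F_2}) : boolfun n :=
  [ffun x : 'rV['F_2]_n => \sum_(K : {set 'I_n}) a K * \prod_(k in K) x 0 k].

(* The algebraic normal form of f: the unique a with anf_eval a = f (lemmas   *)
(* anf_evalK and anfK below), so the default value of odflt is never used.    *)
Definition anf (n : nat) (f : boolfun n) : {ffun {set 'I_n} -> 'F_2} :=
  odflt 0 [pick a | anf_eval a == f].

(* The zero function gets degree 0. *)
Definition deg (n : nat) (f : boolfun n) : nat :=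
  \max_(K : {set 'I_n} | anf f K != 0) #|K|.

Definition hdist (n : nat) (f g : boolfun n) : nat :=
  #|[set x | f x != g x]|.

Definition RM (r n : nat) : {set boolfun n} := [set f | (deg f <= r)%N].

(* The starting point 0 of the arg min belongs to RM r n (lemma RM0 below),   *)
(* so this is the minimum of hdist f over RM r n.                             *)
Definition nl (r n : nat) (f : boolfun n) : nat :=
  hdist f [arg min_(g < (0 : boolfun n) in RM r n) hdist f g].

Definition covering_radius (r n : nat) : nat := \max_(f : boolfun n) nl r f.

Lemma anf_eval_inj n : injective (@anf_eval n).
Proof.
move=> a b eq_ab; apply/ffunP => K.
have [m] := ubnP #|K|; elim: m K => // m IHm K leKm.
have /ffunP/(_ (\row_k (k \in K)%:R)) := eq_ab.
rewrite !ffunE.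
have val_at c : \sum_(L : {set 'I_n}) c L
    * \prod_(k in L) (\row_k0 (k0 \in K)%:R : 'rV['F_2]_n) 0 k
    = c K + \sum_(L : {set 'I_n} | L \proper K) c L.
  rewrite (bigD1 K) //= big1 ?mulr1; last by move=> k kK; rewrite mxE kK.
  congr (_ + _); rewrite big_mkcond [RHS]big_mkcond /=.
  apply: eq_bigr => L _; rewrite properEneq.
  case: eqP => //= _; case: ifPn => [sLK | /subsetPn[k kL kK]].
    by rewrite big1 ?mulr1 // => k kL; rewrite mxE (subsetP sLK).
  by rewrite (bigD1 k) //= mxE (negPf kK) mul0r mulr0.
rewrite !val_at (eq_bigr b); first by move/addIr.
move=> L /proper_card ltLK; apply: IHm; exact: leq_trans ltLK leKm.
Qed.

Lemma anf_evalK n : cancel (@anf_eval n) (@anf n).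
Proof.
move=> a; rewrite /anf; case: pickP => [b /eqP/anf_eval_inj // | /(_ a)].
by rewrite eqxx.
Qed.

Lemma anfK n : cancel (@anf n) (@anf_eval n).
Proof.
have [|g gK Kg] := inj_card_bij (@anf_eval_inj n).
  rewrite !card_ffun card_mx card_Fp // -[#|{set _}|]cardsT -powersetT.
  by rewrite card_powerset cardsT card_ord mul1n.
by move=> f; rewrite -(Kg f) anf_evalK.
Qed.

Lemma RM0 r n : (0 : boolfun n) \in RM r n.
Proof.
have eval0 : anf_eval 0 = 0 :> boolfun n.
  by apply/ffunP => x; rewrite !ffunE big1 // => K _; rewrite ffunE mul0r.
rewrite inE /deg -eval0 anf_evalK big_pred0 // => K.
by rewrite ffunE eqxx.
Qed.

(* Main.v *)
(** Upper bound.  A hyperplane cuts a Boolean function [f] of seven variables into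
    two functions [a] and [b] of six variables.  If some quadratic is within [i]
    of [a], and [b + q] is within [j] of an affine function for every quadratic
    [q], then [f] is within [i + j] of a quadratic.  In six variables [j = 28] is
    always possible, [j = 26] is if [b] has even weight and degree at least 4,
    and [j = 25] is if [b] is a quartic plus a point, by Parseval's identity and
    congruences between Walsh coefficients; cubics, quartics and quintics are
    within 18, 16 and 16 of a quadratic, and the classification of cubics gives
    finer information.  According to the degree of [f] one finds a hyperplane
    for which the bounds of the two halves add up to at most 40.  The exceptions
    are the sums of a cubic and at most five points: a translate of a coset
    leader of the cubic is again one, and can be made to contain enough of the
    points.

    Lower bound.  For the cubic [f40] and every quadratic [q], the square of the
    sum of the signs of [f40 + q] is at most the sum over all directions [a] of
    [sqrt (128 * N a)], where [N a] is the number of [b] for which the second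
    derivative of [f40] along [a] and [b] is constant.  This sum is less than
    [56 ^ 2], so [f40 + q] has weight at least 37, and this weight is a multiple
    of 4 because [f40 + q] is a cubic in seven variables. *)

Require Import Defs.
From Stdlib Require Import ZArith Lia.
From mathcomp Require Import all_boot zify.

Set Implicit Arguments.
Unset Strict Implicit.
Unset Printing Implicit Defensive.

(** * Truth tables and affine moves *)

(** A gluing that needs all of 40 adds 12 + 28, 14 + 26, 16 + 24 or 18 + 22, so each class of
    six-variable functions is described by the bounds it can contribute to such a sum. The bound 28
    improves to 26 from degree 4 on because a function of even weight with no Walsh coefficient of
    absolute value 12 or more is bent, and bent functions of six variables are cubics. Cubics, and
    cubics plus one point, do not share this gain; and a quintic is shown to be within 14 of a
    quadratic except when it is a cubic plus two points. These are the halves to be avoided, and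
    most of the work is the search for a hyperplane that avoids them. For one type of cubics
    separate bounds of the two halves do not suffice. There a quadratic serving both halves at once
    is found by counting: at most 64 quadratics modulo affine functions are bad for one half, and
    more than 64 are good for the other. *)

(* A function of [n] variables is the binary tree of its values: the pair of
   its restrictions to [x_1 = 0] and [x_1 = 1], where [x_1] is called the top
   variable.  [lo k f] says that the degree of [f] is less than [k]: the second
   conjunct is about the derivative in the direction of [x_1]. *)
Fixpoint BF (n : nat) : Type := if n is m.+1 then (BF m * BF m)%type else bool.

Fixpoint xr n : BF n -> BF n -> BF n :=
  if n is m.+1 then fun f g : BF m * BF m => (xr f.1 g.1, xr f.2 g.2) else addb.
Fixpoint zr n : BF n := if n is m.+1 then (zr m, zr m) else false.
Fixpoint wt n : BF n -> nat :=
  if n is m.+1 then fun f : BF m * BF m => wt f.1 + wt f.2 else nat_of_bool.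
Fixpoint lo n (k : nat) : BF n -> bool :=
  if n is m.+1 then fun f : BF m * BF m => lo k f.1 && lo k.-1 (xr f.1 f.2)
  else fun b => (0 < k) || ~~ b.

Lemma xrC n (f g : BF n) : xr f g = xr g f.
Proof. by elim: n f g => [|n IH] f g /=; [exact: addbC | rewrite IH (IH f.2)]. Qed.
Lemma xrA n (f g h : BF n) : xr f (xr g h) = xr (xr f g) h.
Proof. by elim: n f g h => [|n IH] f g h /=; [exact: addbA | rewrite !IH]. Qed.
Lemma xrr n (f : BF n) : xr f f = zr n.
Proof. by elim: n f => [|n IH] f /=; [exact: addbb | rewrite !IH]. Qed.
Lemma xr0 n (f : BF n) : xr f (zr n) = f.
Proof. by elim: n f => [|n IH] f /=; [exact: addbF | rewrite !IH; case: f]. Qed.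
Lemma x0r n (f : BF n) : xr (zr n) f = f. Proof. by rewrite xrC xr0. Qed.
Lemma xrK n (f g : BF n) : xr (xr f g) g = f. Proof. by rewrite -xrA xrr xr0. Qed.
Lemma xKr n (f g : BF n) : xr f (xr f g) = g. Proof. by rewrite xrA xrr x0r. Qed.
Lemma xrAC n (f g h : BF n) : xr (xr f g) h = xr (xr f h) g.
Proof. by rewrite -!xrA (xrC g). Qed.
Lemma xrCA n (f g h : BF n) : xr f (xr g h) = xr g (xr f h).
Proof. by rewrite !xrA (xrC f). Qed.
Lemma xrACA n (a b c d : BF n) : xr (xr a b) (xr c d) = xr (xr a c) (xr b d).
Proof. by rewrite -!xrA (xrCA b). Qed.
Lemma xr_eq0 n (f g : BF n) : xr f g = zr n -> f = g.
Proof. by move=> e; rewrite -[f](xrK f g) e x0r. Qed.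

Lemma lo_zr n k : lo k (zr n).
Proof. by elim: n k => [|n IH] k /=; rewrite ?orbT // xrr !IH. Qed.
Lemma lo_xr n k (f g : BF n) : lo k f -> lo k g -> lo k (xr f g).
Proof.
elim: n k f g => [|n IH] k f g /=; first by case: (0 < k) f g => [] [] [].
by move=> /andP[f1 f2] /andP[g1 g2]; rewrite IH //= xrACA IH.
Qed.
Lemma lo_xrl n k (f g : BF n) : lo k g -> lo k (xr f g) = lo k f.
Proof.
move=> lg; apply/idP/idP => [l|l]; last exact: lo_xr.
by rewrite -(xrK f g) lo_xr.
Qed.
Lemma loW n k m (f : BF n) : k <= m -> lo k f -> lo m f.
Proof.
elim: n k m f => [|n IH] k m f le_km /=; first by case: k le_km => [|k]; case: m => //= _ ->; rewrite orbT.
move=> /andP[f1 f2]; rewrite (IH _ _ _ le_km f1) (IH k.-1) //.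
by rewrite -!subn1 leq_sub2r.
Qed.
Lemma lo0 n (f : BF n) : lo 0 f -> f = zr n.
Proof.
elim: n f => [|n IH] f /=; first by case: f.
move=> /andP[/IH f1 /IH f2]; case: f f1 f2 => [f g] /= ->.
by rewrite x0r => ->.
Qed.
Lemma lo_full n (f : BF n) : lo n.+1 f.
Proof.
elim: n f => [|n IH] f //=.
by rewrite (loW (leqnSn _) (IH _)) IH.
Qed.
Lemma lo2 n k (f g : BF n) : lo k.+1 f -> lo k.+1 ((f, xr f g) : BF n.+1) = lo k g.
Proof. by move=> lf /=; rewrite lf xKr. Qed.

Lemma wt_xr n (f g : BF n) : exists t, wt (xr f g) + t.*2 = wt f + wt g.
Proof.
elim: n f g => [|n IH] f g /=; first by exists (f && g); case: f g => [] [].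
have [s es] := IH f.1 g.1; have [t et] := IH f.2 g.2; exists (s + t).
by rewrite doubleD addnACA es et addnACA.
Qed.
Lemma wt_le n (f g : BF n) : wt (xr f g) <= wt f + wt g.
Proof. by have [t <-] := wt_xr f g; rewrite leq_addr. Qed.
Lemma odd_wt_xr n (f g : BF n) : odd (wt (xr f g)) = odd (wt f) (+) odd (wt g).
Proof. by have [t e] := wt_xr f g; rewrite -oddD -e oddD odd_double addbF. Qed.
Lemma wt0 n (f : BF n) : wt f = 0 -> f = zr n.
Proof.
elim: n f => [|n IH] f /=; first by case: f.
by case: f => a b /= /eqP; rewrite addn_eq0 => /andP[/eqP/IH-> /eqP/IH->].
Qed.
Lemma wt_zr n : wt (zr n) = 0. Proof. by elim: n => //= n ->. Qed.

(** The coefficient of the product of all variables is the sum of all values. *)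
Lemma lo_even n (f : BF n) : lo n f = ~~ odd (wt f).
Proof.
elim: n f => [|n IH] f /=; first by case: f.
by rewrite lo_full IH odd_wt_xr oddD.
Qed.

(* [x_top] is the first coordinate. [Mx j] adds the [j]-th lower coordinate to
   the top one, [Sh j] adds the top coordinate to the [j]-th lower one, [Sw]
   swaps the two top coordinates, [Tr] flips the top one. *)
Inductive mv := Dn of mv | Tr | Sw | Mx of nat | Sh of nat.

(** This is the first half of the function [(a, b)] after the [j]-th lower coordinate has been added
    to the top one. *)
Fixpoint mix n j : BF n -> BF n -> BF n :=
  if n is m.+1 then fun a b : BF m * BF m =>
    if j is i.+1 then (mix i a.1 b.1, mix i a.2 b.2) else (a.1, b.2)
  else fun a b => a.
Fixpoint tr n j : BF n -> BF n :=
  if n is m.+1 then fun f : BF m * BF m => if j is i.+1 then (tr i f.1, tr i f.2) else (f.2, f.1)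
  else fun f => f.
Definition sw n : BF n -> BF n :=
  match n with
  | m.+2 => fun f : BF m.+1 * BF m.+1 => ((f.1.1, f.2.1), (f.1.2, f.2.2))
  | _ => fun f => f
  end.
Fixpoint act1 n (m : mv) : BF n -> BF n :=
  match m with
  | Dn m' => if n is p.+1 then fun f : BF p * BF p => (act1 m' f.1, act1 m' f.2) else fun f => f
  | Tr => if n is p.+1 then fun f : BF p * BF p => (f.2, f.1) else fun f => f
  | Sw => @sw n
  | Mx j => if n is p.+1 then fun f : BF p * BF p => (mix j f.1 f.2, mix j f.2 f.1) else fun f => f
  | Sh j => if n is p.+1 then fun f : BF p * BF p => (f.1, tr j f.2) else fun f => f
  end.
Definition act n (w : seq mv) (f : BF n) : BF n := foldl (fun g m => act1 m g) f w.

Lemma mix_xr n j (a b c d : BF n) :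
  mix j (xr a c) (xr b d) = xr (mix j a b) (mix j c d).
Proof. by elim: n j a b c d => [|n IH] [|j] a b c d //=; rewrite !IH. Qed.
Lemma mixx n j (a : BF n) : mix j a a = a.
Proof. by elim: n j a => [|n IH] [|j] //=; case=> a b; rewrite /= ?IH. Qed.
Lemma mixK n j (a b : BF n) : mix j (mix j a b) (mix j b a) = a.
Proof.
elim: n j a b => [|n IH] [|j] //=; move=> [a1 a2] [b1 b2] //=.
by rewrite !IH.
Qed.
Lemma wt_mix n j (a b : BF n) : wt (mix j a b) + wt (mix j b a) = wt a + wt b.
Proof.
elim: n j a b => [|n IH] [|j] a b //=; first by rewrite addnACA (addnC (wt b.2)) addnACA.
by rewrite addnACA !IH addnACA.
Qed.
Lemma mix_sum n j (a b : BF n) : xr (mix j a b) (mix j b a) = xr a b.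
Proof. by rewrite -mix_xr (xrC b) mixx. Qed.
(** [mix j (zr n) g] is the product of [g] by the [j]-th coordinate, so [mix j a b] is
    [a + x_j (a + b)]. *)
Lemma mixE n j (a b : BF n) : mix j a b = xr a (mix j (zr n) (xr a b)).
Proof. by rewrite -[in LHS](xr0 a) -[b in LHS](xKr a) mix_xr mixx. Qed.
Lemma lo_mix0 n j k (g : BF n) : lo k.-1 g -> lo k (mix j (zr n) g).
Proof.
elim: n j k g => [|n IH] [|j] k g /=; rewrite ?lo_zr ?x0r ?orbT //=.
- by case/andP=> l1 l2; rewrite -[g.2](xKr g.1) lo_xr // (loW (leq_pred _) l2).
- by case/andP=> l1 l2; rewrite IH // -mix_xr xrr IH.
Qed.
Lemma lo_mix n j k (a b : BF n) : lo k a -> lo k.-1 (xr a b) -> lo k (mix j a b).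
Proof. by move=> la lb; rewrite mixE lo_xr // lo_mix0. Qed.

Lemma tr_xr n j (f g : BF n) : tr j (xr f g) = xr (tr j f) (tr j g).
Proof. by elim: n j f g => [|n IH] [|j] f g //=; rewrite !IH. Qed.
Lemma trK n j (f : BF n) : tr j (tr j f) = f.
Proof. by elim: n j f => [|n IH] [|j] //=; case=> f g //=; rewrite !IH. Qed.
Lemma wt_tr n j (f : BF n) : wt (tr j f) = wt f.
Proof. by elim: n j f => [|n IH] [|j] f //=; rewrite ?IH // addnC. Qed.
Lemma lo_dtr n j k (f : BF n) : lo k f -> lo k.-1 (xr f (tr j f)).
Proof.
elim: n j k f => [|n IH] [|j] k f /=; rewrite ?addbb ?orbT //.
- by case/andP=> l1 l2; rewrite (xrC f.2) xrr lo_zr l2.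
- by case/andP=> l1 l2; rewrite IH // xrACA -tr_xr IH.
Qed.
Lemma act1_xr n m (f g : BF n) : act1 m (xr f g) = xr (act1 m f) (act1 m g).
Proof.
elim: m n f g => [m IH|||j|j] //= [|n] f g //=; rewrite ?IH ?mix_xr ?tr_xr //.
by case: n f g.
Qed.
(** As all moves are involutions, the inverse of a word is the reversed word. *)
Lemma act1K n m (f : BF n) : act1 m (act1 m f) = f.
Proof.
elim: m n f => [m IH|||j|j] //= [|n] f //=; rewrite ?IH; try by case: f.
- by case: n f => [|n] [] // [? ?] [? ?].
- by case: f => a b /=; rewrite !mixK.
- by case: f => a b /=; rewrite !trK.
Qed.
Lemma wt_act1 n m (f : BF n) : wt (act1 m f) = wt f.
Proof.
elim: m n f => [m IH|||j|j] //= [|n] f //=; rewrite ?IH ?wt_tr ?wt_mix //.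
  by rewrite addnC.
by case: n f => [|n] f //=; rewrite addnACA.
Qed.
Lemma lo_act1 n m k (f : BF n) : lo k f -> lo k (act1 m f).
Proof.
elim: m n k f => [m IH|||j|j] /=.
- by case=> //= n k f /andP[l1 l2]; rewrite -act1_xr !IH.
- case=> //= n k [a b] /= /andP[l1 l2]; rewrite (xrC b) l2 andbT.
  by rewrite -[b](xKr a) lo_xr // (loW (leq_pred _) l2).
- case=> [|[|n]] k f //=.
  case/and3P=> /andP[l1 l2] l3 l4; rewrite l1 l3 l2 /=.
  by rewrite xrACA.
- by move=> [|n] k f //= /andP[l1 l2]; rewrite mix_sum l2 lo_mix.
- case=> [|n] k f //= /andP[l1 l2]; rewrite l1 /=.
  rewrite -[tr j f.2](xKr f.2) xrA lo_xr //; apply: lo_dtr.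
  by rewrite -[f.2](xKr f.1) lo_xr // (loW (leq_pred _) l2).
Qed.

Lemma act_xr n w (f g : BF n) : act w (xr f g) = xr (act w f) (act w g).
Proof. by elim: w f g => //= m w IH f g; rewrite act1_xr IH. Qed.
Lemma lo_act n w k (f : BF n) : lo k f -> lo k (act w f).
Proof. by elim: w f => //= m w IH f l; apply: IH; apply: lo_act1. Qed.
Lemma wt_act n w (f : BF n) : wt (act w f) = wt f.
Proof. by elim: w f => //= m w IH f; rewrite IH wt_act1. Qed.
Lemma act_cat n v w (f : BF n) : act (v ++ w) f = act w (act v f).
Proof. by rewrite /act foldl_cat. Qed.
Lemma actK n w (f : BF n) : act (rev w) (act w f) = f.
Proof. by elim: w f => //= m w IH f; rewrite rev_cons -cats1 act_cat IH /= act1K. Qed.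
Lemma actVK n w (f : BF n) : act w (act (rev w) f) = f.
Proof. by rewrite -{1}(revK w) actK. Qed.
Lemma lo_actE n w k (f : BF n) : lo k (act w f) = lo k f.
Proof. by apply/idP/idP => [l|]; [rewrite -(actK w f) lo_act | exact: lo_act]. Qed.
Lemma act_Dn n w (f : BF n.+1) : act [seq Dn m | m <- w] f = (act w f.1, act w f.2).
Proof. by elim: w f => [|m w IH] f /=; [case: f | rewrite IH]. Qed.

(** * Points and distances *)

Fixpoint pt (n : nat) : Type := if n is m.+1 then (bool * pt m)%type else unit.
Fixpoint dl n : pt n -> BF n :=
  if n is m.+1 then fun x : bool * pt m => if x.1 then (zr m, dl x.2) else (dl x.2, zr m)
  else fun _ => true.
Fixpoint get n : BF n -> pt n -> bool :=
  if n is m.+1 then fun (f : BF m * BF m) (x : bool * pt m) => get (if x.1 then f.2 else f.1) x.2 else fun b _ => b.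
Fixpoint trs n : pt n -> BF n -> BF n :=
  if n is m.+1 then fun (x : bool * pt m) (f : BF m * BF m) =>
    if x.1 then (trs x.2 f.2, trs x.2 f.1) else (trs x.2 f.1, trs x.2 f.2)
  else fun _ b => b.
Fixpoint padd n : pt n -> pt n -> pt n :=
  if n is m.+1 then fun x y : bool * pt m => (x.1 (+) y.1, padd x.2 y.2) else fun _ _ => tt.
Fixpoint trw n : pt n -> seq mv :=
  if n is m.+1 then fun x : bool * pt m => (if x.1 then [:: Tr] else [::]) ++ [seq Dn w | w <- trw x.2]
  else fun _ => [::].

Lemma trsE n (x : pt n) f : trs x f = act (trw x) f.
Proof.
elim: n x f => [|n IH] //= [[] x] [f g]; rewrite !IH /=.
- by rewrite -(act_Dn _ ((g, f) : BF n.+1)).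
- by rewrite -(act_Dn _ ((f, g) : BF n.+1)).
Qed.
Lemma trs_xr n (x : pt n) f g : trs x (xr f g) = xr (trs x f) (trs x g).
Proof. by rewrite !trsE act_xr. Qed.
Lemma wt_trs n (x : pt n) f : wt (trs x f) = wt f.
Proof. by rewrite trsE wt_act. Qed.
Lemma lo_trs n k (x : pt n) f : lo k (trs x f) = lo k f.
Proof. by rewrite trsE lo_actE. Qed.
Lemma lo_dtrs n k (x : pt n) f : lo k f -> lo k.-1 (xr f (trs x f)).
Proof.
elim: n k x f => [|n IH] k x f /=; first by rewrite addbb orbT.
move=> /andP[l1 l2]; case: x.1 => /=; last by rewrite IH // xrACA -trs_xr IH.
rewrite xrACA (xrC (trs _ f.2)) -trs_xr IH // andbT.
rewrite -[trs _ f.2](xKr (trs x.2 f.1)) -trs_xr xrA lo_xr ?IH // lo_trs.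
exact: l2.
Qed.
Lemma get_trs n (x y : pt n) f : get (trs x f) y = get f (padd x y).
Proof. by elim: n x y f => [|n IH] //= [a x] [b y] [f g] /=; case: a b => [] [] /=; rewrite IH. Qed.
Lemma paddK n (x y : pt n) : padd (padd x y) y = x.
Proof.
elim: n x y => [|n IH] /=; first by case=> [] [].
by case=> a x [b y] /=; rewrite IH addbK.
Qed.
Lemma getP n (f g : BF n) : (forall x, get f x = get g x) -> f = g.
Proof.
elim: n f g => [|n IH] /= f g H; first exact: (H tt).
case: f g H => [f1 f2] [g1 g2] /= H; congr pair; apply: IH => x.
  exact: (H (false, x)).
exact: (H (true, x)).
Qed.
Lemma get_xr n (f g : BF n) x : get (xr f g) x = get f x (+) get g x.
Proof. by elim: n f g x => [|n IH] //= f g [[] x] /=; rewrite IH. Qed.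
Lemma get0 n x : get (zr n) x = false.
Proof. by elim: n x => //= n IH [[] x] /=; rewrite IH. Qed.
Ltac xring := let z := fresh "z" in apply: getP => z; rewrite ?(get_xr, get0);
  by repeat match goal with |- context [get ?f z] => case: (get f z) end.
Lemma wt_dl n (x : pt n) : wt (dl x) = 1.
Proof. by elim: n x => [|n IH] //= [[] x] /=; rewrite IH wt_zr. Qed.
Lemma wt1P n (f : BF n) : wt f = 1 -> exists x, f = dl x.
Proof.
elim: n f => [|n IH] /=; first by case=> // _; exists tt.
case=> f g /=; case ef: (wt f) => [|[|k]] //.
  rewrite add0n => /IH[x ->]; exists (true, x) => /=; by rewrite (wt0 ef).
by rewrite add1n => -[/wt0 ->]; have [x ->] := IH _ ef; exists (false, x).
Qed.
Lemma wt_gt0P n (f : BF n) : 0 < wt f -> exists x, get f x.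
Proof.
elim: n f => [|n IH] /=; first by case=> // _; exists tt.
case=> f g /=; rewrite addn_gt0 => /orP[/IH|/IH] [x xP].
- by exists (false, x).
- by exists (true, x).
Qed.
Lemma wt_xr_dl n (f : BF n) x :
  wt (xr f (dl x)) = if get f x then (wt f).-1 else (wt f).+1.
Proof.
have gt0 m (h : BF m) y : get h y -> 0 < wt h.
  by elim: m h y => [|m IH] h y /=; [case: h | case: y => [[] y] /IH; lia].
elim: n f x => [|n IH] /=; first by case.
case=> f g [[] x] /=; rewrite xr0 IH; case: ifP => // gx.
all: try by have := gt0 _ _ _ gx; lia.
all: by lia.
Qed.

(* [L k f]: some quadratic is within [k] of [f].  [U k f]: whatever quadratic is
   added to [f], an affine function is within [k].  The halves of a function of
   one more variable are to satisfy [L] and [U] (see [glue]): the quadratic of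
   the first half may be extended by any affine function on the second one. *)
Definition L n k (f : BF n) := exists2 q, lo 3 q & wt (xr f q) <= k.
Definition D1 n k (f : BF n) := exists2 l, lo 2 l & wt (xr f l) <= k.
Definition U n k (f : BF n) := forall q, lo 3 q -> D1 k (xr f q).
(** A cubic plus two points. The points may coincide, so cubics are included; [tpE] separates the
    points when the degree is too large for a cubic. *)
Definition tp n (f : BF n) := exists x y, lo 4 (xr f (xr (dl x) (dl y))).

Lemma dl_act n w (x : pt n) : exists y, act w (dl x) = dl y.
Proof. by apply: wt1P; rewrite wt_act wt_dl. Qed.

Lemma L_act n w k (f : BF n) : L k (act w f) -> L k f.
Proof.
by case=> q lq le; exists (act (rev w) q); rewrite ?lo_actE // -(wt_act w) act_xr actVK.
Qed.
Lemma D1_act n w k (f : BF n) : D1 k (act w f) -> D1 k f.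
Proof.
by case=> q lq le; exists (act (rev w) q); rewrite ?lo_actE // -(wt_act w) act_xr actVK.
Qed.
Lemma U_act n w k (f : BF n) : U k (act w f) -> U k f.
Proof. by move=> u q lq; apply: (@D1_act _ w); rewrite act_xr; apply: u; rewrite lo_actE. Qed.
Lemma tp_act n w (f : BF n) : tp (act w f) -> tp f.
Proof.
case=> x [y lf]; have [x' ex] := dl_act (rev w) x; have [y' ey] := dl_act (rev w) y.
exists x', y'; rewrite -(lo_actE w) !act_xr -ex -ey !actVK //.
Qed.
Lemma L_xr n k (f g : BF n) : lo 3 g -> L k (xr f g) -> L k f.
Proof. by move=> lg [q lq le]; exists (xr g q); rewrite ?lo_xr // xrA. Qed.
Lemma U_xr n k (f g : BF n) : lo 3 g -> U k (xr f g) -> U k f.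
Proof.
by move=> lg u q lq; have := u (xr g q) (lo_xr lg lq); rewrite xrA xrK.
Qed.
Lemma D1_xr n k (f g : BF n) : lo 2 g -> D1 k (xr f g) -> D1 k f.
Proof. by move=> lg [q lq le]; exists (xr g q); rewrite ?lo_xr // xrA. Qed.
Lemma LW n k m (f : BF n) : k <= m -> L k f -> L m f.
Proof. by move=> km [q lq le]; exists q => //; apply: leq_trans km. Qed.
Lemma D1_dl n k (f : BF n) x : D1 k f -> D1 k.+1 (xr f (dl x)).
Proof.
case=> l ll le; exists l => //; rewrite xrAC; apply: leq_trans (wt_le _ _) _.
by rewrite wt_dl addn1.
Qed.
Lemma U_dl n k (f : BF n) x : U k f -> U k.+1 (xr f (dl x)).
Proof. by move=> u q lq; rewrite xrAC; apply: D1_dl; apply: u. Qed.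
Lemma L_dl n k (f : BF n) x : L k f -> L k.+1 (xr f (dl x)).
Proof.
case=> l ll le; exists l => //; rewrite xrAC; apply: leq_trans (wt_le _ _) _.
by rewrite wt_dl addn1.
Qed.

Lemma glue_D1 n a b (f g q : BF n) :
  lo 3 q -> wt (xr f q) <= a -> D1 b (xr g q) -> L (a + b) ((f, g) : BF n.+1).
Proof.
move=> lq wq [l ll wl]; exists ((q, xr q l) : BF n.+1).
  by rewrite lo2.
by rewrite /= leq_add // xrA.
Qed.
Lemma glue n a b (f g : BF n) : L a f -> U b g -> L (a + b) ((f, g) : BF n.+1).
Proof. by move=> [q lq wq] u; exact: glue_D1 lq wq (u _ lq). Qed.
Lemma L_swap n k (f g : BF n) : L k ((g, f) : BF n.+1) -> L k ((f, g) : BF n.+1).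
Proof. by move=> l; apply: (@L_act n.+1 [:: Tr]). Qed.
Lemma glueC n a b (f g : BF n) : U a f -> L b g -> L (a + b) ((f, g) : BF n.+1).
Proof. by move=> u l; apply: L_swap; rewrite addnC; apply: glue. Qed.

(* Translating a cubic changes it by a quadratic, so every translate of a coset
   leader of [c] modulo the quadratics is again in the coset of [c]. *)
Lemma trs_coset n (x : pt n) (c q : BF n) : lo 4 c -> lo 3 q ->
  exists2 q', lo 3 q' & xr c q' = trs x (xr c q).
Proof.
move=> lc lq; exists (xr (xr c (trs x c)) (trs x q)).
  by rewrite lo_xr ?lo_trs //; apply: (lo_dtrs (k := 4)).
by rewrite -xrA xKr trs_xr.
Qed.
Lemma leader_at n k (c : BF n) x : lo 4 c -> L k c ->
  L 0 c \/ exists q, [/\ lo 3 q, wt (xr c q) <= k & get (xr c q) x].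
Proof.
move=> lc [q lq wq]; case: (posnP (wt (xr c q))) => [w0|/wt_gt0P[y yP]].
  by left; exists q; rewrite // w0.
right; have [q' lq' e] := trs_coset (padd y x) lc lq; exists q'.
by rewrite e wt_trs get_trs paddK.
Qed.
Lemma L_cubic_dl n k (c : BF n) x : 0 < k -> lo 4 c -> L k c -> L k (xr c (dl x)).
Proof.
move=> k0 lc /(leader_at x lc) [/(L_dl x)|[q [lq wq gx]]]; first exact: LW.
by exists q => //; rewrite xrAC wt_xr_dl gx (leq_trans (leq_pred _)).
Qed.
(** A leader that contains [x] loses this point, so the distance drops by one. For an empty leader
    the distance becomes 1 instead, whence [1 < k]. *)
Lemma L_cubic_dl1 n k (c : BF n) x : 1 < k -> lo 4 c -> L k c -> L k.-1 (xr c (dl x)).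
Proof.
move=> k0 lc /(leader_at x lc) [/(L_dl x)|[q [lq wq gx]]]; first by apply: LW; case: k k0 => [|[]].
by exists q => //; rewrite xrAC wt_xr_dl gx -!subn1 leq_sub2r.
Qed.
Lemma L_cubic_dl2 n k (c : BF n) x y : 1 < k -> lo 4 c -> L k c ->
  L k (xr c (xr (dl x) (dl y))).
Proof.
move=> k0 lc lk; rewrite xrA -(prednK (ltnW k0)).
by apply: L_dl; apply: L_cubic_dl1.
Qed.

(** The [n] coordinates of the point are used to cancel the [n] coefficients of degree [n - 1]: each
    coordinate is decided by the parity of the weight of a half. *)
Lemma odd_split n (f : BF n) : odd (wt f) -> exists x, lo n.-1 (xr f (dl x)).
Proof.
elim: n f => [|n IH] f /=; first by case: f => // _; exists tt.
rewrite oddD => od; case: (boolP (odd (wt f.1))) => o1; rewrite ?o1 ?(negbTE o1) in od.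
- have [|x lx] := IH (xr f.1 f.2); first by rewrite odd_wt_xr o1 (negbTE (_ : ~~ odd (wt f.2))) //; move: od; case: odd.
  exists (false, x) => /=; rewrite xr0 lo_even odd_wt_xr o1 wt_dl /=.
  by rewrite xrAC.
- have [|x lx] := IH (xr f.1 f.2); first by rewrite odd_wt_xr (negbTE o1); move: od; case: odd.
  exists (true, x) => /=; rewrite xr0 lo_even o1 /=.
  by rewrite xrA.
Qed.

(* [res i f] is the restriction of [f] to the hyperplane [x_i = 0]. *)
Fixpoint res n i : BF n.+1 -> BF n :=
  if i is j.+1 then
    match n with m.+1 => fun f : BF m.+1 * BF m.+1 => (@res m j f.1, @res m j f.2) | 0 => fun f : BF 0 * BF 0 => f.1 end
  else fun f : BF n * BF n => f.1.
Fixpoint up i : seq mv := if i is j.+1 then [seq Dn m | m <- up j] ++ [:: Sw] else [::].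
Lemma up_res n i (f : BF n.+1) : i <= n -> (act (up i) f).1 = res i f.
Proof.
elim: i n f => [|i IH] [|n] f //= le_in; rewrite act_cat act_Dn /=.
by rewrite -!IH.
Qed.
Lemma res_xr n i (f g : BF n.+1) : xr (res i f) (res i g) = res i (xr f g).
Proof. by elim: i n f g => [|i IH] [|n] f g //=; rewrite -!IH. Qed.
(** A monomial of degree [k] in more than [k] variables misses one of them, and it survives when
    that variable is set to 0. *)
Lemma res_lo n k (f : BF n.+1) : k <= n -> lo k.+1 f -> ~~ lo k f ->
  exists2 i, i <= n & ~~ lo k (res i f).
Proof.
elim: n k f => [|n IH] k f le_kn.
  by case: k le_kn => // _ l nl; exists 0 => //; move: l nl; case: f => [[] []].
have [l1 /andP[_ l2] nl|] := boolP (@lo n.+1 k f.1); last by exists 0.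
have {}nl : ~~ @lo n.+1 k.-1 (@xr n.+1 f.1 f.2) by apply: contra nl => l; apply/andP.
case: k le_kn l1 l2 nl => [|k] le_kn l1 l2 nl; first by case/negP: nl; exact: l2.
have [|i le_in li] := IH k (@xr n.+1 f.1 f.2) _ l2 nl; first by [].
by exists i.+1 => //=; rewrite negb_and res_xr li orbT.
Qed.

#[local] Arguments Z.mul : simpl never.
#[local] Arguments Z.add : simpl never.
#[local] Arguments Z.sub : simpl never.
#[local] Arguments Z.of_nat : simpl never.
(** * Walsh coefficients *)

Fixpoint BZ (n : nat) : Type := if n is m.+1 then (BZ m * BZ m)%type else Z.
Fixpoint zadd n : BZ n -> BZ n -> BZ n :=
  if n is m.+1 then fun f g : BZ m * BZ m => (zadd f.1 g.1, zadd f.2 g.2) else Z.add.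
Fixpoint zsub n : BZ n -> BZ n -> BZ n :=
  if n is m.+1 then fun f g : BZ m * BZ m => (zsub f.1 g.1, zsub f.2 g.2) else Z.sub.
Fixpoint zdot n : BZ n -> BZ n -> Z :=
  if n is m.+1 then fun f g : BZ m * BZ m => (zdot f.1 g.1 + zdot f.2 g.2)%Z else Z.mul.
Fixpoint gz n : BZ n -> pt n -> Z :=
  if n is m.+1 then fun (f : BZ m * BZ m) (x : bool * pt m) => gz (if x.1 then f.2 else f.1) x.2 else fun z _ => z.
Fixpoint zmax n : BZ n -> Z :=
  if n is m.+1 then fun f : BZ m * BZ m => Z.max (zmax f.1) (zmax f.2) else Z.abs.
Fixpoint W n : BF n -> BZ n :=
  if n is m.+1 then fun f : BF m * BF m => let a := W f.1 in let b := W f.2 in (zadd a b, zsub a b)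
  else fun b => if b then (-1)%Z else 1%Z.
Fixpoint one n : BF n := if n is m.+1 then (one m, one m) else true.
Fixpoint lin n : pt n -> BF n :=
  if n is m.+1 then fun u : bool * pt m => (lin u.2, if u.1 then xr (lin u.2) (one m) else lin u.2)
  else fun _ => false.
Definition zn (n : nat) := Z.of_nat n.

Lemma gz_add n (f g : BZ n) u : gz (zadd f g) u = (gz f u + gz g u)%Z.
Proof. by elim: n f g u => //= n IH f g u; case: u.1. Qed.
Lemma gz_sub n (f g : BZ n) u : gz (zsub f g) u = (gz f u - gz g u)%Z.
Proof. by elim: n f g u => //= n IH f g u; case: u.1. Qed.
Lemma wt_one n (f : BF n) : zn (wt (xr f (one n))) = (zn (2 ^ n) - zn (wt f))%Z.
Proof.
rewrite /zn; elim: n f => [|n IH] /= f; first by case: f.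
by rewrite expnS; have := IH f.1; have := IH f.2; lia.
Qed.
Lemma lo_one n : lo 1 (one n).
Proof. by elim: n => //= n ->; rewrite xrr lo_zr. Qed.
Lemma lo_lin n (u : pt n) : lo 2 (lin u).
Proof.
elim: n u => //= n IH u; rewrite IH; case: u.1; rewrite ?xKr ?lo_one //.
by rewrite xrr lo_zr.
Qed.
Lemma WE n (f : BF n) u : gz (W f) u = (zn (2 ^ n) - 2 * zn (wt (xr f (lin u))))%Z.
Proof.
elim: n f u => [|n IH] /= f u; first by case: f.
rewrite expnS; case: u => [[] u] /=; rewrite ?gz_add ?gz_sub !IH ?xrA /zn; last by lia.
by have := wt_one (xr f.2 (lin u)); rewrite /zn; lia.
Qed.
Lemma gz_le n (T : BZ n) u : (Z.abs (gz T u) <= zmax T)%Z.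
Proof.
elim: n T u => /= [|n IH] T u; first exact: Z.le_refl.
by have h1 := IH T.1 u.2; have h2 := IH T.2 u.2; case: u.1; lia.
Qed.
Lemma zmaxP n (T : BZ n) : exists u, Z.abs (gz T u) = zmax T.
Proof.
elim: n T => [|n IH] /= T; first by exists tt.
have [u eu] := IH T.1; have [v ev] := IH T.2.
have [le|lt] := Z.max_spec (zmax T.1) (zmax T.2).
  by exists (true, v) => /=; lia.
by exists (false, u) => /=; lia.
Qed.
Lemma D1_W n k (f : BF n) : (zn (2 ^ n) - 2 * zn k <= zmax (W f))%Z -> D1 k f.
Proof.
have [u <-] := zmaxP (W f); rewrite WE => le.
have := wt_one (xr f (lin u)); rewrite -xrA => e1.
case: (leqP (wt (xr f (lin u))) k) => [le1|lt1]; first by exists (lin u); rewrite ?lo_lin.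
exists (xr (lin u) (one n)); last by rewrite /zn in le e1 *; lia.
by rewrite lo_xr ?lo_lin // (loW _ (lo_one n)).
Qed.

Lemma zdot_had n (a b c d : BZ n) :
  (zdot (zadd a b) (zadd c d) + zdot (zsub a b) (zsub c d) = 2 * (zdot a c + zdot b d))%Z.
Proof.
elim: n a b c d => [|n IH] /= a b c d; first by change Z in a, b, c, d; nia.
by have := IH a.1 b.1 c.1 d.1; have := IH a.2 b.2 c.2 d.2; lia.
Qed.
Lemma plancherel n (f g : BF n) :
  zdot (W f) (W g) = (zn (2 ^ n) * (zn (2 ^ n) - 2 * zn (wt (xr f g))))%Z.
Proof.
rewrite /zn; elim: n f g => [|n IH] /= f g; first by case: f g => [] [].
by rewrite expnS zdot_had !IH; nia.
Qed.
Lemma parseval n (f : BF n) : zdot (W f) (W f) = (zn (2 ^ n) * zn (2 ^ n))%Z.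
Proof. by rewrite plancherel xrr wt_zr /zn; lia. Qed.

Lemma zdot_le n (p q r : Z) (A B : BZ n) :
  (forall u, p * (gz A u * gz B u) <= q * (gz B u * gz B u) + r)%Z ->
  (p * zdot A B <= q * zdot B B + r * zn (2 ^ n))%Z.
Proof.
rewrite /zn; elim: n A B => [|n IH] /= A B H; first by change Z in A, B; have := H tt => /=; lia.
rewrite expnS.
have h1 := IH A.1 B.1 (fun u => H (false, u)); have h2 := IH A.2 B.2 (fun u => H (true, u)).
by nia.
Qed.
Lemma zdot_eq n (c : Z) (A : BZ n) : (forall u, gz A u * gz A u <= c)%Z ->
  zdot A A = (c * zn (2 ^ n))%Z -> forall u, (gz A u * gz A u = c)%Z.
Proof.
rewrite /zn; elim: n A => [|n IH] /= A H e u; first by change Z in A; have := H tt; move: e; case: u => /=; lia.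
rewrite expnS in e.
have a1 u' : (gz A.1 u' * gz A.1 u' <= c)%Z by apply: (H (false, u')).
have a2 u' : (gz A.2 u' * gz A.2 u' <= c)%Z by apply: (H (true, u')).
have h1 : (1 * zdot A.1 A.1 <= 0 * zdot A.1 A.1 + c * zn (2 ^ n))%Z.
  by apply: zdot_le => u'; have := a1 u'; nia.
have h2 : (1 * zdot A.2 A.2 <= 0 * zdot A.2 A.2 + c * zn (2 ^ n))%Z.
  by apply: zdot_le => u'; have := a2 u'; nia.
rewrite /zn in h1 h2.
by case: u => [[] u] /=; apply: IH => //; nia.
Qed.

(** * Products, parity of weights, and bounds from Parseval's identity *)

Fixpoint an n : BF n -> BF n -> BF n :=
  if n is m.+1 then fun f g : BF m * BF m => (an f.1 g.1, an f.2 g.2) else andb.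
Lemma wt_an n (f g : BF n) : wt (xr f g) + (wt (an f g)).*2 = wt f + wt g.
Proof.
elim: n f g => [|n IH] /= f g; first by case: f g => [] [].
by have := IH f.1 g.1; have := IH f.2 g.2; lia.
Qed.
Lemma an_xrr n (f g h : BF n) : an f (xr g h) = xr (an f g) (an f h).
Proof. by elim: n f g h => [|n IH] f g h /=; [case: f g h => [] [] | rewrite !IH]. Qed.
Lemma an_xrl n (f g h : BF n) : an (xr g h) f = xr (an g f) (an h f).
Proof. by elim: n f g h => [|n IH] f g h /=; [case: f g h => [] [] [] | rewrite !IH]. Qed.
Lemma an0 n (f : BF n) : an f (zr n) = zr n.
Proof. by elim: n f => [|n IH] f /=; [case: f | rewrite !IH]. Qed.
Lemma a0n n (f : BF n) : an (zr n) f = zr n.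
Proof. by elim: n f => [|n IH] f //=; rewrite !IH. Qed.
Lemma lo_an n a b (f g : BF n) : lo a.+1 f -> lo b.+1 g -> lo (a + b).+1 (an f g).
Proof.
elim: n a b f g => [|n IH] a b f g //= /andP[f1 f2] /andP[g1 g2]; rewrite IH //=.
have -> : xr (an f.1 g.1) (an f.2 g.2) = xr (an f.1 (xr g.1 g.2)) (an (xr f.1 f.2) g.2).
  by rewrite an_xrr an_xrl -xrA xKr.
have g2' : lo b.+1 g.2 by rewrite -[g.2](xKr g.1) lo_xr // (loW (leqnSn _)).
apply: lo_xr.
  case: b g1 g2 g2' => [|b] g1 g2 g2'; first by rewrite (lo0 g2) an0 lo_zr.
  by rewrite addnS; apply: IH.
case: a f1 f2 => [|a] f1 f2; first by rewrite (lo0 f2) a0n lo_zr.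
by rewrite addSn; apply: IH.
Qed.

Fixpoint allpt n : (pt n -> bool) -> bool :=
  if n is m.+1 then fun p => allpt (fun x => p (false, x)) && allpt (fun x => p (true, x))
  else fun p => p tt.
Lemma allptP n (p : pt n -> bool) : allpt p -> forall x, p x.
Proof.
elim: n p => [|n IH] p /=; first by move=> h [].
by case/andP=> /IH h1 /IH h2 [[] x]; [exact: h2 | exact: h1].
Qed.

(** The mean square of the 64 coefficients is 64, so one of them has absolute value at least 8, and
    (64 - 8) / 2 = 28. *)
Lemma D1_28 (f : BF 6) : D1 28 f.
Proof.
apply: D1_W; case: (Z.leb_spec 8 (zmax (W f))) => [|lt]; first by rewrite /zn; lia.
have h : (1 * zdot (W f) (W f) <= 0 * zdot (W f) (W f) + 49 * zn (2 ^ 6))%Z.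
  by apply: zdot_le => u; have := @gz_le 6 (W f) u; nia.
by move: h; rewrite parseval /zn; lia.
Qed.
Lemma U_28 (f : BF 6) : U 28 f. Proof. by move=> q _; apply: D1_28. Qed.

Lemma W_mod4 n (f : BF n) u : lo n f -> 2 < n -> (gz (W f) u mod 4 = 0)%Z.
Proof.
case: n f u => [|[|[|n]]] // f u lf _; rewrite WE.
have : lo n.+3 (xr f (lin u)) by rewrite lo_xr // (loW _ (lo_lin u)).
rewrite lo_even => /negbTE e; have := odd_double_half (wt (xr f (lin u))).
rewrite e add0n => <-; rewrite /zn !expnS.
set a := 2 ^ n; set b := _./2.
have -> : (Z.of_nat (2 * (2 * (2 * a))) - 2 * Z.of_nat b.*2 = (2 * Z.of_nat a - Z.of_nat b) * 4)%Z by lia.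
exact: Z_mod_mult.
Qed.

(* [sk K f] counts [f] on the subcube of the points below [K]; its parity is
   the coefficient of the monomial [K] in [f]. *)
Fixpoint sk n : pt n -> BF n -> nat :=
  if n is m.+1 then fun (K : bool * pt m) (f : BF m * BF m) => if K.1 then sk K.2 f.1 + sk K.2 f.2 else sk K.2 f.1
  else fun _ b => b.
Fixpoint nk n : pt n -> nat := if n is m.+1 then fun K : bool * pt m => K.1 + nk K.2 else fun _ => 0.
Lemma odd_sk_xr n (K : pt n) f g : odd (sk K (xr f g)) = odd (sk K f) (+) odd (sk K g).
Proof.
elim: n K f g => [|n IH] K f g /=; first by case: f g => [] [].
by case: K.1; rewrite ?oddD !IH // addbACA.
Qed.
Lemma sk_lo n k (f : BF n) : (forall K, k <= nk K -> ~~ odd (sk K f)) -> lo k f.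
Proof.
elim: n k f => [|n IH] k f /= H; first by have := H tt; case: k {H} => //=; case: f; auto.
rewrite !IH // => K le; last exact: (H (false, K)).
by have := H (true, K); rewrite /= odd_sk_xr oddD; apply; lia.
Qed.
(** The sum of the coefficients at the frequencies that vanish on [K]; [PK_W] is Poisson summation
    over the subcube below [K]. *)
Fixpoint PK n : pt n -> BZ n -> Z :=
  if n is m.+1 then fun (K : bool * pt m) (T : BZ m * BZ m) => if K.1 then PK K.2 T.1 else (PK K.2 T.1 + PK K.2 T.2)%Z
  else fun _ z => z.
Lemma PK_add n K (a b : BZ n) : PK K (zadd a b) = (PK K a + PK K b)%Z.
Proof. by elim: n K a b => //= n IH K a b; case: K.1; rewrite !IH; lia. Qed.
Lemma PK_sub n K (a b : BZ n) : PK K (zsub a b) = (PK K a - PK K b)%Z.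
Proof. by elim: n K a b => //= n IH K a b; case: K.1; rewrite !IH; lia. Qed.
Lemma nk_le n (K : pt n) : nk K <= n.
Proof. by elim: n K => //= n IH K; have := IH K.2; case: K.1; lia. Qed.
Lemma PK_W n K (f : BF n) :
  PK K (W f) = (zn (2 ^ (n - nk K)) * (zn (2 ^ nk K) - 2 * zn (sk K f)))%Z.
Proof.
rewrite /zn; elim: n K f => [|n IH] /= K f; first by case: f.
have := nk_le K.2; have := IH K.2 f.1; have := IH K.2 f.2.
case: K.1; rewrite /= !PK_add ?PK_sub => -> ->.
  by rewrite add1n subSS expnS; nia.
by move=> le; rewrite add0n subSn // expnS; nia.
Qed.
Lemma PK_mod n K (T : BZ n) : (forall u, gz T u mod 16 = 8)%Z ->
  (PK K T mod 16 = (8 * zn (2 ^ (n - nk K))) mod 16)%Z.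
Proof.
rewrite /zn; elim: n K T => [|n IH] /= K T H; first by rewrite (H tt).
have h1 := IH K.2 T.1 (fun u => H (false, u)); have h2 := IH K.2 T.2 (fun u => H (true, u)).
case: K.1; first by rewrite add1n subSS.
rewrite add0n subSn ?nk_le // expnS Z.add_mod // h1 h2 -Z.add_mod //.
by congr (_ mod _)%Z; lia.
Qed.

(** Both 8 and -8 are 8 modulo 16, so the signs of the coefficients do not matter modulo 16, and
    Poisson summation determines the parity of [sk K f] as soon as [K] has at least four
    elements. *)
Lemma bent_cubic (f : BF 6) : (forall u, gz (W f) u * gz (W f) u = 64)%Z -> lo 4 f.
Proof.
move=> H; have H8 u : (gz (W f) u mod 16 = 8)%Z.
  have /Z.mul_eq_0[e|e] : ((gz (W f) u - 8) * (gz (W f) u + 8) = 0)%Z by have := H u; lia.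
    by have -> : gz (W f) u = 8%Z by lia.
  by have -> : gz (W f) u = (-8)%Z by lia.
apply: sk_lo => K le; have := nk_le K; have := PK_mod K H8; rewrite PK_W /zn.
set s := sk K f; move: le; case: (nk K) => [|[|[|[|[|[|[|m]]]]]]] // _ e _.
- have {}e : (4 * (16 - 2 * Z.of_nat s) mod 16 = 32 mod 16)%Z by exact: e.
  by move: e; Z.div_mod_to_equations; lia.
- have {}e : (2 * (32 - 2 * Z.of_nat s) mod 16 = 16 mod 16)%Z by exact: e.
  by move: e; Z.div_mod_to_equations; lia.
- have {}e : (1 * (64 - 2 * Z.of_nat s) mod 16 = 8 mod 16)%Z by exact: e.
  by move: e; Z.div_mod_to_equations; lia.
Qed.

(** Otherwise all coefficients, being multiples of 4, would be at most 8 in absolute value; by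
    Parseval they would all be exactly 8, and the function would be bent. *)
Lemma zmax12 (f : BF 6) : lo 6 f -> ~~ lo 4 f -> (12 <= zmax (W f))%Z.
Proof.
move=> l6 /negP l4; case: (Z.leb_spec 12 (zmax (W f))) => // lt; case: l4.
apply: bent_cubic; apply: zdot_eq; last by rewrite parseval /zn; lia.
move=> u; have := @gz_le 6 (W f) u; have := @W_mod4 6 f u l6 isT => m le.
have [a ea] : exists a, gz (W f) u = (4 * a)%Z.
  by exists (gz (W f) u / 4)%Z; move: m; Z.div_mod_to_equations; lia.
rewrite ea in le *; have [h1 h2] : (-2 <= a /\ a <= 2)%Z by lia.
by nia.
Qed.
Lemma D1_26 (f : BF 6) : lo 6 f -> ~~ lo 4 f -> D1 26 f.
Proof. by move=> l6 l4; apply: D1_W; have := zmax12 l6 l4; rewrite /zn; lia. Qed.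
Lemma U_26 (f : BF 6) : lo 6 f -> ~~ lo 4 f -> U 26 f.
Proof.
move=> l6 l4 q lq; apply: D1_26; first by rewrite lo_xr // (loW _ lq).
by rewrite lo_xrl // (loW _ lq).
Qed.

(** The product of a quartic by a linear function has degree at most 5, hence even weight; so the
    weights of all [f + lin u] agree modulo 4. *)
Lemma W_mod8 (f : BF 6) u v : lo 5 f -> ((gz (W f) u - gz (W f) v) mod 8 = 0)%Z.
Proof.
move=> l5; have key w : exists t, wt (xr f (lin w)) + t * 4 = wt f + wt (lin w).
  have : lo 6 (an f (lin w)) := lo_an (a := 4) (b := 1) l5 (lo_lin w).
  rewrite lo_even => /negbTE ev; have := odd_double_half (wt (an f (lin w))).
  by rewrite ev add0n => e; exists (wt (an f (lin w)))./2; have := wt_an f (lin w); lia.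
have lin4 w : exists t, wt (lin w : BF 6) = t * 4.
  have /(_ w)/eqP e := @allptP 6 (fun w => wt (lin w) == (wt (lin w) %/ 4) * 4) isT.
  by eexists; exact: e.
have [[t et] [s es]] := (key u, key v); have [[a ea] [b eb]] := (lin4 u, lin4 v).
rewrite !WE /zn.
set x := wt (xr f (lin u)) in et *; set y := wt (xr f (lin v)) in es *.
have -> : (Z.of_nat (2 ^ 6) - 2 * Z.of_nat x - (Z.of_nat (2 ^ 6) - 2 * Z.of_nat y)
  = (Z.of_nat t - Z.of_nat a - (Z.of_nat s - Z.of_nat b)) * 8)%Z by lia.
exact: Z_mod_mult.
Qed.

(* When some [W f u] is [12] all of them are [4] modulo [8]; if adding the point
   [x] decreased every [12], the inner product of the two transforms would be
   smaller than the [64 * 62] given by Plancherel. *)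
Lemma D1_25 (f : BF 6) x : lo 5 f -> ~~ lo 4 f -> D1 25 (xr f (dl x)).
Proof.
move=> l5 l4; have l6 : lo 6 f by apply: loW l5.
case: (Z.leb_spec 16 (zmax (W f))) => [le|lt].
  by apply: D1_dl; apply: D1_W; rewrite /zn; lia.
case: (Z.leb_spec 14 (zmax (W (xr f (dl x))))) => [le|lt'].
  by apply: D1_W; rewrite /zn; lia.
have ge := zmax12 l6 l4; have [v ev] := zmaxP (W f).
have vals u : exists a, (gz (W f) u = 8 * a + 4)%Z.
  have := W_mod8 u v l5; have := @W_mod4 6 f v l6 isT => m4 m8.
  have e12 : (gz (W f) v = 12 \/ gz (W f) v = -12)%Z.
    by move: m4; Z.div_mod_to_equations; lia.
  exists ((gz (W f) u - 4) / 8)%Z.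
  by case: e12 => e; rewrite e in m8; move: m8; Z.div_mod_to_equations; lia.
(* The constants 4, 3 and 48 give equality in both extreme cases: 10 against 12, and 6 against 4.
   Plancherel then yields 4 * 64 * 62 = 15872 on the left and only 15360 on the right. *)
have h : (4 * zdot (W (xr f (dl x))) (W f) <= 3 * zdot (W f) (W f) + 48 * zn (2 ^ 6))%Z.
  apply: zdot_le => u; have [a ea] := vals u.
  have := @gz_le 6 (W f) u; have := @gz_le 6 (W (xr f (dl x))) u.
  have : (gz (W (xr f (dl x))) u = gz (W f) u + 2 \/ gz (W (xr f (dl x))) u = gz (W f) u - 2)%Z.
    rewrite !WE xrAC wt_xr_dl /zn; case: ifP => gx; last by lia.
    have : 0 < wt (xr f (lin u)); last by lia.
    by case: posnP => // /wt0 e; move: gx; rewrite e -(xrr f) get_xr addbb.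
  have : (a = -2 \/ a = -1 \/ a = 0 \/ a = 1)%Z by have := @gz_le 6 (W f) u; lia.
  by rewrite ea; case=> [->|[->|[->|->]]]; lia.
move: h; rewrite parseval plancherel xrAC xrr x0r wt_dl /zn; lia.
Qed.

(** * Monomials and orbits *)

Fixpoint mons n d : seq (BF n) :=
  if n is m.+1 then
    [seq ((g, g) : BF m.+1) | g <- mons m d] ++
    (if d is e.+1 then [seq ((zr m, g) : BF m.+1) | g <- mons m e] else [::])
  else if d is 0 then [:: true] else [::].
Fixpoint comb n (bs : seq bool) (ms : seq (BF n)) {struct ms} : BF n :=
  if ms is m :: ms' then
    if bs is b :: bs' then if b then xr m (comb bs' ms') else comb bs' ms' else zr n
  else zr n.
(* The degree-[d] coefficients of [f], in the order of [mons n d]. *)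
Fixpoint cf n d : BF n -> seq bool :=
  if n is m.+1 then fun f : BF m * BF m =>
    cf d f.1 ++ (if d is e.+1 then cf e (xr f.1 f.2) else [::])
  else fun b => if d is 0 then [:: b] else [::].

Lemma comb_cat n (a b : seq bool) (s t : seq (BF n)) : size a = size s ->
  comb (a ++ b) (s ++ t) = xr (comb a s) (comb b t).
Proof.
elim: s a => [|m s IH] [|x a] //=; first by rewrite x0r.
by move=> [e]; rewrite IH //; case: x; rewrite ?xrA.
Qed.
Lemma comb_map1 n bs (s : seq (BF n)) :
  comb bs [seq ((g, g) : BF n.+1) | g <- s] = (comb bs s, comb bs s).
Proof. by elim: s bs => [|m s IH] [|[] bs] //=; rewrite IH. Qed.
Lemma comb_map2 n bs (s : seq (BF n)) :
  comb bs [seq ((zr n, g) : BF n.+1) | g <- s] = (zr n, comb bs s).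
Proof. by elim: s bs => [|m s IH] [|[] bs] //=; rewrite IH ?x0r. Qed.

Lemma size_cf n d (f : BF n) : size (cf d f) = size (mons n d).
Proof.
elim: n d f => [|n IH] [|d] f //=; rewrite !size_cat !size_map ?IH //.
Qed.
Lemma lo_cf n d (f : BF n) : lo d.+1 f -> lo d (xr f (comb (cf d f) (mons n d))).
Proof.
elim: n d f => [|n IH] [|d] /= f; rewrite ?orbT //.
- by case: f.
- move=> /andP[l1 /lo0 e]; rewrite !cats0 comb_map1 /= IH //=.
  by rewrite xrACA xrr xr0 e lo_zr.
move=> /andP[l1 l2]; rewrite comb_cat ?size_cf ?size_map ?size_cf // comb_map1 comb_map2 /=.
by rewrite xr0 IH //= xrACA xKr IH.
Qed.

Fixpoint allb k (p : seq bool -> bool) : bool :=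
  if k is j.+1 then allb j (fun v => p (false :: v)) && allb j (fun v => p (true :: v))
  else p [::].
Lemma allbP k p : allb k p -> forall v, size v = k -> p v.
Proof.
elim: k p => [|k IH] p /=; first by move=> h [].
by case/andP=> h1 h2 [|[] v] //= [/IH]; [move/(_ _ h2) | move/(_ _ h1)].
Qed.
Fixpoint allc n (ms : seq (BF n)) (f : BF n) (p : BF n -> bool) : bool :=
  if ms is m :: ms' then allc ms' f p && allc ms' (xr f m) p else p f.
Lemma allcP n (ms : seq (BF n)) f p : allc ms f p -> forall v, p (xr f (comb v ms)).
Proof.
elim: ms f => [|m ms IH] f /=; first by move=> h v /=; rewrite xr0.
case/andP=> /IH h1 /IH h2 [|[] v]; [|by rewrite xrA|exact: h1].
by have := h1 [::]; case: (ms).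
Qed.

Definition d1b n (k : nat) (f : BF n) : bool := (zn (2 ^ n) - 2 * zn k <=? zmax (W f))%Z.
Lemma d1bP n k (f : BF n) : d1b k f -> D1 k f.
Proof. by move/Z.leb_le/D1_W. Qed.
Definition ub n k (f : BF n) : bool := allc (mons n 2) f (@d1b n k).
Lemma ubP n k (f : BF n) : ub k f -> U k f.
Proof.
move=> h q lq; have := lo_cf lq; set c := comb _ _ => lc.
by apply: (D1_xr lc); rewrite -xrA xKr; apply: d1bP; apply: allcP.
Qed.

(* The stored words are not trusted: each use checks where they lead. *)
Inductive trie := TE | TN of option (nat * seq mv) & trie & trie.
Fixpoint tget (t : trie) (v : seq bool) : option (nat * seq mv) :=
  if t is TN o l r then if v is b :: v' then tget (if b then r else l) v' else o else None.
Fixpoint tset (t : trie) (v : seq bool) (x : nat * seq mv) : trie :=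
  let: (o, l, r) := if t is TN o l r then (o, l, r) else (None, TE, TE) in
  match v with
  | [::] => TN (Some x) l r
  | b :: v' => if b then TN o l (tset r v' x) else TN o (tset l v' x) r
  end.
Section Orbits.
Variables (n : nat) (ck : pred (BF n)) (bld : seq bool -> BF n) (rd : BF n -> seq bool) (ws : seq (seq mv)).
(** Breadth-first search on coefficient vectors. As [rev u] undoes [u], the word [rev u ++ w] leads
    from the new vector back to the representative. *)
Fixpoint orb_step (v : seq bool) (i : nat) (w : seq mv) (us : seq (seq mv))
    (t : trie) (new : seq (seq bool)) : trie * seq (seq bool) :=
  if us is u :: us' then
    let g := act u (bld v) in let v' := rd g in
    if tget t v' is Some _ then orb_step v i w us' t new
    else if ck (xr g (bld v')) then
      orb_step v i w us' (tset t v' (i, rev u ++ w)) (v' :: new)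
    else orb_step v i w us' t new
  else (t, new).
Fixpoint orb_loop (fuel : nat) (t : trie) (front : seq (seq bool)) : trie :=
  if fuel is fuel'.+1 then
    let: (t', new) := foldl (fun s v =>
      if tget s.1 v is Some (i, w) then orb_step v i w ws s.1 s.2 else s) (t, [::]) front in
    if new is [::] then t' else orb_loop fuel' t' new
  else t.
Definition orb (reps : seq (seq bool)) : trie :=
  foldl (fun t ir => orb_loop 50 (tset t ir.2 (ir.1, [::])) [:: ir.2]) TE
    (zip (iota 0 (size reps)) reps).
Definition orb_ok (t : trie) (reps : seq (seq bool)) (okw : mv -> bool) (v : seq bool) : bool :=
  if tget t v is Some (i, w) then
    all okw w && ck (xr (act w (bld v)) (bld (nth [::] reps i))) && (i < size reps)
  else false.
Lemma orb_okP t reps okw v : orb_ok t reps okw v ->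
  exists w r, [/\ all okw w, r \in reps & ck (xr (act w (bld v)) (bld r))].
Proof.
rewrite /orb_ok; case: tget => // -[i w] /andP[/andP[ow l] lt].
by exists w, (nth [::] reps i); rewrite mem_nth.
Qed.
End Orbits.

(** * Classes of cubics and quartics in five variables *)

Fixpoint monom n i (s : seq nat) : BF n :=
  if n is m.+1 then let g := monom m i.+1 s in if i \in s then (zr m, g) else (g, g) else true.
Definition sum_monom n (ss : seq (seq nat)) : BF n := foldr (fun s f => xr (monom n 1 s) f) (zr n) ss.
Definition dnw (i : nat) (m : mv) : mv := iter i Dn m.
(** The elementary transvections, which generate the general linear group over the field with two
    elements. *)
Definition linmv n : seq (seq mv) :=
  flatten [seq [seq [:: dnw i (Mx j)] | j <- iota 0 (n - i.+1)] ++
               [seq [:: dnw i (Sh j)] | j <- iota 0 (n - i.+1)] | i <- iota 0 n].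
Definition trmv n : seq (seq mv) := [seq [:: dnw i Tr] | i <- iota 0 n].

Fixpoint islin (m : mv) : bool := match m with Dn m' => islin m' | Tr => false | _ => true end.

Definition repsA := [:: zr 5; sum_monom 5 [:: [:: 1; 2; 3]]; sum_monom 5 [:: [:: 1; 2; 3]; [:: 1; 4; 5]]].
Definition bldA v := comb v (mons 5 3).
Definition tA := Eval vm_compute in orb (lo 3) bldA (@cf 5 3) (linmv 5) [seq cf 3 f | f <- repsA].
Lemma tA_ok : allb 10 (orb_ok (lo 3) bldA tA [seq cf 3 f | f <- repsA] islin).
Proof. by vm_compute. Qed.

Definition q4 := sum_monom 5 [:: [:: 1; 2; 3; 4]].
Definition bldB0 v := comb v (mons 5 4).
Definition tB0 := Eval vm_compute in orb (lo 4) bldB0 (@cf 5 4) (linmv 5) [seq cf 4 f | f <- [:: zr 5; q4]].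
Lemma tB0_ok : allb 5 (orb_ok (lo 4) bldB0 tB0 [seq cf 4 f | f <- [:: zr 5; q4]] predT).
Proof. by vm_compute. Qed.
(** The cubic parts that can accompany [q4]. Translations are among the moves here: they add to [q4]
    its derivatives, which are cubics. *)
Definition repsB := [:: zr 5; sum_monom 5 [:: [:: 1; 2; 5]]; sum_monom 5 [:: [:: 1; 2; 5]; [:: 3; 4; 5]]].
Definition bldB v := xr q4 (comb v (mons 5 3)).
Definition tB := Eval vm_compute in orb (lo 3) bldB (@cf 5 3) (linmv 5 ++ trmv 5) [seq cf 3 f | f <- repsB].
Lemma tB_ok : allb 10 (orb_ok (lo 3) bldB tB [seq cf 3 f | f <- repsB] predT).
Proof. by vm_compute. Qed.

Definition lh n (f : BF n.+1) : BF n := f.1.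
Definition rh n (f : BF n.+1) : BF n := f.2.
Definition pr n (a b : BF n) : BF n.+1 := (a, b).
Lemma pr_eta n (f : BF n.+1) : f = pr (lh f) (rh f). Proof. by case: f. Qed.
Lemma xr_pr n (a b c d : BF n) : xr (pr a b) (pr c d) = pr (xr a c) (xr b d).
Proof. by []. Qed.
Lemma lo_pr n k (a b : BF n) : lo k (pr a b) = lo k a && lo k.-1 (xr a b).
Proof. by []. Qed.
Lemma wt_pr n (a b : BF n) : wt (pr a b) = wt a + wt b.
Proof. by []. Qed.
Lemma act_pr n w (a b : BF n) : act [seq Dn m | m <- w] (pr a b) = pr (act w a) (act w b).
Proof. exact: act_Dn. Qed.
Lemma act_tr n (a b : BF n) : act [:: Tr] (pr a b) = pr b a.
Proof. by []. Qed.
Definition dt n (x : pt n) (f : BF n) : BF n := xr f (trs x f).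

Lemma lo_dt n k (x : pt n) f : lo k.+1 f -> lo k (dt x f).
Proof. exact: lo_dtrs. Qed.
Lemma trs_padd n (x y : pt n) f : trs x (trs y f) = trs (padd x y) f.
Proof. by elim: n x y f => [|n IH] //= [a x] [b y] [f g] /=; case: a b => [] []; rewrite /= !IH. Qed.
(** The failure of additivity in the direction is a second derivative, of degree lower by two. *)
Lemma dt_padd n (x y : pt n) k c : lo k.+2 c -> lo k (xr (dt (padd x y) c) (xr (dt x c) (dt y c))).
Proof.
move=> lc; have -> : xr (dt (padd x y) c) (xr (dt x c) (dt y c)) = dt x (dt y c).
  by rewrite /dt trs_xr trs_padd; xring.
by apply: lo_dt; apply: lo_dt.
Qed.
Fixpoint addv (a b : seq bool) : seq bool :=
  match a, b with
  | x :: a', y :: b' => (x (+) y) :: addv a' b'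
  | [::], _ => b
  | _, [::] => a
  end.
Lemma comb_nil n (ms : seq (BF n)) : comb [::] ms = zr n. Proof. by case: ms. Qed.
Lemma comb_addv n a b (ms : seq (BF n)) : comb (addv a b) ms = xr (comb a ms) (comb b ms).
Proof.
elim: ms a b => [|m ms IH] [|x a] [|y b] //=; rewrite ?x0r ?xr0 //.
by rewrite IH; case: x y => [] [] /=; xring.
Qed.

Fixpoint pz n : pt n := if n is m.+1 then (false, pz m) else tt.
Lemma trs_pz n (f : BF n) : trs (pz n) f = f.
Proof. by elim: n f => [|n IH] //= [f g]; rewrite !IH. Qed.
Lemma dt_pz n (f : BF n) : dt (pz n) f = zr n.
Proof. by rewrite /dt trs_pz xrr. Qed.
(* A translation by [x] adds [dt x c] to the quadratic part, so only quadratics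
   modulo these derivatives have to be examined. *)
Definition spanned n (c : BF n) (ms : seq (BF n)) (q : BF n) :=
  exists x v, lo 2 (xr (xr q (dt x c)) (comb v ms)).
Lemma spanned_xr n (c : BF n) ms p q : lo 4 c ->
  spanned c ms p -> spanned c ms q -> spanned c ms (xr p q).
Proof.
move=> lc [x [v lv]] [y [w lw]]; exists (padd x y), (addv v w); rewrite comb_addv.
have -> : xr (xr (xr p q) (dt (padd x y) c)) (xr (comb v ms) (comb w ms)) =
  xr (xr (dt (padd x y) c) (xr (dt x c) (dt y c)))
     (xr (xr (xr p (dt x c)) (comb v ms)) (xr (xr q (dt y c)) (comb w ms))) by xring.
by rewrite lo_xr ?dt_padd // lo_xr.
Qed.
Lemma spanned_lo n (c : BF n) ms q : lo 2 q -> spanned c ms q.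
Proof. by move=> lq; exists (pz n), [::]; rewrite dt_pz comb_nil !xr0. Qed.
Lemma spanned_comb n (c : BF n) ms w s : lo 4 c ->
  (forall m, List.In m s -> spanned c ms m) -> spanned c ms (comb w s).
Proof.
move=> lc; elim: s w => [|m s IH] w H; first by apply: spanned_lo; exact: lo_zr.
case: w => [|[] w] /=; first by apply: spanned_lo; exact: lo_zr.
  by apply: spanned_xr => //; [apply: H; left | apply: IH => m' ?; apply: H; right].
by apply: IH => m' ?; apply: H; right.
Qed.
Definition span_ok n (c : BF n) (ms : seq (BF n)) (wit : seq (pt n * seq bool)) : bool :=
  (size wit == size (mons n 2)) &&
  all (fun mw => lo 2 (xr (xr mw.1 (dt mw.2.1 c)) (comb mw.2.2 ms))) (zip (mons n 2) wit).
Lemma span_okP n (c : BF n) ms wit q : lo 4 c -> span_ok c ms wit -> lo 3 q -> spanned c ms q.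
Proof.
move=> lc /andP[/eqP sz al] lq.
have -> : q = xr (xr q (comb (cf 2 q) (mons n 2))) (comb (cf 2 q) (mons n 2)) by rewrite xrK.
apply: spanned_xr => //; first by apply: spanned_lo; apply: lo_cf.
apply: spanned_comb => //; elim: (mons n 2) wit sz al => [|m s IH] [|[x v] wit] //= [sz].
case/andP=> l al m' [<-|im]; first by exists x, v.
exact: (IH wit).
Qed.

(** Translations and affine summands do not change the distance to the affine functions, so the
    functions [c + comb v ms] stand for all [c + q]. *)
Lemma U_span n k (c : BF n) ms wit : lo 4 c -> span_ok c ms wit ->
  allc ms c (@d1b n k) -> U k c.
Proof.
move=> lc sp al q lq; have [x [v l]] := span_okP lc sp lq.
apply: (@D1_act _ (trw x)); rewrite -trsE trs_xr.
apply: (@D1_xr _ _ _ (xr (xr (xr q (dt x c)) (comb v ms)) (dt x q))).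
  by rewrite lo_xr // lo_dt.
have -> : xr (xr (trs x c) (trs x q)) (xr (xr (xr q (dt x c)) (comb v ms)) (dt x q)) = xr c (comb v ms).
  by rewrite /dt; xring.
by apply: d1bP; apply: allcP.
Qed.

Fixpoint pts n : seq (pt n) :=
  if n is m.+1 then [seq (false, x) | x <- pts m] ++ [seq (true, x) | x <- pts m] else [:: tt].
Fixpoint zargmax n : BZ n -> pt n :=
  if n is m.+1 then fun T : BZ m * BZ m =>
    if (zmax T.2 <=? zmax T.1)%Z then (false, zargmax T.1) else (true, zargmax T.2)
  else fun=> tt.
(* A function of minimal weight among those differing from [f] by an affine one. *)
Definition minco n (f : BF n) : BF n :=
  let u := zargmax (W f) in let g := xr f (lin u) in
  if (gz (W f) u <? 0)%Z then xr g (one n) else g.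
Fixpoint supp n : BF n -> seq (pt n) :=
  if n is m.+1 then fun f : BF m * BF m =>
    [seq (false, x) | x <- supp f.1] ++ [seq (true, x) | x <- supp f.2]
  else fun b => if b then [:: tt] else [::].

Fixpoint pivots (k : nat) (rows : seq (seq bool)) : seq nat :=
  match k, rows with
  | j.+1, r :: rs =>
    let p := find id r in
    if p < size r then p :: pivots j [seq if nth false s p then addv s r else s | s <- rs]
    else pivots j rs
  | _, _ => [::]
  end.
Definition basis6 : seq (pt 6) :=
  [seq x <- pts 6 | nk x == 1].
Section Quotient.
Variable c : BF 6.
(** Gaussian elimination on the derivatives of [c]: the quadratic monomials that are not pivots
    represent the quadratics modulo these derivatives. [qwit] only proposes a reduction of each of
    the 15 monomials, and [span_ok] verifies it. *)
Definition piv := pivots 6 [seq cf 2 (dt x c) | x <- basis6].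
Definition free := [seq i <- iota 0 15 | i \notin piv].
Definition qms := [seq nth (zr 6) (mons 6 2) i | i <- free].
Definition qwit : seq (pt 6 * seq bool) :=
  [seq let x := nth (pz 6) (pts 6) (find (fun x => let v := cf 2 (xr m (dt x c)) in
                    all (fun p => ~~ nth false v p) piv) (pts 6)) in
       let v := cf 2 (xr m (dt x c)) in (x, [seq nth false v i | i <- free]) | m <- mons 6 2].
Fixpoint selc (ms : seq (BF 6)) (f : BF 6) (p : BF 6 -> bool) : seq (BF 6) :=
  if ms is m :: ms' then selc ms' f p ++ selc ms' (xr f m) p else if p f then [:: f] else [::].
End Quotient.

(** * Cubics in six variables *)

Definition tvw (i j : nat) : seq mv :=
  if i < j then [:: dnw i.-1 (Mx (j - i.+1))] else [:: dnw j.-1 (Sh (i - j.+1))].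
(** The third form becomes [x2 (x3 x4 + x5 x6)] here. A single transvection between the pairs 3, 4
    and 5, 6 does not preserve it; the four products do, being symplectic. *)
Definition wsN := linmv 6 ++
  [:: tvw 3 5 ++ tvw 6 4; tvw 5 3 ++ tvw 4 6; tvw 3 6 ++ tvw 5 4; tvw 6 3 ++ tvw 4 5].
Definition bldN (t : BF 5) v : BF 6 := pr t (xr t (comb v (mons 5 2))).
Definition rdN (f : BF 6) := cf 2 (xr (lh f) (rh f)).
(* Coefficients of orbit representatives, found by search. *)
Definition repsN (i : nat) : seq (seq bool) := [seq [seq x == 1 | x <- v] | v <- nth [::] [::
  [:: [:: 0;0;0;0;0;1;0;1;0;0]; [:: 0;0;0;0;0;0;0;0;0;1]; [:: 0;0;0;0;0;0;0;0;0;0]];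
  [:: [:: 1;0;0;0;0;0;0;0;0;0]; [:: 0;0;0;0;1;0;1;0;0;0]; [:: 0;0;0;0;0;0;0;1;0;0]; [:: 0;0;0;0;0;0;0;0;0;0]];
  [:: [:: 0;0;1;1;0;1;0;0;0;0]; [:: 0;0;0;0;1;0;0;0;0;0]; [:: 0;0;0;0;0;1;0;0;0;0]; [:: 0;0;0;0;0;0;0;0;0;0]]] i].
Definition tN (i : nat) := orb (lo 3) (bldN (nth (zr 5) repsA i)) rdN wsN (repsN i).
Definition tNs := Eval vm_compute in [:: tN 0; tN 1; tN 2].
Definition tN_chk (i : nat) := allb 10 (orb_ok (lo 3) (bldN (nth (zr 5) repsA i)) (nth TE tNs i) (repsN i) predT).
Lemma tN_ok : all tN_chk [:: 0; 1; 2]. Proof. by vm_compute. Qed.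

Lemma cubic5_form (f : BF 5) : lo 4 f ->
  exists w r, [/\ all islin w, r \in iota 0 3 & lo 3 (xr (act w f) (nth (zr 5) repsA r))].
Proof.
move=> /lo_cf; set v := cf 3 f => lf.
have := allbP tA_ok (v := v) (size_cf 3 f) => /orb_okP[w [r [ow rin l]]].
have : exists2 i, i \in iota 0 3 & bldA r = nth (zr 5) repsA i.
  move: rin; rewrite !inE => /or3P[] /eqP->; by [exists 0; vm_compute | exists 1; vm_compute | exists 2; vm_compute].
case=> i iin e; exists w, i; split=> //; rewrite -e.
have -> : xr (act w f) (bldA r) = xr (act w (xr f (bldA v))) (xr (act w (bldA v)) (bldA r)).
  by rewrite act_xr; xring.
by rewrite lo_xr // lo_actE.
Qed.

Lemma cubic6_form (c : BF 6) : lo 4 c -> exists w i r,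
  [/\ i \in iota 0 3, r \in repsN i & lo 3 (xr (act w c) (bldN (nth (zr 5) repsA i) r))].
Proof.
rewrite (pr_eta c); move: (lh c) (rh c) => a b {c}; rewrite lo_pr => /andP[la lab].
have [w [i [_ iin l]]] := cubic5_form la; set t := nth _ _ i in l.
set d := act w (xr a b); have ld : lo 3 d by rewrite lo_actE.
have := lo_cf ld; set v := cf 2 d => lv.
have /allP/(_ i iin) := tN_ok => /allbP/(_ v (size_cf 2 d))/orb_okP[w' [r [_ rin l']]].
exists ([seq Dn m | m <- w] ++ w'), i, r; split=> //.
rewrite act_cat act_pr; set c := pr _ _.
have l6 : lo 3 (xr c (bldN t v)).
  rewrite /c /bldN xr_pr lo_pr l andTb.
  have -> : xr (xr (act w a) t) (xr (act w b) (xr t (comb v (mons 5 2)))) =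
      xr d (comb v (mons 5 2)) by rewrite /d act_xr; xring.
  exact: lv.
have -> : xr (act w' c) (bldN t r) = xr (act w' (xr c (bldN t v))) (xr (act w' (bldN t v)) (bldN t r)).
  by rewrite act_xr; xring.
by rewrite lo_xr // lo_actE.
Qed.

Definition pairs n k (c : BF n) := forall x y, x <> y -> L k (xr c (xr (dl x) (dl y))).
(** The number 64 counts translations: in [bad_span] the bad cosets are the translates of a single
    one. *)
Definition bad24 n (c : BF n) := exists2 Bd : seq (BF n), size Bd <= 64 &
  forall q, lo 3 q -> D1 24 (xr c q) \/ exists2 b, List.In b Bd & lo 2 (xr q b).
(** One coset of quadratics more than [bad24] can exclude, so that a quadratic good for one half and
    not bad for the other exists; see [bad24_good15]. *)
Definition good15 n (c : BF n) := forall x, exists G : seq (BF n),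
  [/\ 64 < size G, forall g, List.In g G -> lo 3 g && (wt (xr (xr c (dl x)) g) <= 15)
    & pairwise (fun g h => ~~ lo 2 (xr g h)) G].
(** The cases belong to representatives of weight at most 12, 14, 18 and 16, in this order. In the
    last one [bad24] and [good15] stand in for a bound [U]. *)
Definition cubic_type (c : BF 6) := [\/ L 12 c, L 14 c /\ U 22 c,
  [/\ L 18 c, U 22 c & pairs 16 c] | [/\ bad24 c, good15 c & pairs 14 c]].

Lemma dl_inj n (x y : pt n) : dl x = dl y -> x = y.
Proof.
elim: n x y => [|n IH] /=; first by case=> [] [].
have ne (z : pt n) : zr n <> dl z by move=> /(congr1 (@wt n)); rewrite wt_zr wt_dl.
case=> [[] x] [[] y] /= e.
- by rewrite (IH _ _ (congr1 snd e)).
- by case: (ne y (congr1 fst e)).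
- by case: (ne x (esym (congr1 fst e))).
- by rewrite (IH _ _ (congr1 fst e)).
Qed.
Lemma pairs_act n k w (c : BF n) : pairs k (act w c) -> pairs k c.
Proof.
move=> p x y ne; apply: (@L_act _ w); rewrite !act_xr.
have [x' ex] := dl_act w x; have [y' ey] := dl_act w y; rewrite ex ey; apply: p => e.
by apply: ne; apply: dl_inj; rewrite -(actK w (dl x)) ex e -ey actK.
Qed.
Lemma pairs_xr n k (c g : BF n) : lo 3 g -> pairs k (xr c g) -> pairs k c.
Proof. by move=> lg p x y ne; apply: (L_xr lg); rewrite xrAC; apply: p. Qed.

Lemma bad24_act n w (c : BF n) : bad24 (act w c) -> bad24 c.
Proof.
case=> Bd sz H; exists [seq act (rev w) b | b <- Bd]; first by rewrite size_map.
move=> q lq; have [|d|[b bin l]] := H (act w q); first by rewrite lo_actE.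
  by left; apply: (@D1_act _ w); rewrite act_xr.
right; exists (act (rev w) b); first exact: List.in_map.
by rewrite -(lo_actE w) act_xr actVK.
Qed.
Lemma bad24_xr n (c g : BF n) : lo 3 g -> bad24 (xr c g) -> bad24 c.
Proof.
move=> lg [Bd sz H]; exists [seq xr g b | b <- Bd]; first by rewrite size_map.
move=> q lq; have [|d|[b bin l]] := H (xr g q); first by rewrite lo_xr.
  by left; move: d; rewrite xrA xrK.
by right; exists (xr g b); [exact: List.in_map | rewrite xrA (xrC q)].
Qed.
Lemma In_map_inv (A B : Type) (f : A -> B) s y : List.In y [seq f x | x <- s] ->
  exists2 x, List.In x s & y = f x.
Proof. by move/List.in_map_iff => [x [<- ?]]; exists x. Qed.
Lemma good15_act n w (c : BF n) : good15 (act w c) -> good15 c.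
Proof.
move=> H x; have [x' ex] := dl_act w x; have [G [sz inG pw]] := H x'.
exists [seq act (rev w) g | g <- G]; split; first by rewrite size_map.
  move=> y yin; have [g gin ->] := In_map_inv yin; have /andP[lg wg] := inG _ gin; rewrite lo_actE lg -(wt_act w) !act_xr actVK ex.
  exact: wg.
rewrite pairwise_map; apply: sub_pairwise pw => g h /=; by rewrite -act_xr lo_actE.
Qed.
Lemma good15_xr n (c g : BF n) : lo 3 g -> good15 (xr c g) -> good15 c.
Proof.
move=> lg H x; have [G [sz inG pw]] := H x; exists [seq xr g h | h <- G]; split.
- by rewrite size_map.
- move=> y yin; have [h hin ->] := In_map_inv yin; have /andP[lh wh] := inG _ hin; rewrite lo_xr //=.
  by have -> : xr (xr c (dl x)) (xr g h) = xr (xr (xr c g) (dl x)) h by xring.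
- rewrite pairwise_map; apply: sub_pairwise pw => a b /=.
  by have -> : xr (xr g a) (xr g b) = xr a b by xring.
Qed.
Lemma cubic_type_act w c : cubic_type (act w c) -> cubic_type c.
Proof.
case=> [/L_act|[/L_act ? /U_act]|[/L_act ? /U_act ? /pairs_act]|[/bad24_act ? /good15_act ? /pairs_act]] h.
- exact: Or41.
- exact: Or42.
- exact: Or43.
- exact: Or44.
Qed.
Lemma cubic_type_xr c g : lo 3 g -> cubic_type (xr c g) -> cubic_type c.
Proof.
move=> lg; case=> [/(L_xr lg)|[/(L_xr lg) ? /(U_xr lg)]|[/(L_xr lg) ? /(U_xr lg) ? /(pairs_xr lg)]
  |[/(bad24_xr lg) ? /(good15_xr lg) ? /(pairs_xr lg)]] h.
- exact: Or41.
- exact: Or42.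
- exact: Or43.
- exact: Or44.
Qed.

Lemma all_In (A : Type) (p : pred A) s x : all p s -> List.In x s -> p x.
Proof. by elim: s => //= y s IH /andP[py /IH h] [<-|/h]. Qed.
Lemma has_In (A : Type) (p : pred A) s : has p s -> exists2 x, List.In x s & p x.
Proof.
elim: s => //= y s IH /orP[py|/IH[x xin px]]; first by exists y => //; left.
by exists x => //; right.
Qed.
Lemma paddC n (x y : pt n) : padd x y = padd y x.
Proof. by elim: n x y => //= n IH x y; rewrite addbC IH. Qed.
Lemma paddxx n (x : pt n) : padd x x = pz n.
Proof. by elim: n x => //= n IH x; rewrite addbb IH. Qed.
Lemma padd0 n (x : pt n) : padd x (pz n) = x.
Proof. by elim: n x => [[]|n IH [b x]] //=; rewrite addbF IH. Qed.
Lemma padd_eq0 n (x y : pt n) : padd x y = pz n -> x = y.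
Proof. by move=> e; rewrite -(paddK x y) e paddC padd0. Qed.
Lemma trs0 n (x : pt n) : trs x (zr n) = zr n.
Proof. by apply: wt0; rewrite wt_trs wt_zr. Qed.
Lemma trs_dl n (x y : pt n) : trs x (dl y) = dl (padd x y).
Proof.
by elim: n x y => [|n IH] //= [[] x] [[] y] /=; rewrite IH trs0.
Qed.
Lemma lo_coset n (c e : BF n) x : lo 4 c -> lo 3 (xr c e) -> lo 3 (xr c (trs x e)).
Proof.
move=> lc le; have -> : xr c (trs x e) = xr (dt x c) (trs x (xr c e)).
  by rewrite /dt trs_xr; xring.
by rewrite lo_xr ?lo_trs // lo_dt.
Qed.

Definition pairs_ok n k (c : BF n) (E : seq (BF n)) :=
  all (fun e => [&& get e (pz n), lo 3 (xr c e) & wt e <= k.+2]) E &&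
  allpt (fun p => has (fun e => get e p) E).
(** Some member of the coset contains the origin and [x + y]. Its translate by [x] contains [x] and
    [y], and adding these two points lowers its weight by two. *)
Lemma pairs_okP n k (c : BF n) E : lo 4 c -> pairs_ok k c E -> pairs k c.
Proof.
move=> lc /andP[aE /allptP hE] x y ne.
have /has_In[e ein ge] := hE (padd x y).
have /and3P[g0 lq we] := all_In aE ein.
exists (xr c (trs x e)); first exact: lo_coset.
have -> : xr (xr c (xr (dl x) (dl y))) (xr c (trs x e)) = xr (xr (trs x e) (dl x)) (dl y) by xring.
rewrite !wt_xr_dl get_xr !get_trs paddxx g0 ge wt_trs.
have -> : get (dl x) y = false.
  by apply/negP => gy; apply: ne; move: gy; elim: (n) x y {c E lc aE hE e ein ge g0 lq we} => [|m IH] /=;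
    [case=> [] [] | case=> [[] x] [[] y] /=; rewrite ?get0 // => /IH->].
by rewrite addbF; move: we; case: (wt e) => [|[]].
Qed.

Definition good_ok n (c : BF n) (E : seq (BF n)) :=
  [&& 64 < size E,
    all (fun e => [&& get e (pz n), lo 3 (xr c e) & wt e <= 16]) E
  & pairwise (fun e f => ~~ lo 2 (xr e f)) E].
(** One list serves all points: translation by [x] moves the origin, which lies in every member, to
    [x], and keeps the members inequivalent modulo affine functions. *)
Lemma good_okP n (c : BF n) E : lo 4 c -> good_ok c E -> good15 c.
Proof.
move=> lc /and3P[sz aE pw] x; exists [seq xr c (trs x e) | e <- E]; split.
- by rewrite size_map.
- move=> y yin; have [e ein ->] := In_map_inv yin; have /and3P[g0 lq we] := all_In aE ein.
  rewrite lo_coset //; have -> : xr (xr c (dl x)) (xr c (trs x e)) = xr (trs x e) (dl x) by xring.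
  by rewrite wt_xr_dl get_trs paddxx g0 wt_trs; case: (wt e) we.
- rewrite pairwise_map; apply: sub_pairwise pw => e f /=.
  by have -> : xr (xr c (trs x e)) (xr c (trs x f)) = trs x (xr e f);
    [rewrite trs_xr; xring | rewrite lo_trs].
Qed.

(** A quadratic is reduced by a translation to a combination of [ms]. If the bound 24 fails, this
    combination is [b] modulo affine functions, and undoing the translation adds [dt x c] to it. *)
Lemma bad_span n (c b : BF n) ms wit : n = 6 -> lo 4 c -> span_ok c ms wit -> lo 3 b ->
  allc ms c (fun f => d1b 24 f || lo 2 (xr (xr c b) f)) -> bad24 c.
Proof.
move=> n6 lc sp lb al; exists [seq xr b (dt x c) | x <- pts n].
  by rewrite size_map n6.
move=> q lq; have [x [v l]] := span_okP lc sp lq.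
have /orP[d|l2] := allcP al v; [left|right].
  apply: (@D1_act _ (trw x)); rewrite -trsE trs_xr.
  apply: (@D1_xr _ _ _ (xr (xr (xr q (dt x c)) (comb v ms)) (dt x q))).
    by rewrite lo_xr // lo_dt.
  have -> : xr (xr (trs x c) (trs x q)) (xr (xr (xr q (dt x c)) (comb v ms)) (dt x q)) = xr c (comb v ms).
    by rewrite /dt; xring.
  exact: d1bP.
exists (xr b (dt x c)).
  apply: (List.in_map (fun x => xr b (dt x c))); elim: (n) x {c b ms wit n6 lc sp lb al q lq l v l2} => [|m IH] /=.
    by case; left.
  by case=> [[] x]; apply: List.in_or_app; [right|left]; apply: List.in_map; apply: IH.
have -> : xr q (xr b (dt x c)) =
  xr (xr (xr q (dt x c)) (comb v ms)) (xr (xr c b) (xr c (comb v ms))) by xring.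
by rewrite lo_xr.
Qed.

Definition leads c k := [seq minco f | f <- selc (qms c) c (@d1b 6 k)].
Definition org_leads c k := flatten [seq [seq trs p e | p <- supp e] | e <- leads c k].
Definition ok22 (c : BF 6) := span_ok c (qms c) (qwit c) && allc (qms c) c (@d1b 6 22).
Definition ok18 (c : BF 6) := ok22 c && pairs_ok 16 c (org_leads c 18).
(** [b] is the quadratic of the first coset failing the bound 24. As [bad24] allows 64 cosets, 65
    members of the list are taken for [good15]. *)
Definition ok16 (c : BF 6) :=
  let E := org_leads c 16 in
  let b := xr c (head c (selc (qms c) c (fun f => ~~ d1b 24 f))) in
  [&& span_ok c (qms c) (qwit c), lo 3 b,
      allc (qms c) c (fun f => d1b 24 f || lo 2 (xr (xr c b) f)),
      good_ok c (take 65 E) & pairs_ok 14 c E].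
(** The representatives have small weight themselves, so the zero quadratic already witnesses
    [L]. *)
Definition rep_ok (c : BF 6) : bool :=
  lo 4 c &&
  if wt c <= 12 then true else if wt c <= 14 then ok22 c else
  if wt c <= 16 then ok16 c else (wt c <= 18) && ok18 c.
Lemma reps6_ok :
  all (fun i => all (fun r => rep_ok (bldN (nth (zr 5) repsA i) r)) (repsN i)) (iota 0 3).
Proof. by vm_compute. Qed.

Lemma L_wt n k (f : BF n) : wt f <= k -> L k f.
Proof. by exists (zr n); rewrite ?lo_zr ?xr0. Qed.
Lemma rep_okP c : rep_ok c -> cubic_type c.
Proof.
case/andP=> lc; case: ifP => [le _|_]; first by apply: Or41; apply: L_wt.
case: ifP => [le /andP[sp al]|_].
  by apply: Or42; split; [exact: L_wt | exact: U_span lc sp al].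
case: ifP => [_ /and5P[sp lb al gd pk]|_ /andP[le /andP[/andP[sp al] pk]]].
  by apply: Or44; split; [exact: bad_span lc sp lb al | exact: good_okP gd | exact: pairs_okP pk].
by apply: Or43; split; [exact: L_wt | exact: U_span lc sp al | exact: pairs_okP pk].
Qed.
Lemma cubic_types c : lo 4 c -> cubic_type c.
Proof.
move=> lc; have [w [i [r [iin rin l]]]] := cubic6_form lc.
apply: (@cubic_type_act w); apply: (cubic_type_xr l); rewrite xKr; apply: rep_okP.
by have /allP/(_ i iin)/allP/(_ r rin) := reps6_ok.
Qed.

(** * Quartics and quintics in six variables *)

Lemma glue_pr n a b (f g : BF n) : L a f -> U b g -> L (a + b) (pr f g).
Proof. exact: glue. Qed.
Lemma glueC_pr n a b (f g : BF n) : U a f -> L b g -> L (a + b) (pr f g).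
Proof. exact: glueC. Qed.

Lemma nlo_act n w k (f : BF n) : ~~ lo k f -> ~~ lo k (act w f).
Proof. by rewrite lo_actE. Qed.
Lemma quartic5_form (f : BF 5) : lo 5 f -> ~~ lo 4 f ->
  exists w r, r \in iota 0 3 /\ lo 3 (xr (act w f) (xr q4 (nth (zr 5) repsB r))).
Proof.
move=> /lo_cf; set v := cf 4 f => lv nl.
have := allbP tB0_ok (v := v) (size_cf 4 f) => /orb_okP[w [r [_ rin l]]].
have {}l : lo 4 (xr (act w f) (bldB0 r)).
  have -> : xr (act w f) (bldB0 r) = xr (act w (xr f (bldB0 v))) (xr (act w (bldB0 v)) (bldB0 r)).
    by rewrite act_xr; xring.
  by rewrite lo_xr // lo_actE.
move: rin l; rewrite !inE => /orP[] /eqP->.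
  have -> : bldB0 (cf 4 (zr 5)) = zr 5 by vm_compute.
  by rewrite xr0 lo_actE (negbTE nl).
have -> : bldB0 (cf 4 q4) = q4 by vm_compute.
move=> /[dup] l4 /lo_cf; set g := xr (act w f) q4; set u := cf 3 g => lu.
have := allbP tB_ok (v := u) (size_cf 3 g) => /orb_okP[w' [r' [_ rin l]]].
have : exists2 i, i \in iota 0 3 & bldB r' = xr q4 (nth (zr 5) repsB i).
  by move: rin; rewrite !inE => /or3P[] /eqP->;
    [exists 0; vm_compute | exists 1; vm_compute | exists 2; vm_compute].
case=> i iin e; exists (w ++ w'), i; split=> //; rewrite -e act_cat.
have -> : xr (act w' (act w f)) (bldB r') =
    xr (act w' (xr g (comb u (mons 5 3)))) (xr (act w' (bldB u)) (bldB r')).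
  by rewrite /g /bldB !act_xr; xring.
by rewrite lo_xr // lo_actE.
Qed.

(** The coefficients are multiples of 4 and their mean square 32 exceeds 16, so one of them is at
    least 8 in absolute value. *)
Lemma U_12 (f : BF 5) : lo 5 f -> U 12 f.
Proof.
move=> lf q lq; apply: D1_W; set g := xr f q.
have lg : lo 5 g by rewrite lo_xr // (loW _ lq).
case: (Z.leb_spec 8 (zmax (W g))) => [|lt]; first by rewrite /zn; lia.
have h : (1 * zdot (W g) (W g) <= 0 * zdot (W g) (W g) + 16 * zn (2 ^ 5))%Z.
  apply: zdot_le => u; have := @gz_le 5 (W g) u; have := @W_mod4 5 g u lg isT => m le.
  have [a ea] : exists a, gz (W g) u = (4 * a)%Z.
    by exists (gz (W g) u / 4)%Z; move: m; Z.div_mod_to_equations; lia.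
  rewrite ea in le *; have [h1 h2] : (-1 <= a /\ a <= 1)%Z by lia.
  by nia.
by move: h; rewrite parseval /zn; lia.
Qed.

Definition r3 := nth (zr 5) repsB 2.
Fixpoint findc n (ms : seq (BF n)) (f : BF n) (p : pred (BF n)) : option (BF n) :=
  if ms is m :: ms' then
    if findc ms' f p is Some g then Some g else findc ms' (xr f m) p
  else if p f then Some f else None.
Definition r3lead : BF 5 := Eval vm_compute in
  odflt (zr 5) (omap (@minco 5) (findc (mons 5 2) (xr q4 r3) (@d1b 5 6))).
Lemma r3_ok : [&& lo 3 (xr (xr q4 r3) r3lead), wt r3lead <= 6 & ub 10 (xr q4 r3)].
Proof. by vm_compute. Qed.
Lemma quartic5_cases (f : BF 5) : lo 5 f -> ~~ lo 4 f -> L 4 f \/ L 6 f /\ U 10 f.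
Proof.
move=> l5 l4; have [w [r [rin l]]] := quartic5_form l5 l4.
have /and3P[lq wq uq] := r3_ok.
move: rin l; rewrite !inE => /or3P[] /eqP-> l; [left|left|right; split].
- by apply: (@L_act _ w); apply: (L_xr l); rewrite xKr; apply: L_wt; vm_compute.
- by apply: (@L_act _ w); apply: (L_xr l); rewrite xKr; apply: L_wt; vm_compute.
- apply: (@L_act _ w); apply: (L_xr l); rewrite xKr; apply: (L_xr lq); rewrite xKr.
  exact: L_wt.
- by apply: (@U_act _ w); apply: (U_xr l); rewrite xKr -/r3; exact: ubP uq.
Qed.
Lemma up_pr n i (f : BF n.+1) : i <= n -> act (up i) f = pr (res i f) (rh (act (up i) f)).
Proof. by move=> le; rewrite -up_res // -pr_eta. Qed.
(** Degree 4 survives on both halves of some hyperplane. The third class of quartics in five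
    variables has the larger distance 6, but also the better bound [U 10], so that 4 + 12 and 6 + 10
    both give 16. *)
Lemma quartic6_L16 (h : BF 6) : lo 5 h -> ~~ lo 4 h -> L 16 h.
Proof.
move=> l5 l4; have [|i le nl] := @res_lo 5 4 h _ l5 l4; first by [].
apply: (@L_act _ (up i)); have := l5; rewrite -(lo_actE (up i)) (up_pr h le).
move: (res i h) (rh _) nl => a b na; rewrite lo_pr => /andP[la lab].
have lb : lo 5 b by rewrite -(xKr a b) lo_xr // (loW _ lab).
have nb : ~~ lo 4 b by apply: contra na => lb4; rewrite -(xrK a b) lo_xr.
case: (quartic5_cases la na) => [La|[La Ua]].
  exact: (glue_pr La (U_12 lb)).
case: (quartic5_cases lb nb) => [Lb|[Lb Ub]]; last exact: (glue_pr La Ub).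
exact: LW (glueC_pr Ua Lb).
Qed.

Fixpoint org n : BF n := if n is m.+1 then (org m, zr m) else true.
Lemma org_dl n : org n = dl (pz n).
Proof. by elim: n => //= n ->. Qed.
Lemma mix_org n j : mix j (org n) (zr n) = org n /\ mix j (zr n) (org n) = zr n.
Proof.
elim: n j => [|n IH] [|j] //=; have [-> ->] := IH j; by rewrite mixx.
Qed.
Lemma act1_zr n m : act1 m (zr n) = zr n.
Proof. by apply: wt0; rewrite wt_act1 wt_zr. Qed.
Lemma act1_org n m : islin m -> act1 m (org n) = org n.
Proof.
elim: m n => //= [m IH||j|j] [|p] //= lm.
- by rewrite IH // act1_zr.
- by case: p.
- by have [-> ->] := mix_org p j.
- by rewrite (wt0 (f := tr j (zr p))) // wt_tr wt_zr.
Qed.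
Lemma act_org n w : all islin w -> act w (org n) = org n.
Proof. by elim: w => //= m w IH /andP[lm lw]; rewrite act1_org ?IH. Qed.

(* Words that act on the two halves separately, or exchange them. *)
Definition isdn (m : mv) : bool := match m with Dn _ | Tr => true | _ => false end.
Definition lo2h n k (f : BF n.+1) := lo k (lh f) && lo k (rh f).
Lemma lo2h_xr n k (f g : BF n.+1) : lo2h k f -> lo2h k g -> lo2h k (xr f g).
Proof. by move=> /andP[a b] /andP[c d]; apply/andP; split; apply: lo_xr. Qed.
Lemma lo2h_act n k w (f : BF n.+1) : all isdn w -> lo2h k f -> lo2h k (act w f).
Proof.
elim: w f => //= m w IH f /andP[im iw] /andP[l1 l2]; apply: IH => //.
by case: m im => [m||||] //= _; rewrite /lo2h /lh /rh /= ?lo_act1 // l1 l2.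
Qed.
Lemma lo2h_split n k (f : BF n.+1) : lo2h k f -> exists s q, [/\ lo k s, lo k q & f = pr s (xr s q)].
Proof.
move=> /andP[l1 l2]; exists (lh f), (xr (lh f) (rh f)); split=> //; first exact: lo_xr.
by rewrite xKr -pr_eta.
Qed.

(** * Families of six-variable functions settled by exhaustive search *)

Section Family.
Variables (k : nat) (T c : BF 5).
Definition bldF v : BF 6 := pr (xr T (comb v (mons 5 3))) (xr T (xr c (comb v (mons 5 3)))).
Definition rdF (f : BF 6) := cf 3 (xr (lh f) T).
(** For a cubic [A] these are functions whose halves are [T] plus a cubic and whose halves differ by
    [c] plus an arbitrary quadratic. *)
Definition fam (A : BF 5) := forall q, lo 3 q -> L k (pr (xr T A) (xr T (xr c (xr A q)))).
Lemma fam_xr A s : lo 3 s -> fam (xr A s) -> fam A.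
Proof.
move=> ls H q lq; apply: (@L_xr _ _ _ (pr s s)); first by rewrite lo_pr xrr lo_zr ls.
rewrite xr_pr; have := H q lq.
have -> : xr T (xr A s) = xr (xr T A) s by xring.
by have -> : xr T (xr c (xr (xr A s) q)) = xr (xr T (xr c (xr A q))) s by xring.
Qed.
(** The images are compared only modulo quadratics on each half. The discrepancy [(s, s + q')]
    consists of the quadratic [(s, s)] and a change of the quadratic that [fam] leaves free. *)
Lemma fam_step w v v' : all isdn w -> lo2h 3 (xr (act w (bldF v)) (bldF v')) ->
  fam (comb v' (mons 5 3)) -> fam (comb v (mons 5 3)).
Proof.
move=> iw l H q lq; apply: (@L_act _ w).
have lq2 : lo2h 3 (act w (pr (zr 5) q)).
  by apply: lo2h_act => //; rewrite /lo2h /lh /rh /= lo_zr.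
have [s [q' [ls lq' e]]] := lo2h_split (lo2h_xr l lq2).
apply: (@L_xr _ _ _ (pr s s)); first by rewrite lo_pr xrr lo_zr ls.
have := H q' lq'.
set X := pr _ _; set Y := xr _ _; suff -> : Y = X by [].
have eX : X = xr (bldF v') (pr (zr 5) q').
  by rewrite /X /bldF xr_pr xr0; congr pr; xring.
have -> : Y = xr (xr (act w (bldF v)) (act w (pr (zr 5) q))) (pr s s).
  rewrite /Y -act_xr /bldF xr_pr xr0; congr (xr (act w (pr _ _)) _); xring.
have -> : xr (xr (act w (bldF v)) (act w (pr (zr 5) q))) (pr s s) =
   xr (bldF v') (xr (xr (xr (act w (bldF v)) (bldF v')) (act w (pr (zr 5) q))) (pr s s)) by xring.
by rewrite e eX xr_pr xrr; congr (xr _ (pr _ _)); xring.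
Qed.
Lemma fam_all (t : trie) reps (test : BF 6 -> bool) :
  allb 10 (orb_ok (@lo2h 5 3) bldF t reps isdn) ->
  (forall f, test f -> L k f) ->
  all (fun r => allc (mons 5 2) (zr 5) (fun q => test (xr (bldF r) (pr (zr 5) q)))) reps ->
  forall A, lo 4 A -> fam A.
Proof.
move=> tok testP al A /lo_cf; set v := cf 3 A => lA; apply: (fam_xr lA).
rewrite xKr; have := allbP tok (v := v) (size_cf 3 A) => /orb_okP[w [r [iw rin l]]].
apply: (fam_step iw l) => q lq.
have := lo_cf lq; set u := cf 2 q => lu.
have h := testP _ (allcP (allP al r rin) u).
apply: (@L_xr _ _ _ (pr (zr 5) (xr q (comb u (mons 5 2))))).
  by rewrite lo_pr lo_zr x0r.
move: h; set X := xr (bldF r) _; set Y := xr _ _; suff -> : Y = X by [].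
pose A' := comb r (mons 5 3); pose Q := comb u (mons 5 2).
have -> : Y = pr (xr (xr T A') (zr 5)) (xr (xr T (xr c (xr A' q))) (xr q Q)) by [].
have -> : X = pr (xr (xr T A') (zr 5)) (xr (xr T (xr c A')) (xr (zr 5) Q)) by [].
by congr pr; xring.
Qed.
End Family.

(** Computes the point whose existence is [odd_split]. *)
Fixpoint oddpt n : BF n -> pt n :=
  if n is m.+1 return BF n -> pt n then fun f : BF m * BF m =>
    (~~ odd (wt f.1), oddpt (xr f.1 f.2)) else fun=> tt.
Fixpoint somept n : BF n -> pt n :=
  if n is m.+1 return BF n -> pt n then fun f : BF m * BF m =>
    if wt f.1 == 0 then (true, somept f.2) else (false, somept f.1) else fun=> tt.
(* A quadratic at distance at most 4 from [a], when the table lookups find one. *)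
Definition near_quadric (a : BF 5) : option (BF 5) :=
  if odd (wt a) then
    let p := oddpt a in let c := xr a (dl p) in
    if tget tA (cf 3 c) is Some (i, w) then
      if i is 0 then Some c else if i is 1 then
        let e := act (rev w) (nth (zr 5) repsA 1) in
        Some (xr c (trs (padd p (somept e)) e))
      else None
    else None
  else
    if tget tB0 (cf 4 a) is Some (1, w) then
      let a1 := act w a in
      if tget tB (cf 3 (xr a1 q4)) is Some (i, w1) then
        if i <= 1 then Some (act (rev (w ++ w1)) (xr (act w1 a1) (xr q4 (nth (zr 5) repsB i))))
        else None
      else None
    else None.
Definition split_test (k : nat) (h : BF 6) : bool :=
  if near_quadric (lh h) is Some q then
    let w := wt (xr (lh h) q) in
    if (w <= k) && lo 3 q then d1b (k - w) (xr (rh h) q) else false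
  else false.
Definition split_test_at (k : nat) (w : seq mv) (h : BF 6) : bool :=
  let g := act w h in if split_test k g then true else split_test k (pr (rh g) (lh g)).
Fixpoint hasi (A : Type) (p : A -> bool) (s : seq A) : bool :=
  if s is x :: s' then if p x then true else hasi p s' else false.
(** Makes the sum of the listed coordinates the top coordinate, so that the halves are the
    restrictions to a hyperplane and its complement. *)
Definition sum_to_top (l : seq nat) : seq mv :=
  if l is i :: js then up i ++ [seq Mx j.-1 | j <- js] else [::].
Fixpoint subseqs (s : seq nat) : seq (seq nat) :=
  if s is x :: s' then [seq x :: t | t <- subseqs s'] ++ subseqs s' else [:: [::]].
Definition hyperplanes n := [seq sum_to_top l | l <- subseqs (iota 0 n) & l != [::]].

Lemma split_testP k h : split_test k h -> L k h.
Proof.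
rewrite /split_test; case: near_quadric => // q; case: ifP => // /andP[le lq] /d1bP d.
by rewrite (pr_eta h) -(subnKC le); apply: (glue_D1 lq _ d).
Qed.
Lemma split_test_atP k w h : split_test_at k w h -> L k h.
Proof.
rewrite /split_test_at; case: ifP => [/split_testP/L_act|_ /split_testP l] //.
by apply: (@L_act _ w); rewrite (pr_eta (act w h)); apply: L_swap.
Qed.
Definition split_test_any (ws : seq (seq mv)) (h : BF 6) := hasi (fun w => split_test_at 14 w h) ws.
Lemma split_test_anyP ws h : split_test_any ws h -> L 14 h.
Proof. by rewrite /split_test_any; elim: ws => //= w s IH; case: ifP => [/split_test_atP|_ /IH]. Qed.

(** The last five words preserve [x1 (x2 x3 + x4 x5)] on each half: four are products of
    transvections paired symplectically, and the fifth reverses the order of [x2], [x3], [x4],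
    [x5]. *)
Definition wsF := [:: Tr] :: [seq [seq Dn m | m <- w] | w <- linmv 5 ++ trmv 5 ++
  [:: tvw 2 4 ++ tvw 5 3; tvw 4 2 ++ tvw 3 5; tvw 2 5 ++ tvw 4 3; tvw 5 2 ++ tvw 3 4;
      [:: dnw 1 Sw; dnw 2 Sw; dnw 3 Sw; dnw 1 Sw; dnw 2 Sw; dnw 1 Sw]]].
Definition repsF (i : nat) : seq (seq bool) := [seq [seq x == 1 | x <- v] | v <- nth [::] [::
  [:: [:: 0;0;0;1;1;0;0;0;0;0]; [:: 0;0;0;0;1;0;0;0;0;0]; [:: 0;0;0;0;0;0;1;1;0;0];
      [:: 0;0;0;0;0;0;0;0;1;0]; [:: 0;0;0;0;0;0;0;0;0;0]];
  [:: [:: 0;0;0;1;0;0;0;1;0;0]; [:: 0;0;0;1;0;0;0;0;0;0]; [:: 0;0;0;0;0;0;1;1;0;1];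
      [:: 0;0;0;0;0;0;0;0;1;0]; [:: 0;0;0;0;0;0;0;0;0;1]; [:: 0;0;0;0;0;0;0;0;0;0]];
  [:: [:: 0;0;1;0;1;0;0;1;0;0]; [:: 0;0;1;0;1;0;0;0;0;0]; [:: 0;0;0;0;0;1;0;1;0;0];
      [:: 0;0;0;0;0;1;0;0;0;0]; [:: 0;0;0;0;0;0;0;1;0;0]; [:: 0;0;0;0;0;0;0;0;0;0]]] i].
(** The first two families receive the quintics that are not a cubic plus two points, the third one
    the quartics of full rank. *)
Definition TF i := nth (zr 5) [:: org 5; org 5; q4] i.
Definition cF i := nth (zr 5) [:: nth (zr 5) repsA 1; nth (zr 5) repsA 2; r3] i.

Definition tF := Eval vm_compute in
  [seq orb (@lo2h 5 3) (bldF (TF i) (cF i)) (rdF (TF i)) wsF (repsF i) | i <- iota 0 3].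
Lemma tF_ok : all (fun i => allb 10 (orb_ok (@lo2h 5 3) (bldF (TF i) (cF i)) (nth TE tF i) (repsF i) isdn))
  (iota 0 3).
Proof. by vm_compute. Qed.
(* Hyperplanes that were found to settle almost all members of each family. *)
Definition family_hyps i := [seq nth [::] (hyperplanes 6) j | j <- nth [::] [:: [:: 61; 52]; [:: 55; 58; 32]; [:: 15; 54]] i]
  ++ hyperplanes 6.
Definition family_test i := let ws := family_hyps i in
  all (fun r => let f := bldF (TF i) (cF i) r in
    allc (mons 5 2) (zr 5) (fun q => split_test_any ws (xr f (pr (zr 5) q)))) (repsF i).
Lemma family_test_ok : all family_test (iota 0 3).
Proof. by vm_compute. Qed.
Lemma fam14 i A : i < 3 -> lo 4 A -> fam 14 (TF i) (cF i) A.
Proof.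
move=> lt; have iin : i \in iota 0 3 by rewrite mem_iota.
apply: (fam_all (allP tF_ok i iin) (@split_test_anyP (family_hyps i))).
exact: (allP family_test_ok i iin).
Qed.

Lemma trs_tr n (z : pt n) : exists s : seq nat, forall f : BF n, foldl (fun g j => tr j g) f s = trs z f.
Proof.
elim: n z => [|n IH]; first by move=> z; exists [::].
move=> [b z]; have [s es] := IH z.
have e (f : BF n * BF n) :
    foldl (fun (g : BF n.+1) j => tr j g) (f : BF n.+1) [seq j.+1 | j <- s] =
    ((trs z f.1, trs z f.2) : BF n.+1).
  by rewrite -!es; elim: s f {es} => [|j s IHs] [f1 f2] //=; rewrite IHs.
by case: b; [exists (0 :: [seq j.+1 | j <- s]) | exists [seq j.+1 | j <- s]] => f /=; rewrite e.
Qed.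
(** The map [x + x_top z] is linear and translates only the second half. *)
Lemma lin_shear n (z : pt n) : exists w, all islin w /\ forall a b : BF n, act w (pr a b) = pr a (trs z b).
Proof.
have [s es] := trs_tr z; exists [seq Sh j | j <- s]; split; first by elim: s {es}.
by move=> a b; rewrite -es; elim: s b {es} => [|j s IH] b //=; rewrite -IH.
Qed.

Definition px n b (x : pt n) : pt n.+1 := (b, x).
Lemma dl0 n (x : pt n) : dl (px false x) = pr (dl x) (zr n). Proof. by []. Qed.
Lemma dl1 n (x : pt n) : dl (px true x) = pr (zr n) (dl x). Proof. by []. Qed.

Lemma tpE n (f : BF n.+1) : 3 < n -> tp f -> ~~ lo n f ->
  exists c x y, [/\ lo 4 c, x <> y & f = xr c (xr (dl x) (dl y))].
Proof.
move=> n3 [x [y l]] nl; exists (xr f (xr (dl x) (dl y))), x, y; split=> //; last by rewrite xrK.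
move=> e; move: l; rewrite e xrr xr0 => /(@loW n.+1 4 n f n3) l; by rewrite l in nl.
Qed.

Lemma quintic6_tp (h : BF 6) : ~~ lo 5 h -> tp h -> L 14 h \/ L 16 h /\ U 24 h.
Proof.
move=> nl /tpE-/(_ isT nl) [c [x [y [lc xy ->]]]].
case: (cubic_types lc) => [l|[l _]|[l u p]|[_ _ p]].
- by left; apply: (LW (k := 12)) => //; apply: L_cubic_dl2.
- by left; apply: L_cubic_dl2.
- by right; split; [apply: p | rewrite xrA; do 2 apply: U_dl].
- by left; apply: p.
Qed.

(** The halves differ by a cubic in five variables. If its cubic part vanishes, removing the two
    copies of the origin leaves a cubic; otherwise linear moves, which fix the origin, lead to one
    of the first two families. *)
Lemma quintic6_org (k1 k2 : BF 5) : lo 4 k1 -> lo 4 k2 ->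
  let h := pr (xr (org 5) k1) (xr (org 5) k2) in L 14 h \/ tp h.
Proof.
move=> l1 l2 h; have [w [i [lw iin l]]] := cubic5_form (lo_xr l1 l2).
have e : act [seq Dn m | m <- w] h = pr (xr (org 5) (act w k1)) (xr (org 5) (act w k2)).
  by rewrite act_pr !act_xr act_org.
have fin j c : j < 3 -> TF j = org 5 -> cF j = c ->
    lo 3 (xr (act w (xr k1 k2)) c) -> L 14 h.
  move=> j3 eT ec lq; apply: (@L_act _ [seq Dn m | m <- w]); rewrite e.
  have lA : lo 4 (act w k1) by rewrite lo_actE.
  have := @fam14 j _ j3 lA _ lq; rewrite eT ec act_xr.
  set X := pr _ _; set Y := pr _ _; suff -> : X = Y by [].
  by congr pr; xring.
move: iin l; rewrite !inE => /or3P[] /eqP-> l.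
- right; apply: (@tp_act _ [seq Dn m | m <- w]); rewrite e.
  exists (px false (pz 5)), (px true (pz 5)).
  rewrite dl0 dl1 -!org_dl (xr_pr (org 5)) x0r xr0 xr_pr lo_pr; apply/andP; split.
    have -> : xr (xr (org 5) (act w k1)) (org 5) = act w k1 by xring.
    by rewrite lo_actE.
  have -> : xr (xr (xr (org 5) (act w k1)) (org 5)) (xr (xr (org 5) (act w k2)) (org 5)) =
    xr (act w (xr k1 k2)) (zr 5) by rewrite act_xr; xring.
  exact: l.
- by left; apply: (fin 0 (nth (zr 5) repsA 1)).
- by left; apply: (fin 1 (nth (zr 5) repsA 2)).
Qed.

(** On a hyperplane where degree 5 survives both halves have odd weight, so each is a cubic plus a
    point. A shear and a translation move both points to the origins of the halves. *)
Lemma quintic6 (h : BF 6) : lo 6 h -> ~~ lo 5 h -> L 14 h \/ [/\ tp h, L 16 h & U 24 h].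
Proof.
move=> l6 l5; suff [l|t] : L 14 h \/ tp h; first by left.
  by case: (quintic6_tp l5 t) => [l|[? ?]]; [left | right].
have [|i le nl] := @res_lo 5 5 h _ l6 l5; first by [].
suff : L 14 (act (up i) h) \/ tp (act (up i) h).
  by case=> [/L_act|/tp_act]; [left | right].
have := l6; rewrite -(lo_actE (up i)) (up_pr h le).
move: (res i h) (rh _) nl => a b na; rewrite lo_pr => /andP[la lab].
have oa : odd (wt a) by rewrite lo_even negbK in na.
have ob : odd (wt b) by move: lab; rewrite lo_even odd_wt_xr oa; case: odd.
have [x lx] := odd_split oa; have [y ly] := odd_split ob.
have [w [_ ew]] := lin_shear (padd x y).
pose w' := w ++ [seq Dn m | m <- trw x].
suff : L 14 (act w' (pr a b)) \/ tp (act w' (pr a b)).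
  by case=> [/L_act|/tp_act]; [left | right].
have org_trs z (f : BF 5) : xr (trs z f) (org 5) = trs z (xr f (dl z)).
  by rewrite trs_xr trs_dl paddxx org_dl.
have -> : act w' (pr a b) = pr (xr (org 5) (xr (org 5) (trs x a))) (xr (org 5) (xr (org 5) (trs y b))).
  rewrite act_cat ew act_pr -!trsE trs_padd !xKr.
  by rewrite (paddC x (padd x y)) (paddC x y) paddK.
by apply: quintic6_org; rewrite xrC org_trs lo_trs.
Qed.

Lemma U_odd_quartic (g : BF 6) x : lo 5 (xr g (dl x)) -> ~~ lo 4 (xr g (dl x)) -> U 25 g.
Proof.
move=> l5 l4 q lq; have l : lo 5 (xr (xr g (dl x)) q) by rewrite lo_xr // (loW _ lq).
have n : ~~ lo 4 (xr (xr g (dl x)) q).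
  by apply: contra l4 => l'; rewrite -(xrK (xr g (dl x)) q) lo_xr // (loW _ lq).
have := D1_25 x l n; set X := xr _ _; suff -> : X = xr g q by [].
by rewrite /X; xring.
Qed.

(** * Seven variables, even weight *)

Lemma all_or (A : Type) (P Q : A -> Prop) (s : seq A) : (forall a, List.In a s -> P a \/ Q a) ->
  (exists2 a, List.In a s & P a) \/ (forall a, List.In a s -> Q a).
Proof.
elim: s => [|a s IH] H; first by right.
case: (H a (or_introl erefl)) => [p|q]; first by left; exists a => //; left.
case: IH => [b bs|[b bs p]|all]; first by apply: H; right.
- by left; exists b => //; right.
- by right=> b /= [<-|/all].
Qed.
Lemma In_filter (A : Type) (p : pred A) s x : List.In x (filter p s) -> List.In x s /\ p x.
Proof.
elim: s => //= a s IH; case: ifP => [pa [<-|/IH[]]|_ /IH[]]; by [split; [left|] | split; [right|]].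
Qed.
Lemma pairwise_le n (G B : seq (BF n)) : pairwise (fun g h => ~~ lo 2 (xr g h)) G ->
  (forall g, List.In g G -> exists2 b, List.In b B & lo 2 (xr g b)) -> size G <= size B.
Proof.
elim: B G => [|b B IH] G pG H; first by case: G {pG} H => // g G /(_ g (or_introl erefl)) [].
pose p g := lo 2 (xr g b); rewrite -(count_predC p) -[size (b :: B)]add1n leq_add //; last first.
  rewrite -size_filter; apply: IH; first exact: pairwise_filter.
  move=> g hg; have [gG np] := In_filter hg; have [b' /= [<-|bB] l] := H g gG; last by exists b'.
  by rewrite /= /p l in np.
rewrite -size_filter; have := pairwise_filter p pG.
have : forall g, List.In g (filter p G) -> p g by move=> g hg; have [] := In_filter hg.
case: (filter p G) => [|g [|h s]] //= P /andP[/andP[/negP[]]].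
have -> : xr g h = xr (xr g b) (xr h b) by xring.
by apply: lo_xr; apply: P; [left | right; left].
Qed.
Lemma bad24_good15 (c1 c2 : BF 6) x : bad24 c1 -> good15 c2 ->
  exists g, [/\ lo 3 g, D1 24 (xr c1 g) & wt (xr (xr c2 (dl x)) g) <= 15].
Proof.
move=> [B sB HB] /(_ x) [G [sG HG pG]].
have [|[g gG d]|H] := @all_or _ (fun g => D1 24 (xr c1 g))
    (fun g => exists2 b, List.In b B & lo 2 (xr g b)) G.
- by move=> g /HG/andP[lg _]; apply: HB.
- by have /andP[lg w] := HG _ gG; exists g.
- by have := leq_trans sG (leq_trans (pairwise_le pG H) sB); rewrite ltnn.
Qed.
Lemma good15_L15 (c : BF 6) x : good15 c -> L 15 (xr c (dl x)).
Proof.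
move=> /(_ x) [[|g G] [// _ H _]]; have /andP[lg w] := H g (or_introl erefl).
by exists g.
Qed.
Lemma good15_L16 (c : BF 6) : good15 c -> L 16 c.
Proof. by move=> /(@good15_L15 _ (pz 6))/(@L_dl _ _ _ (pz 6)); rewrite xrK. Qed.

Lemma L_swap_pr n k (f g : BF n) : L k (pr f g) -> L k (pr g f).
Proof. exact: L_swap. Qed.
Lemma L40_D1 (f g q : BF 6) a b : a + b <= 40 -> lo 3 q -> wt (xr f q) <= a -> D1 b (xr g q) ->
  L 40 (pr f g).
Proof. by move=> le lq w d; apply: (LW le); apply: glue_D1 lq w d. Qed.
Lemma L40_LU (f g : BF 6) a b : L a f -> U b g -> a + b <= 40 -> L 40 (pr f g).
Proof. by move=> l u le; apply: (LW le); apply: glue_pr. Qed.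
Lemma L40_UL (f g : BF 6) a b : U a f -> L b g -> a + b <= 40 -> L 40 (pr f g).
Proof. by move=> l u le; apply: (LW le); apply: glueC_pr. Qed.

Lemma L40_even (c1 c2 : BF 6) : lo 4 c1 -> lo 4 c2 -> L 40 (pr c1 c2).
Proof.
move=> /cubic_types [l1|[l1 u1]|[l1 u1 p1]|[b1 g1 p1]];
  first by move=> _; exact: (L40_LU l1 (U_28 c2)).
all: move=> /cubic_types [l2|[l2 u2]|[l2 u2 p2]|[b2 g2 p2]];
  first (by exact: (L40_UL (U_28 c1) l2)).
1,2: by exact: (L40_LU l1 u2).
1: by exact: (L40_UL u1 (good15_L16 g2)).
1,2: by exact: (L40_UL u1 l2).
1: by exact: (L40_UL u1 (good15_L16 g2)).
1,2: by exact: (L40_LU (good15_L16 g1) u2).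
(* Both cubics are of the last type: a common quadratic is within 16 of [c2] and leaves [c1] within
   24 of an affine function. *)
have [g [lg d w]] := bad24_good15 (pz 6) b1 g2.
apply: L_swap_pr; apply: (@L40_D1 _ _ _ 16 24 _ lg _ d) => //.
by have := wt_le (xr (xr c2 (dl (pz 6))) g) (dl (pz 6)); rewrite wt_dl xrAC xrK; lia.
Qed.

Lemma L40_odd (c1 c2 : BF 6) x : lo 4 c1 -> lo 4 c2 -> L 40 (pr c1 (xr c2 (dl x))).
Proof.
move=> l41 l42; case: (cubic_types l41) => [l1|[l1 u1]|[l1 u1 p1]|[b1 g1 p1]];
  first by exact: (L40_LU l1 (U_28 _)).
all: case: (cubic_types l42) => [l2|[l2 u2]|[l2 u2 p2]|[b2 g2 p2]];
  try (by exact: (L40_UL (U_28 c1) (L_cubic_dl x (isT : 0 < 12) l42 l2))).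
1,4: by exact: (L40_UL u1 (L_cubic_dl x (isT : 0 < 14) l42 l2)).
1,3: by exact: (L40_UL u1 (L_cubic_dl1 x (isT : 1 < 18) l42 l2)).
1,2: by exact: (L40_UL u1 (good15_L15 x g2)).
1,2: by exact: (L40_LU (good15_L16 g1) (U_dl x u2)).
have [g [lg d w]] := bad24_good15 x b1 g2.
by apply: L_swap_pr; apply: (@L40_D1 _ _ _ 15 24 _ lg _ d).
Qed.

(** Replacing monomials by their complements turns quartic forms in six variables into alternating
    bilinear forms; these four have rank 0, 2, 4 and 6. *)
Definition q6s : seq (BF 6) := Eval vm_compute in [:: zr 6; pr (zr 5) (nth (zr 5) repsA 1);
  pr (zr 5) (nth (zr 5) repsA 2); pr q4 (xr q4 r3)].
Definition q6 (i : nat) : BF 6 := nth (zr 6) q6s i.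
Definition bldQ v : BF 6 := pr q4 (xr q4 (comb v (mons 5 3))).
Definition rdQ (f : BF 6) := cf 3 (xr (lh f) (rh f)).
Definition repsQ := [seq cf 3 (nth (zr 5) repsB i) | i <- iota 0 3].
Definition tQ := Eval vm_compute in orb (lo 4) bldQ rdQ (linmv 6) repsQ.
Lemma tQ_ok : allb 10 (orb_ok (lo 4) bldQ tQ repsQ predT).
Proof. by vm_compute. Qed.
(** A cyclic shift of the first five coordinates; it takes the forms of rank 2 and 4 built on [q4]
    to [q6 1] and [q6 2]. *)
Definition rot5 : seq mv := [seq dnw i Sw | i <- iota 0 4].
Lemma rot5_ok : all (fun i => has (fun j =>
    has (fun w => lo 4 (xr (act w (bldQ (nth [::] repsQ i))) (q6 j))) [:: [::]; rot5]) (iota 0 4)) (iota 0 3).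
Proof. by vm_compute. Qed.

Lemma quartic6_form (h : BF 6) : lo 5 h -> exists w i, i < 4 /\ lo 4 (xr (act w h) (q6 i)).
Proof.
move=> lh5; have := lh5; rewrite {1}(pr_eta h) lo_pr => /andP[l5 l4].
set a := lh h in l5 l4; set d := xr a (rh h) in l4.
have eh : h = pr a (xr a d) by rewrite xKr -pr_eta.
have := allbP tB0_ok (v := cf 4 a) (size_cf 4 a) => /orb_okP[w [r [_ rin l]]].
have {}l : lo 4 (xr (act w a) (bldB0 r)).
  have -> : xr (act w a) (bldB0 r) =
      xr (act w (xr a (bldB0 (cf 4 a)))) (xr (act w (bldB0 (cf 4 a))) (bldB0 r)).
    by rewrite act_xr; xring.
  by rewrite lo_xr // lo_actE; apply: lo_cf.
move: rin l; rewrite !inE => /orP[] /eqP->.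
  have -> : bldB0 (cf 4 (zr 5)) = zr 5 by vm_compute.
  rewrite xr0 lo_actE => la; have [w' [i [lw iin l]]] := cubic5_form l4.
  exists [seq Dn m | m <- w'], i; split; first by move: iin; rewrite mem_iota => /leq_trans ->.
  have -> : q6 i = pr (zr 5) (nth (zr 5) repsA i).
    by move: iin; rewrite !inE => /or3P[] /eqP->.
  rewrite eh act_pr xr_pr lo_pr xr0 lo_actE la act_xr.
  have -> : xr (act w' a) (xr (xr (act w' a) (act w' d)) (nth (zr 5) repsA i)) =
     xr (act w' d) (nth (zr 5) repsA i) by xring.
  exact: l.
have -> : bldB0 (cf 4 q4) = q4 by vm_compute.
move=> l; have ld : lo 4 (act w d) by rewrite lo_actE.
set v := cf 3 (act w d).
have := allbP tQ_ok (v := v) (size_cf 3 _) => /orb_okP[w1 [r1 [_ /(nthP [::])[i]]]].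
rewrite size_map size_iota => i3 <- l1; have := allP rot5_ok i.
rewrite mem_iota i3 => /(_ isT)/hasP[j]; rewrite mem_iota => /andP[_ j4] /has_In[w2 _ l2].
exists ([seq Dn m | m <- w] ++ w1 ++ w2), j; split=> //.
rewrite !act_cat; set b := bldQ (nth _ _ _) in l1 l2; set H := act _ h.
have -> : xr (act w2 (act w1 H)) (q6 j) = xr (act w2 (act w1 (xr H (bldQ v))))
  (xr (act w2 (xr (act w1 (bldQ v)) b)) (xr (act w2 b) (q6 j))).
  by rewrite !act_xr; xring.
rewrite lo_xr //; last by rewrite lo_xr ?lo_actE.
rewrite !lo_actE /H eh act_pr act_xr /bldQ xr_pr lo_pr l andTb.
have -> : xr (xr (act w a) q4) (xr (xr (act w a) (act w d)) (xr q4 (comb v (mons 5 3)))) =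
  xr (act w d) (comb v (mons 5 3)) by xring.
exact: lo_cf.
Qed.

(** * Hyperplanes for quartics in seven variables *)

Definition rank6 (h : BF 6) := exists w, lo 4 (xr (act w h) (q6 3)).
Lemma rank6_L h : rank6 h -> L 14 h.
Proof.
case=> w l; apply: (@L_act _ w); rewrite -(xrK (act w h) (q6 3)).
move: l; set g := xr _ _; rewrite {1}(pr_eta g) lo_pr => /andP[lA lq].
have := @fam14 2 (lh g) isT lA _ lq.
set X := pr _ _; set Y := xr _ _; suff -> : X = Y by [].
have -> : Y = xr (pr (lh g) (rh g)) (pr q4 (xr q4 r3)) by rewrite /Y -pr_eta.
rewrite xr_pr /X -[TF 2]/q4 -[cF 2]/r3; congr pr; xring.
Qed.
Lemma rank6_nlo h : rank6 h -> ~~ lo 4 h.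
Proof.
case=> w l; apply/negP => lh4; have : lo 4 (q6 3).
  by rewrite -(xKr (act w h) (q6 3)) lo_xr // lo_actE.
by vm_compute.
Qed.
Lemma rank6_xr h g : lo 4 g -> rank6 (xr h g) -> rank6 h.
Proof.
move=> lg [w l]; exists w; move: l; rewrite act_xr xrAC lo_xrl ?lo_actE //.
Qed.
(* A hyperplane on which the quartic part of [f] vanishes or has full rank. *)
Definition good (f : BF 7) := exists w, lo 4 (lh (act w f)) && lo 4 (rh (act w f)) \/ rank6 (lh (act w f)).
Lemma good_act w f : good (act w f) -> good f.
Proof. by case=> w' h; exists (w ++ w'); rewrite act_cat. Qed.
Lemma lh_xr n (f g : BF n.+1) : lh (xr f g) = xr (lh f) (lh g). Proof. by []. Qed.
Lemma rh_xr n (f g : BF n.+1) : rh (xr f g) = xr (rh f) (rh g). Proof. by []. Qed.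
Lemma lo_lr n k (f : BF n.+1) : lo k f -> lo k (lh f) /\ lo k (rh f).
Proof.
rewrite {1}(pr_eta f) lo_pr => /andP[l1 l2]; split=> //.
by rewrite -(xKr (lh f) (rh f)) lo_xr // (loW _ l2) // leq_pred.
Qed.
Lemma good_xr f g : lo 4 g -> good (xr f g) -> good f.
Proof.
move=> lg [w h]; exists w; move: h; rewrite act_xr lh_xr rh_xr.
have [l1 l2] : lo 4 (lh (act w g)) /\ lo 4 (rh (act w g)) by apply: lo_lr; rewrite lo_actE.
by rewrite !lo_xrl // => -[h|/(rank6_xr l1)]; [left | right].
Qed.
(** By [goodh_norm] this depends only on the class of the quartic part of [h], so four forms remain
    to be treated. *)
Definition goodh (h : BF 6) := forall b, lo 4 (xr h b) -> good (pr h b).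
Lemma goodh_lh f w : lo 5 f -> goodh (lh (act w f)) -> good f.
Proof.
rewrite -(lo_actE w) => l /(_ (rh (act w f))) H; apply: (@good_act w).
by move: l; rewrite {1}(pr_eta (act w f)) lo_pr => /andP[_ /H]; rewrite -pr_eta.
Qed.
Lemma goodh_norm w i h : lo 4 (xr (act w h) (q6 i)) -> goodh (q6 i) -> goodh h.
Proof.
move=> l H b lb; apply: (@good_act [seq Dn m | m <- w]); rewrite act_pr.
set g := xr (act w h) (q6 i) in l.
apply: (@good_xr _ (pr g g)); first by rewrite lo_pr l xrr lo_zr.
rewrite xr_pr; have -> : xr (act w h) g = q6 i by rewrite /g xKr.
apply: H; have -> : xr (q6 i) (xr (act w b) g) = act w (xr h b) by rewrite /g act_xr; xring.
by rewrite lo_actE.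
Qed.
Lemma goodh0 : goodh (q6 0).
Proof.
have -> : q6 0 = zr 6 by [].
by move=> b; rewrite x0r => lb; exists [::]; left; apply/andP; split; [exact: lo_zr | exact: lb].
Qed.
Lemma goodh3 : goodh (q6 3).
Proof. by move=> b _; exists [::]; right; exists [::]; rewrite xrr lo_zr. Qed.

(** A mere proposal, including the default [(0, [::])]: [in_class] checks that the word leads to the
    announced form. *)
Definition norm6 (h : BF 6) : nat * seq mv :=
  if tget tB0 (cf 4 (lh h)) is Some (i, w) then
    let w' := [seq Dn m | m <- w] in
    if i is 0 then if tget tA (cf 3 (xr (lh h) (rh h))) is Some (i, w) then (i, [seq Dn m | m <- w]) else (0, [::])
    else let h' := act w' h in
      if tget tQ (cf 3 (xr (lh h') (rh h'))) is Some (j, w'') then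
        (j.+1, w' ++ w'' ++ if j is 2 then [::] else rot5)
      else (0, [::])
  else (0, [::]).
Definition in_class (s : seq nat) (h : BF 6) : bool :=
  let: (i, w) := norm6 h in if i \in s then lo 4 (xr (act w h) (q6 i)) else false.
Lemma in_class_good s h : (forall i, i \in s -> goodh (q6 i)) -> in_class s h -> goodh h.
Proof.
by rewrite /in_class; case: norm6 => i w H; case: ifP => // /H g /goodh_norm; apply.
Qed.

Lemma comb_catE n v (s t : seq (BF n)) : comb v (s ++ t) = xr (comb (take (size s) v) s) (comb (drop (size s) v) t).
Proof.
elim: s v => [|m s IH] v /=; first by rewrite drop0 x0r.
case: v => [|[] v] /=; rewrite ?IH ?xrA //.
by case: {IH} t => //= *; rewrite xr0.
Qed.
Lemma lo_comb n k v (ms : seq (BF n)) : all (lo k) ms -> lo k (comb v ms).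
Proof.
elim: ms v => [|m ms IH] [|[] v] //=; rewrite ?lo_zr // => /andP[lm /IH lms] //.
by rewrite lo_xr.
Qed.
Definition spansb n d (B : seq (BF n)) (vs : seq (seq bool)) :=
  all (fun m => hasi (fun v => lo d (xr m (comb v B))) vs) (mons n d).
Lemma hasi_ex (A : Type) (p : A -> bool) s : hasi p s -> exists x, p x.
Proof. by elim: s => //= x s IH; case: ifP => [px _|_ /IH //]; exists x. Qed.
Lemma spansbP n d (B : seq (BF n)) vs f : spansb d B vs -> lo d.+1 f -> exists v, lo d (xr f (comb v B)).
Proof.
move=> sp /lo_cf l; suff [v lv] : exists v, lo d (xr (comb (cf d f) (mons n d)) (comb v B)).
  exists v; have -> : xr f (comb v B) = xr (xr f (comb (cf d f) (mons n d)))
    (xr (comb (cf d f) (mons n d)) (comb v B)) by xring.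
  exact: lo_xr.
move: {l} (cf d f) sp => u; rewrite /spansb; elim: (mons n d) u => [|m ms IH] u /=.
  by exists [::]; rewrite comb_nil xr0 lo_zr.
case/andP=> /hasi_ex[v0 l0] /IH {}IH; case: u => [|[] u]; last by exact: IH.
  by exists [::]; rewrite comb_nil xr0 lo_zr.
have [v lv] := IH u; exists (addv v0 v); rewrite comb_addv xrACA.
exact: lo_xr.
Qed.

Section Class.
Variable i : nat.
Definition qf (c : BF 6) : BF 7 := pr (q6 i) (xr (q6 i) c).
Definition dq j := xr (q6 i) (tr j (q6 i)).
Lemma qf_lo c g : lo 3 g -> good (qf (xr c g)) -> good (qf c).
Proof.
move=> lg h; apply: (@good_xr _ (pr (zr 6) g)); first by rewrite lo_pr x0r lo_zr.
by move: h; rewrite /qf xr_pr xr0 xrA.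
Qed.
(** The shear translates the second half and thereby adds to [c] a derivative of [q6 i], so [c]
    matters only modulo these derivatives and quadratics. *)
Lemma qf_shift c j : lo 4 c -> good (qf (xr c (dq j))) -> good (qf c).
Proof.
move=> lc h; apply: (@good_act [:: Sh j]).
have -> : act [:: Sh j] (qf c) = pr (q6 i) (tr j (xr (q6 i) c)) by [].
apply: (@good_xr _ (pr (zr 6) (xr c (tr j c)))).
  by rewrite lo_pr x0r lo_zr; apply: (@lo_dtr 6 j 4).
rewrite xr_pr xr0; move: h; rewrite /qf tr_xr.
set X := xr _ _; set Y := xr _ _; suff -> : X = Y by [].
by rewrite /X /Y /dq; xring.
Qed.
Lemma qf_shifts c v s : lo 5 (q6 i) -> lo 4 c -> good (qf (xr c (comb v [seq dq j | j <- s]))) -> good (qf c).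
Proof.
move=> lq; elim: s c v => [|j s IH] c v lc; first by rewrite [comb _ _]/(zr 6) xr0.
case: v => [|[] v]; first by rewrite comb_nil xr0.
- have ld : lo 4 (xr c (dq j)) by rewrite lo_xr // (@lo_dtr 6 j 5).
  have -> : comb (true :: v) [seq dq k | k <- j :: s] = xr (dq j) (comb v [seq dq k | k <- s]) by [].
  by rewrite xrA => h; apply: (qf_shift lc); apply: IH h.
- by move=> h; apply: (IH c v lc).
Qed.

Variables (s : seq nat) (ws : seq (seq mv)).
Hypothesis sg : forall i, i \in s -> goodh (q6 i).
(** A pruned search. By [nest_wf] the monomials of deeper levels contribute only cubics to the half
    tested at a level, so a success there settles the whole subtree. *)
Fixpoint nest (lv : seq (seq mv * seq (BF 6))) (c : BF 6) : bool :=
  if lv is (w, ms) :: lv' then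
    allc ms c (fun c' => if in_class s (lh (act w (qf c'))) then true else nest lv' c')
  else hasi (fun w => in_class s (lh (act w (qf c)))) ws.
Fixpoint nest_wf (lv : seq (seq mv * seq (BF 6))) : bool :=
  if lv is (w, ms) :: lv' then
    all (lo 4) ms && all (fun m => lo 4 (lh (act w (pr (zr 6) m)))) (flatten (unzip2 lv')) && nest_wf lv'
  else true.
Lemma nest_wf_lo lv : nest_wf lv -> all (lo 4) (flatten (unzip2 lv)).
Proof.
elim: lv => // -[w ms] lv IH /andP[/andP[l _] /IH l'].
by rewrite [flatten _]/(ms ++ flatten (unzip2 lv)) all_cat l.
Qed.
Lemma qf_lh w c : lo 5 (q6 i) -> lo 4 c -> goodh (lh (act w (qf c))) -> good (qf c).
Proof.
move=> lq lc; apply: goodh_lh; rewrite lo_pr lq xKr; exact: lc.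
Qed.
Lemma goodh_xr h g : lo 4 g -> goodh (xr h g) -> goodh h.
Proof.
move=> lg H b lb; apply: (@good_xr _ (pr g g)); first by rewrite lo_pr lg xrr lo_zr.
rewrite xr_pr; apply: H; have -> : xr (xr h g) (xr b g) = xr h b by xring.
exact: lb.
Qed.
Lemma lh_comb w v ms : all (fun m => lo 4 (lh (act w (pr (zr 6) m)))) ms ->
  lo 4 (lh (act w (pr (zr 6) (comb v ms)))).
Proof.
have z : lo 4 (lh (act w (pr (zr 6) (zr 6)))).
  by apply: (proj1 (lo_lr _)); rewrite lo_actE (lo_zr 7).
elim: ms v => [|m ms IH] [|[] v] // /andP[lm lms]; last exact: IH.
have -> : pr (zr 6) (comb (true :: v) (m :: ms)) = xr (pr (zr 6) m) (pr (zr 6) (comb v ms)).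
  by rewrite xr_pr xr0.
by rewrite act_xr lh_xr lo_xr // IH.
Qed.
Lemma nestP lv c v : lo 5 (q6 i) -> lo 4 c -> nest_wf lv -> nest lv c ->
  good (qf (xr c (comb v (flatten (unzip2 lv))))).
Proof.
move=> lq; elim: lv c v => [|[w ms] lv IH] c v lc.
  rewrite [comb _ _]/(zr 6) xr0 /nest => _.
  by elim: ws => //= w ws' IH; case: ifP => [/(in_class_good sg)/(qf_lh lq lc)|_ /IH].
case/andP=> /andP[lm l0] wf al; rewrite [flatten _]/(ms ++ flatten (unzip2 lv)) comb_catE xrA.
set v1 := take _ _; set v2 := drop _ _; set c' := xr c _.
have lc' : lo 4 c' by rewrite lo_xr // lo_comb.
have := allcP al v1; rewrite -/c'; case: ifP => [/(in_class_good sg) g _|_ h]; last exact: IH.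
have lv4 : lo 4 (comb v2 (flatten (unzip2 lv))).
  exact/lo_comb/nest_wf_lo.
apply: (@qf_lh w) => //; first exact: lo_xr.
apply: (goodh_xr (lh_comb v2 l0)); move: g.
have -> : qf c' = xr (qf (xr c' (comb v2 (flatten (unzip2 lv))))) (pr (zr 6) (comb v2 (flatten (unzip2 lv)))).
  by rewrite /qf xr_pr xr0; congr pr; xring.
by rewrite act_xr lh_xr.
Qed.
Lemma goodh_nest lv vs : lo 5 (q6 i) -> nest_wf lv -> nest lv (zr 6) ->
  spansb 3 ([seq dq j | j <- iota 0 6] ++ flatten (unzip2 lv)) vs -> goodh (q6 i).
Proof.
move=> lq wf ne sp b lb; have [v] := spansbP sp lb.
rewrite comb_catE; set u1 := comb _ [seq _ | _ <- _]; set u2 := comb _ (flatten _) => l.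
have -> : pr (q6 i) b = qf (xr (q6 i) b) by rewrite /qf xKr.
apply: (qf_shifts (s := iota 0 6) (v := take (size [seq dq j | j <- iota 0 6]) v) lq lb); rewrite -/u1.
apply: (qf_lo l); have := nestP (drop (size [seq dq j | j <- iota 0 6]) v) lq (lo_zr 6 4) wf ne.
rewrite -/u2 x0r.
suff -> : xr (xr (xr (q6 i) b) u1) (xr (xr (q6 i) b) (xr u1 u2)) = u2 by [].
by xring.
Qed.
End Class.

Definition mon6 (s : seq (seq nat)) := [seq sum_monom 6 [:: m] | m <- s].
(** Monomials completing the derivatives of [q6 i] to all cubic forms. [x1 x2 x5] and [x1 x2 x6] are
    derivatives of [q6 2] modulo quadratics, so the pair 1, 2 is added for [q6 1] only. Each level
    tests a hyperplane on which a variable common to all later monomials is 0. *)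
Definition lvq (i : nat) : seq (seq mv * seq (BF 6)) :=
  let P := if i is 1 then [:: [:: 1; 2]] else [::] in
  let Q := P ++ [:: [:: 1; 3]; [:: 1; 4]; [:: 2; 3]; [:: 2; 4]; [:: 3; 4]] in
  [:: (up 6, mon6 [seq rcons p 5 | p <- Q]); (up 5, mon6 [seq rcons p 6 | p <- Q]);
      (up 4, mon6 [seq [:: j; 5; 6] | j <- iota 1 4])].
Definition vsq : seq (seq bool) := let e j := rcons (nseq j false) true in
  [seq e j | j <- iota 0 22] ++ [seq addv (e j) (e k) | j <- iota 0 6, k <- iota 6 16].
Definition class_hyps := [seq nth [::] (hyperplanes 7) j | j <- [:: 7; 59; 22; 1; 79; 4; 111]] ++ hyperplanes 7.
Definition class_test i s := [&& lo 5 (q6 i), nest_wf (lvq i), nest i s class_hyps (lvq i) (zr 6) &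
  spansb 3 ([seq dq i j | j <- iota 0 6] ++ flatten (unzip2 (lvq i))) vsq].
Lemma class_testP i s : class_test i s -> (forall j, j \in s -> goodh (q6 j)) -> goodh (q6 i).
Proof. by case/and4P=> l wf ne sp sg; apply: (goodh_nest sg l wf ne sp). Qed.
Lemma class_test2 : class_test 2 [:: 0; 3]. Proof. by vm_compute. Qed.
Lemma class_test1 : class_test 1 [:: 0; 2; 3]. Proof. by vm_compute. Qed.
(** Rank 4 is reduced to ranks 0 and 6, and then rank 2 to ranks 0, 4 and 6. *)
Lemma goodh_q6 i : i < 4 -> goodh (q6 i).
Proof.
have g2 : goodh (q6 2).
  by apply: (class_testP class_test2) => j; rewrite !inE => /orP[] /eqP->; [exact: goodh0 | exact: goodh3].
have g1 : goodh (q6 1).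
  apply: (class_testP class_test1) => j; rewrite !inE => /or3P[] /eqP->;
  [exact: goodh0 | exact: g2 | exact: goodh3].
case: i => [|[|[|[|i]]]] // _; [exact: goodh0 | exact: goodh3].
Qed.

Lemma good_quartic (f : BF 7) : lo 5 f -> good f.
Proof.
rewrite {1}(pr_eta f) lo_pr => /andP[l5 l4]; have [w [i [i4 l]]] := quartic6_form l5.
by rewrite (pr_eta f); apply: (goodh_norm l (goodh_q6 i4)).
Qed.
(* Splitting off the top variable, the other half has the same quartic part. *)
Lemma quartic7_split (f : BF 7) : lo 5 f -> exists w (a b : BF 6), act w f = pr a b /\ (lo 4 a && lo 4 b \/ [/\ lo 5 a, lo 5 b, ~~ lo 4 a, ~~ lo 4 b & L 14 a /\ L 14 b]).
Proof.
move=> l5; have [w h] := good_quartic l5; exists w, (lh (act w f)), (rh (act w f)).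
split; first exact: pr_eta.
case: h => [->|r]; first by left.
have := l5; rewrite -(lo_actE w) {1}(pr_eta (act w f)) lo_pr => /andP[la lab].
have rb : rank6 (rh (act w f)) by apply: (rank6_xr lab); rewrite xrC xrK.
right; split; [| |exact: rank6_nlo|exact: rank6_nlo|by split; apply: rank6_L] => //.
by rewrite -(xKr (lh (act w f)) (rh (act w f))) lo_xr // (loW _ lab).
Qed.

Lemma L40_quartic (f : BF 7) : lo 5 f -> L 40 f.
Proof.
move=> /quartic7_split[w [a [b [e h]]]]; apply: (@L_act _ w); rewrite e.
case: h => [/andP[la lb]|[la lb na nb [La Lb]]]; first exact: L40_even.
by apply: (L40_LU La (U_26 (loW _ lb) nb)).
Qed.
Lemma px_eta n (x : pt n.+1) : x = px x.1 x.2. Proof. by case: x. Qed.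
Lemma L40_quartic_dl (f : BF 7) P : lo 5 f -> L 40 (xr f (dl P)).
Proof.
move=> /quartic7_split[w [a [b [e h]]]]; apply: (@L_act _ w); rewrite act_xr e.
have [y ->] := dl_act w P; rewrite (px_eta y); move: y.1 y.2 => [] x.
  rewrite dl1 xr_pr xr0; case: h => [/andP[la lb]|[la lb na nb [La Lb]]]; first exact: L40_odd.
  by apply: (L40_LU La (U_odd_quartic (x := x) _ _)); rewrite ?xrK.
rewrite dl0 xr_pr xr0; apply: L_swap_pr.
case: h => [/andP[la lb]|[la lb na nb [La Lb]]]; first exact: L40_odd.
by apply: (L40_LU Lb (U_odd_quartic (x := x) _ _)); rewrite ?xrK.
Qed.

Lemma glue_quintic (a b : BF 6) : lo 6 a -> lo 6 b -> ~~ lo 5 a -> ~~ lo 4 b -> L 40 (pr a b).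
Proof.
move=> la lb na nb; case: (quintic6 la na) => [La|[_ _ Ua]].
  exact: (L40_LU La (U_26 lb nb)).
have Ub : L 16 b.
  case: (boolP (lo 5 b)) => l5; first exact: quartic6_L16.
  by case: (quintic6 lb l5) => [|[]] // /(LW (m := 16)); apply.
exact: (L40_UL Ua Ub).
Qed.
Lemma L40_quintic (f : BF 7) : lo 6 f -> ~~ lo 5 f -> L 40 f.
Proof.
move=> l6 l5; have [|i le nl] := @res_lo 6 5 f _ l6 l5; first by [].
apply: (@L_act _ (up i)); have := l6; rewrite -(lo_actE (up i)) (up_pr f le).
move: (res i f) (rh _) nl => a b na; rewrite lo_pr => /andP[la lab].
have lb : lo 6 b by rewrite -(xKr a b) lo_xr // (loW _ lab).
have nb : ~~ lo 5 b by apply: contra na => lb5; rewrite -(xrK a b) lo_xr.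
by apply: glue_quintic => //; apply: contra nb => /(loW (m := 5)); apply.
Qed.

(** * Functions of degree six *)

Fixpoint res1 n i : BF n.+1 -> BF n :=
  if i is j.+1 then
    match n with m.+1 => fun f : BF m.+1 * BF m.+1 => (@res1 m j f.1, @res1 m j f.2) | 0 => fun f : BF 0 * BF 0 => f.2 end
  else fun f : BF n * BF n => f.2.
Lemma up_res01 n i (f : BF n.+1) : i <= n -> act (up i) f = pr (res i f) (res1 i f).
Proof.
elim: i n f => [|i IH] [|n] f //; first by case: f.
  by case: f.
move=> le_in; rewrite [up _]/([seq Dn m | m <- up i] ++ [:: Sw]) act_cat act_Dn !IH //.
Qed.
Lemma res1_xr n i (f g : BF n.+1) : xr (res1 i f) (res1 i g) = res1 i (xr f g).
Proof. by elim: i n f g => [|i IH] [|n] f g //=; rewrite -!IH. Qed.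
Fixpoint zi n i : pt n -> bool :=
  if n is m.+1 then fun z : bool * pt m => if i is j.+1 then zi j z.2 else z.1 else fun=> false.
Fixpoint mkpt n (p : nat -> bool) : pt n :=
  if n is m.+1 then (p 0, mkpt m (fun j => p j.+1)) else tt.
Lemma zi_mkpt n p i : i < n -> zi i (mkpt n p) = p i.
Proof. by elim: n p i => [|n IH] p [|i] //= le; rewrite IH. Qed.
Lemma res_trs n i (z : pt n.+1) : i <= n ->
  exists z', forall f : BF n.+1, res i (trs z f) = trs z' (if zi i z then res1 i f else res i f).
Proof.
elim: i n z => [|i IH] n [b z] le.
  by exists z => -[f1 f2]; case: n b z {le} f1 f2 => [|n] [] z f1 f2.
case: n z le => [|n] z le //; have [z' e] := IH n z le; exists (b, z') => -[f1 f2].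
have {}e (f : BF n.+1) := e f.
have -> : zi i.+1 ((b, z) : pt n.+2) = @zi n.+1 i z by [].
by case: (@zi n.+1 i z) e => e; case: b => /=; rewrite !e.
Qed.
Fixpoint ones n : pt n := if n is m.+1 then (true, ones m) else tt.
Definition dlb n (b : bool) (x : pt n) := if b then dl x else zr n.
Lemma dlb_xr n b1 b2 (x : pt n) : xr (dlb b1 x) (dlb (b1 (+) b2) x) = dlb b2 x.
Proof. by case: b1; case: b2; rewrite /dlb /= ?xrr ?xr0 ?x0r. Qed.
Lemma L_cubic_dlb n k (c : BF n.+1) b1 b2 (x : pt n) : 1 < k -> lo 4 c -> L k c ->
  L k (xr c (pr (dlb b1 x) (dlb b2 x))).
Proof.
move=> k1 lc Lc; case: b1; case: b2; rewrite /dlb.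
- have -> : pr (dl x) (dl x) = xr (dl (px false x)) (dl (px true x)).
    by rewrite dl0 dl1 xr_pr xr0 x0r.
  exact: L_cubic_dl2.
- by rewrite -(dl0 x); apply: L_cubic_dl => //; apply: ltnW.
- by rewrite -(dl1 x); apply: L_cubic_dl => //; apply: ltnW.
- by have -> : pr (zr n) (zr n) = zr n.+1 by []; rewrite xr0.
Qed.
(** A monomial that disappears in every restriction contains all variables, and [dl (ones n)] is the
    product of all variables. *)
Lemma res_all_lo n k (g : BF n.+1) : (forall i, i <= n -> lo k (res i g)) ->
  exists b, lo k (xr g (dlb b (ones n.+1))).
Proof.
elim: n k g => [|n IH] k g H.
  have l := H 0 isT; exists (xr (lh g) (rh g)); move: l; case: g {H} => g1 g2 /= l.
  by case: g1 g2 l => [] [] l /=; rewrite ?orbT ?orbF // ?l.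
have l0 : lo k (lh g) := H 0 isT.
have [i le|b lb] := IH k.-1 (xr (lh g) (rh g)).
  rewrite -res_xr; have := H i.+1 le.
  by rewrite [res _ _]/(pr (res i (lh g)) (res i (rh g))) lo_pr => /andP[].
exists b; have -> : dlb b (ones n.+2) = pr (zr n.+1) (dlb b (ones n.+1)) by case: b {lb}.
by rewrite (pr_eta g) xr_pr lo_pr xr0 l0 xrA.
Qed.

Lemma resS n i (a b : BF n.+1) : res i.+1 (pr a b) = pr (res i a) (res i b).
Proof. by []. Qed.
(** Only the product of all lower variables, with or without the top one, escapes these
    restrictions; it accounts for a change of at most two points. *)
Lemma flat_res n k (f : BF n.+2) : (forall i, i <= n -> lo k (res i.+1 f)) ->
  exists b1 b2, lo k (xr f (pr (dlb b1 (ones n.+1)) (dlb b2 (ones n.+1)))).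
Proof.
move=> H; have h i : i <= n -> lo k (res i (lh f)) /\ lo k.-1 (res i (xr (lh f) (rh f))).
  move=> le; have := H i le.
  by rewrite (pr_eta f) resS lo_pr -res_xr => /andP[].
have [|b1 l1] := @res_all_lo n k (lh f); first by move=> i /h[].
have [|b2 l2] := @res_all_lo n k.-1 (xr (lh f) (rh f)); first by move=> i /h[].
move: (ones n.+1) l1 l2 => p l1 l2; exists b1, (b1 (+) b2).
rewrite (pr_eta f) xr_pr lo_pr l1 andTb.
have -> : xr (xr (lh f) (dlb b1 p)) (xr (rh f) (dlb (b1 (+) b2) p)) =
    xr (xr (lh f) (rh f)) (xr (dlb b1 p) (dlb (b1 (+) b2) p)) by xring.
by rewrite dlb_xr.
Qed.

(** The monomial [x2 x3 x4 x5 x6 x7]; every nonzero form of degree 6 in seven variables is linearly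
    equivalent to it. *)
Definition m6 : BF 7 := pr (dl (ones 6)) (dl (ones 6)).
Definition bldS v : BF 7 := comb v (mons 7 6).
Definition tS := Eval vm_compute in orb (lo 6) bldS (@cf 7 6) (linmv 7) [:: cf 6 m6; cf 6 (zr 7)].
Lemma tS_ok : allb 7 (orb_ok (lo 6) bldS tS [:: cf 6 m6; cf 6 (zr 7)] predT).
Proof. by vm_compute. Qed.
Lemma m6_ok : all (fun i => [&& res i.+1 m6 == zr 6, lo 6 (res1 i.+1 m6) & ~~ lo 5 (res1 i.+1 m6)]) (iota 0 6).
Proof. by vm_compute. Qed.
Lemma lo_res01 n k i (f : BF n.+1) : i <= n -> lo k f ->
  [/\ lo k (res i f), lo k (res1 i f) & lo k.-1 (xr (res i f) (res1 i f))].
Proof.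
move=> le; rewrite -(lo_actE (up i)) up_res01 // => /[dup] /lo_lr[l1 l2].
by rewrite lo_pr => /andP[_ l3].
Qed.
(** [m6] vanishes on one half and has degree 5 on the other, so exactly one half of [f] has degree
    5, which is what [glue_quintic] asks of one half. *)
Lemma glue_sextic (f : BF 7) i : i < 6 -> lo 6 (xr f m6) ->
  ~~ lo 4 (res i.+1 f) -> ~~ lo 4 (res1 i.+1 f) -> L 40 f.
Proof.
move=> i6 lg na nb; have : i \in iota 0 6 by rewrite mem_iota.
move=> /(allP m6_ok)/and3P[/eqP z l6 l5].
have [l1 l2 l3] := @lo_res01 6 6 i.+1 _ i6 lg.
have ea : res i.+1 (xr f m6) = res i.+1 f by rewrite -res_xr z xr0.
rewrite ea in l1 l3; rewrite -res1_xr in l2 l3.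
have lb : lo 6 (res1 i.+1 f) by rewrite -(xrK (res1 i.+1 f) (res1 i.+1 m6)) lo_xr.
apply: (@L_act _ (up i.+1)); rewrite up_res01 //.
case: (boolP (lo 5 (res i.+1 f))) => a5; last exact: glue_quintic.
apply: L_swap_pr; apply: glue_quintic => //; apply: contra l5 => b5.
have -> : res1 i.+1 m6 = xr (xr (res i.+1 f) (xr (res1 i.+1 f) (res1 i.+1 m6)))
    (xr (res i.+1 f) (res1 i.+1 f)) by xring.
by rewrite lo_xr // lo_xr.
Qed.
Lemma L40_cubic_flat (f : BF 7) : (forall i, i < 6 -> lo 4 (res i.+1 f)) -> L 40 f.
Proof.
move=> H; have [b1 [b2 lc]] := @flat_res 5 4 f H; move: (ones 6) lc => p lc.
rewrite -(xrK f (pr (dlb b1 p) (dlb b2 p))); apply: L_cubic_dlb => //.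
exact/L40_quartic/(loW _ lc).
Qed.
Lemma L40_sextic (f : BF 7) : lo 7 f -> ~~ lo 6 f -> L 40 f.
Proof.
move=> l7 l6; have := lo_cf l7; set v := cf 6 f => lv.
have := allbP tS_ok (v := v) (size_cf 6 f) => /orb_okP[w [r [_ rin l]]].
have {}l : lo 6 (xr (act w f) (bldS r)).
  have -> : xr (act w f) (bldS r) = xr (act w (xr f (bldS v))) (xr (act w (bldS v)) (bldS r)).
    by rewrite act_xr; xring.
  by rewrite lo_xr // lo_actE.
apply: (@L_act _ w); move: (act w f) l (nlo_act w l6) => F l nF.
have {}l : lo 6 (xr F m6).
  move: rin l; rewrite !inE => /orP[] /eqP->.
    by have -> : bldS (cf 6 m6) = m6 by vm_compute.
  have -> : bldS (cf 6 (zr 7)) = zr 7 by vm_compute.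
  by rewrite xr0 (negbTE nF).
have [/allP al|/allPn[i]] := boolP (all (fun i => lo 4 (res i.+1 F) || lo 4 (res1 i.+1 F)) (iota 0 6)).
  (* Translate so that in each of the six directions the restriction known to be a cubic is the one
     at 0. *)
  pose z := mkpt 7 (fun j => if j is i.+1 then ~~ lo 4 (res i.+1 F) else false).
  apply: (@L_act _ (trw z)); rewrite -trsE; apply: L40_cubic_flat => i i6.
  have [z' ->] := @res_trs 6 i.+1 z i6; rewrite lo_trs zi_mkpt //.
  have := al i; rewrite mem_iota i6 => /(_ isT).
  by case: ifP => [/negPf->|/negbFE ->].
rewrite mem_iota negb_or => /andP[_ i6] /andP[na nb]; exact: glue_sextic l na nb.
Qed.

(** * Seven variables, odd weight *)

Lemma odd_quintic (b : BF 6) x : lo 6 b -> U 25 (xr b (dl x)) \/ exists s, lo 4 (xr (xr b (dl x)) (dl s)).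
Proof.
move=> lb; have [|s ls] := @odd_split 6 (xr b (dl x)).
  by rewrite odd_wt_xr wt_dl; move: lb; rewrite lo_even => /negPf->.
case: (boolP (lo 4 (xr (xr b (dl x)) (dl s)))) => l; first by right; exists s.
by left; apply: U_odd_quartic ls l.
Qed.
Lemma odd_quintic_tp (b : BF 6) x : lo 6 b -> ~ tp b -> U 25 (xr b (dl x)).
Proof.
move=> lb nt; case: (odd_quintic x lb) => // -[s ls]; case: nt; exists x, s.
by rewrite xrA.
Qed.
Lemma quintic6_ntp (b : BF 6) : lo 6 b -> ~~ lo 5 b -> ~ tp b -> L 14 b.
Proof. by move=> l6 l5 nt; case: (quintic6 l6 l5) => // -[]. Qed.
Section Point.
Variables (a b : BF 6) (x : pt 6).
Hypotheses (la : lo 6 a) (lb : lo 6 b) (na : ~~ lo 5 a) (nb : ~~ lo 5 b).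
Lemma glue_point : L 14 b -> U 25 (xr b (dl x)) -> L 40 (pr a (xr b (dl x))).
Proof.
move=> Lb Ub; case: (quintic6 la na) => [La|[_ _ Ua]]; first exact: (L40_LU La Ub).
exact: (L40_UL Ua (L_dl x Lb)).
Qed.
Lemma glue_ntp_in : ~ tp b -> L 40 (pr a (xr b (dl x))).
Proof. by move=> nt; apply: glue_point; [apply: quintic6_ntp | apply: odd_quintic_tp]. Qed.
Lemma glue_ntp_out : ~ tp a -> (forall s, ~~ lo 4 (xr (xr b (dl x)) (dl s))) -> L 40 (pr a (xr b (dl x))).
Proof.
move=> nt H; case: (odd_quintic x lb) => [Ub|[s]]; last by rewrite (negbTE (H s)).
exact: (L40_LU (quintic6_ntp la na nt) Ub).
Qed.
End Point.
Lemma glue_ntp2 (a b : BF 6) P : lo 6 a -> lo 6 b -> ~~ lo 5 a -> ~~ lo 5 b -> ~ tp a -> ~ tp b ->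
  L 40 (xr (pr a b) (dl P)).
Proof.
move=> la lb na nb ta tb; rewrite (px_eta P); case: P.1.
  by rewrite dl1 xr_pr xr0; apply: glue_ntp_in.
by rewrite dl0 xr_pr xr0; apply: L_swap_pr; apply: glue_ntp_in.
Qed.

(* An affine map sends any two points to [pz] and the point next to it. *)
Lemma lin_point n (z : pt n.+1) : z <> pz n.+1 ->
  exists w, all islin w /\ act w (dl z) = dl (px true (pz n)).
Proof.
elim: n z => [|n IH] [b z] nz.
  by case: b z nz => [] [] // _; exists [::].
case: b nz => nz.
  have [w [lw ew]] := lin_shear (z : pt n.+1); exists w; split=> //.
  by rewrite [dl _]/(pr (zr n.+1) (@dl n.+1 z)) ew trs_dl paddxx dl1.
have [|w [lw ew]] := IH z; first by move=> ez; case: nz; rewrite ez.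
exists ([seq Dn m | m <- w] ++ [:: Sw]); rewrite all_cat /= andbT; split.
  by elim: (w) lw => //= m w' IHw /andP[-> /IHw].
suff : act ([seq Dn m | m <- w] ++ [:: Sw]) (pr (@dl n.+1 z) (zr n.+1)) = dl (px true (pz n.+1)) by [].
rewrite act_cat act_pr ew.
have -> : act w (zr n.+1) = zr n.+1 by apply: wt0; rewrite wt_act wt_zr.
by [].
Qed.
Lemma act_pz n w : all islin w -> act w (dl (pz n)) = dl (pz n).
Proof. by rewrite -org_dl; apply: act_org. Qed.
Definition ln6 : BF 6 := pr (org 5) (org 5).
Lemma two_points (u v : pt 6) : u <> v -> exists w, act w (xr (dl u) (dl v)) = ln6.
Proof.
move=> nuv; have [|w [lw ew]] := @lin_point 5 (padd u v).
  by move=> e; case: nuv; apply: padd_eq0.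
exists (trw u ++ w); rewrite act_cat -trsE trs_xr !trs_dl paddxx act_xr ew act_pz //.
Qed.

Lemma res_zr n i : i <= n -> res i (zr n.+1) = zr n /\ res1 i (zr n.+1) = zr n.
Proof. by elim: i n => [|i IH] [|n] // le; have [/= -> ->] := IH n le. Qed.
Lemma res_org n i : i <= n -> res i (org n.+1) = org n /\ res1 i (org n.+1) = zr n.
Proof.
elim: i n => [|i IH] [|n] // le; have [e1 e2] := IH n le; have [e3 e4] := @res_zr n i le.
by split; [change (pr (res i (org n.+1)) (res i (zr n.+1)) = org n.+1)
  | change (pr (res1 i (org n.+1)) (res1 i (zr n.+1)) = zr n.+1)]; rewrite ?e1 ?e2 ?e3 ?e4.
Qed.
Lemma res_dl n i (x : pt n.+1) : i <= n -> exists y,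
  res i (dl x) = dl y /\ res1 i (dl x) = zr n \/ res i (dl x) = zr n /\ res1 i (dl x) = dl y.
Proof.
move=> le; have [z ez] := dl_act (up i) x; exists z.2; have := up_res01 (dl x) le.
rewrite ez (px_eta z) [(px _ _).2]/=; case: z.1; rewrite ?dl0 ?dl1 => -[<- <-]; by [right|left].
Qed.
Lemma res1S n i (a b : BF n.+1) : res1 i.+1 (pr a b) = pr (res1 i a) (res1 i b).
Proof. by []. Qed.

Lemma lo_odd n k (f : BF n) : k <= n -> lo k f -> ~~ odd (wt f).
Proof. by move=> le /(loW le); rewrite lo_even. Qed.
Lemma dl00 n (u v : pt n) : xr (dl (px false u)) (dl (px false v)) = pr (xr (dl u) (dl v)) (zr n).
Proof. by rewrite !dl0 xr_pr xr0. Qed.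
Lemma dl01 n (u v : pt n) : xr (dl (px false u)) (dl (px true v)) = pr (dl u) (dl v).
Proof. by rewrite dl0 dl1 xr_pr xr0 x0r. Qed.
Lemma dl11 n (u v : pt n) : xr (dl (px true u)) (dl (px true v)) = pr (zr n) (xr (dl u) (dl v)).
Proof. by rewrite !dl1 xr_pr xr0. Qed.
(** Nonzero cubics in five variables have weight at least 4. *)
Lemma org_two (x : pt 5) : lo 4 (xr (org 5) (dl x)) -> org 5 = dl x.
Proof.
have al : allpt (fun y : pt 5 => ~~ lo 4 (xr (org 5) (dl y)) || (wt (xr (org 5) (dl y)) == 0)).
  by vm_compute.
have := allptP al x => /orP[/negPf->|/eqP/wt0/xr_eq0] //.
Qed.
(* Both halves have odd weight, so each contains one of the two points, which
   must be [pz 5]. *)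
Lemma ntp_odd (e k1 k2 : BF 5) : lo 4 k1 -> lo 4 k2 -> e = org 5 -> ~~ lo 3 (xr k1 k2) ->
  ~ tp (pr (xr e k1) (xr e k2)).
Proof.
move=> l1 l2 -> nl [x [y]].
have od (k : BF 5) : lo 4 k -> lo 4 (xr (org 5) k) -> False.
  by move=> lk /(lo_odd (isT : 4 <= 5)); rewrite odd_wt_xr org_dl wt_dl (negbTE (lo_odd _ lk)).
have ex z1 z2 : lo 4 (xr (pr (xr (org 5) k1) (xr (org 5) k2)) (pr (dl z1) (dl z2))) -> False.
  rewrite xr_pr lo_pr => /andP[h1 h2].
  have e1 : org 5 = dl z1.
    apply: org_two; have -> : xr (org 5) (dl z1) = xr (xr (xr (org 5) k1) (dl z1)) k1 by xring.
    exact: lo_xr.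
  have e2 : org 5 = dl z2.
    apply: org_two.
    have -> : xr (org 5) (dl z2) = xr (xr (xr (xr (org 5) k1) (dl z1)) (xr (xr (xr (org 5) k1) (dl z1)) (xr (xr (org 5) k2) (dl z2)))) k2.
      by xring.
    by apply: (lo_xr _ l2); apply: (lo_xr h1); apply: (loW _ h2).
  move: h2 nl; rewrite -e1 -e2.
  have -> : xr (xr (xr (org 5) k1) (org 5)) (xr (xr (org 5) k2) (org 5)) = xr k1 k2 by xring.
  by move=> ->.
rewrite (px_eta x) (px_eta y); move: x.1 x.2 y.1 y.2 => [] u [] v.
- by rewrite dl11 xr_pr xr0 lo_pr => /andP[h _]; apply: (od _ l1 h).
- by rewrite (xrC (dl _)) dl01; exact: ex.
- by rewrite dl01; exact: ex.
rewrite dl00 xr_pr xr0 lo_pr => /andP[h1 h2]; apply: (od _ l2).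
rewrite -(xKr (xr (xr (org 5) k1) (xr (@dl 5 u) (@dl 5 v))) (xr (org 5) k2)) lo_xr //.
exact: (loW _ h2).
Qed.

Lemma pt_ex n (p : pt n -> bool) : (exists y, p y) \/ (forall y, ~~ p y).
Proof.
elim: n p => [|n IH] p.
  by case: (boolP (p tt)) => h; [left; exists tt | right; case].
case: (IH (fun y => p (false, y))) => [[y h]|h0]; first by left; exists (false, y).
case: (IH (fun y => p (true, y))) => [[y h]|h1]; first by left; exists (true, y).
by right=> -[[] y].
Qed.
Lemma wt_sum_le n k (s : seq (BF n)) :
  (forall y, sumn [seq (get f y : nat) | f <- s] <= k) -> sumn [seq wt f | f <- s] <= k * 2 ^ n.
Proof.
elim: n s => [|n IH] s H.
  by have := H tt; rewrite muln1; apply: leq_trans; apply: eq_leq; congr sumn; apply: eq_map; case.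
have h1 : sumn [seq wt f | f <- [seq lh f | f <- s]] <= k * 2 ^ n.
  by apply: IH => y; rewrite -map_comp; have := H (false, y).
have h2 : sumn [seq wt f | f <- [seq rh f | f <- s]] <= k * 2 ^ n.
  by apply: IH => y; rewrite -map_comp; have := H (true, y).
rewrite expnS mulnCA mul2n -addnn; apply: leq_trans (leq_add h1 h2).
by rewrite -!map_comp; elim: s {H h1 h2} => //= f s IHs; rewrite addnACA leq_add2l.
Qed.
Lemma wt_dlE n (f : BF n) x : wt (xr f (dl x)) + (get f x).*2 = (wt f).+1.
Proof.
rewrite wt_xr_dl; case: ifP => gx; last by rewrite /= addn0.
have : 0 < wt f; last by lia.
by case e: (wt f) => //; have := wt0 e => e'; rewrite e' get0 in gx.
Qed.
Lemma get_dl n (x y : pt n) : get (dl x) y = (wt (xr (dl x) (dl y)) == 0).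
Proof. by have := wt_dlE (dl x) y; rewrite wt_dl; case: get => /= h; apply/esym/eqP; lia. Qed.

(** * A cubic plus a plane and a point *)

Definition quad n (f0 f1 f2 f3 : BF n) : BF n.+2 := pr (pr f0 f1) (pr f2 f3).
Lemma wt_quad n (f0 f1 f2 f3 : BF n) : wt (quad f0 f1 f2 f3) = wt f0 + wt f1 + wt f2 + wt f3.
Proof. by rewrite /quad !wt_pr addnA. Qed.
Lemma xr_quad n (f0 f1 f2 f3 g0 g1 g2 g3 : BF n) :
  xr (quad f0 f1 f2 f3) (quad g0 g1 g2 g3) = quad (xr f0 g0) (xr f1 g1) (xr f2 g2) (xr f3 g3).
Proof. by []. Qed.
Lemma quad_eta n (f : BF n.+2) : exists f0 f1 f2 f3, f = quad f0 f1 f2 f3.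
Proof. by exists (lh (lh f)), (rh (lh f)), (lh (rh f)), (rh (rh f)); case: f => [[] ? ? []]. Qed.
Definition px2 n (t s : bool) (y : pt n) : pt n.+2 := px t (px s y).
Lemma trs_quad n (t s : bool) (y : pt n) (f0 f1 f2 f3 : BF n) : trs (px2 t s y) (quad f0 f1 f2 f3) =
  let f i := trs y (nth (zr n) [:: f0; f1; f2; f3] i) in
  match t, s with
  | false, false => quad (f 0) (f 1) (f 2) (f 3)
  | false, true => quad (f 1) (f 0) (f 3) (f 2)
  | true, false => quad (f 2) (f 3) (f 0) (f 1)
  | true, true => quad (f 3) (f 2) (f 1) (f 0)
  end.
Proof. by case: t; case: s. Qed.
(* The plane spanned by the two top coordinates through [z], and the point [p]. *)
Definition plane n (z : pt n) := quad (dl z) (dl z) (dl z) (dl z).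
Lemma wt_plane_point n (z p : pt n) (f0 f1 f2 f3 : BF n) :
  if get (dl z) p then
    wt (xr (quad f0 f1 f2 f3) (xr (plane z) (dl (px2 false false p)))) +
      (get f1 z + get f2 z + get f3 z).*2 = wt (quad f0 f1 f2 f3) + 3
  else
    wt (xr (quad f0 f1 f2 f3) (xr (plane z) (dl (px2 false false p)))) +
      (get f0 z + get f1 z + get f2 z + get f3 z + get f0 p).*2 = wt (quad f0 f1 f2 f3) + 5.
Proof.
set e := quad f0 f1 f2 f3; set w := wt _; have -> : w = wt (quad (xr f0 (xr (dl z) (dl p))) (xr f1 (dl z)) (xr f2 (dl z)) (xr f3 (dl z))).
  congr wt; rewrite -xr_quad; congr xr.
  have -> : dl (px2 false false p) = quad (dl p) (zr n) (zr n) (zr n) by [].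
  by rewrite xr_quad !xr0.
rewrite /e !wt_quad; have := wt_dlE f1 z; have := wt_dlE f2 z; have := wt_dlE f3 z; case: ifP => gp.
  have -> : dl z = dl p by apply/xr_eq0/wt0/eqP; rewrite -get_dl.
  rewrite xrr xr0; lia.
have := wt_dlE f0 z; have := wt_dlE (xr f0 (dl z)) p; rewrite get_xr gp addbF xrA; lia.
Qed.

Lemma L_trs n k (x : pt n) (f : BF n) : L k (trs x f) -> L k f.
Proof. by rewrite trsE => /L_act. Qed.
Lemma padd_px2 n t s t' s' (x y : pt n) : padd (px2 t s x) (px2 t' s' y) = px2 (t (+) t') (s (+) s') (padd x y).
Proof. by []. Qed.
Lemma get_pz n (f : BF n) y : get (trs y f) (pz n) = get f y.
Proof. by rewrite get_trs padd0. Qed.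
(** A leader of weight at most 35 can absorb the five points. A heavier one has a translate
    containing three of the five points, or two of the three that remain when [p] is the base point
    of the plane; then the weight does not exceed 39. *)
Lemma L40_plane_point00 (c : BF 7) (p : pt 5) : lo 4 c -> L 40 (xr c (xr (plane (pz 5)) (dl (px2 false false p)))).
Proof.
move=> lc; have [q lq we] := L40_quartic (loW (isT : 4 <= 5) lc).
move e: (xr c q) we => f we.
have key (z : pt 7) : wt (xr (trs z f) (xr (plane (pz 5)) (dl (px2 false false p)))) <= 40 ->
    L 40 (xr c (xr (plane (pz 5)) (dl (px2 false false p)))).
  have [q' lq' eq'] := trs_coset z lc lq; rewrite e in eq'; rewrite -eq' => h; exists q' => //.
  by rewrite xrAC.
have [f0 [f1 [f2 [f3 ef]]]] := quad_eta f; rewrite ef in key we *.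
case: (leqP (wt (quad f0 f1 f2 f3)) 35) => we35.
  apply: (key (pz 7)); rewrite trs_pz; have := wt_plane_point (pz 5) p f0 f1 f2 f3.
  by case: ifP => _; lia.
rewrite wt_quad in we we35.
have K t s y h0 h1 h2 h3 :
    trs (px2 t s y) (quad f0 f1 f2 f3) = quad (trs y h0) (trs y h1) (trs y h2) (trs y h3) ->
    (if get (dl (pz 5)) p then 2 <= get h1 y + get h2 y + get h3 y
     else 3 <= get h0 y + get h1 y + get h2 y + get h3 y + get h0 (padd y p)) ->
    L 40 (xr c (xr (plane (pz 5)) (dl (px2 false false p)))).
  move=> eh; have sw : wt (quad (trs y h0) (trs y h1) (trs y h2) (trs y h3)) <= 40.
    by rewrite -eh wt_trs wt_quad.
  move=> h; apply: (key (px2 t s y)); rewrite eh; move: h.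
  have := wt_plane_point (pz 5) p (trs y h0) (trs y h1) (trs y h2) (trs y h3).
  rewrite !get_pz get_trs; case: ifP => _; lia.
have K' y : ((if get (dl (pz 5)) p then
    [|| 2 <= get f1 y + get f2 y + get f3 y, 2 <= get f0 y + get f3 y + get f2 y,
        2 <= get f3 y + get f0 y + get f1 y | 2 <= get f2 y + get f1 y + get f0 y]
  else let S := get f0 y + get f1 y + get f2 y + get f3 y in
    [|| 3 <= S + get f0 (padd y p), 3 <= S + get f1 (padd y p),
        3 <= S + get f2 (padd y p) | 3 <= S + get f3 (padd y p)])%N : bool) ->
    L 40 (xr c (xr (plane (pz 5)) (dl (px2 false false p)))).
  move=> h; have E0 := K false false y f0 f1 f2 f3 (trs_quad _ _ _ _ _ _ _).
  have E1 := K false true y f1 f0 f3 f2 (trs_quad _ _ _ _ _ _ _).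
  have E2 := K true false y f2 f3 f0 f1 (trs_quad _ _ _ _ _ _ _).
  have E3 := K true true y f3 f2 f1 f0 (trs_quad _ _ _ _ _ _ _).
  move: h E0 E1 E2 E3; case: ifP => _ /or4P[] h.
  - by move=> /(_ h).
  - by move=> _ /(_ h).
  - by move=> _ _ /(_ h).
  - by move=> _ _ _ /(_ h).
  - by move=> E _ _ _; apply: E; lia.
  - by move=> _ E _ _; apply: E; lia.
  - by move=> _ _ E _; apply: E; lia.
  - by move=> _ _ _ E; apply: E; lia.
have s8 a b c' d a' b' c'' d' : sumn [:: a; b; c'; d; a'; b'; c''; d'] = a + b + c' + d + (a' + b' + c'' + d').
  by rewrite /= addn0 !addnA.
(* The eight functions have total weight at least 72, more than twice the 32 points, so at some
   point at least three of them take the value 1. *)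
have [[y hy]|na] := pt_ex (fun y : pt 5 => 2 < sumn [seq (get g y : nat) | g <- [:: f0; f1; f2; f3; trs p f0; trs p f1; trs p f2; trs p f3]]); last first.
  have := @wt_sum_le 5 2 [:: f0; f1; f2; f3; trs p f0; trs p f1; trs p f2; trs p f3].
  rewrite (_ : 2 * 2 ^ 5 = 64) // /map s8 !wt_trs => H.
  have /H : forall y, sumn [seq (get g y : nat) | g <- [:: f0; f1; f2; f3; trs p f0; trs p f1; trs p f2; trs p f3]] <= 2.
    by move=> y; have := na y; rewrite -leqNgt.
  by lia.
move: hy; rewrite /map s8 !get_trs (paddC p) => hy.
case gp : (get (dl (pz 5)) p).
  have ep : p = pz 5 by apply/esym/dl_inj/xr_eq0/wt0/eqP; rewrite -get_dl.
  apply: (K' y); rewrite gp; move: hy; rewrite ep padd0.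
  by case: (get f0 y); case: (get f1 y); case: (get f2 y); case: (get f3 y).
have := K' (padd y p); have := K' y; rewrite gp paddK; move: hy.
case: (get f0 y); case: (get f1 y); case: (get f2 y); case: (get f3 y);
case: (get f0 (padd y p)); case: (get f1 (padd y p)); case: (get f2 (padd y p)); case: (get f3 (padd y p));
by move=> // _ H1 H2; first [exact: H1 | exact: H2].
Qed.
Lemma trs_plane n t s : trs (px2 t s (pz n)) (plane (pz n)) = plane (pz n).
Proof. by rewrite /plane trs_quad; case: t; case: s; rewrite /= trs_pz. Qed.
Lemma L40_plane_point (c : BF 7) P : lo 4 c -> L 40 (xr c (xr (plane (pz 5)) (dl P))).
Proof.
move=> lc; have [t [s [p ->]]] : exists t s (p : pt 5), P = px2 t s p by case: P => t [s p]; exists t, s, p.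
 apply: (@L_trs _ _ (px2 t s (pz 5))).
rewrite !trs_xr trs_dl padd_px2 !addbb (paddC _ p) padd0.
rewrite trs_plane; by apply: L40_plane_point00; rewrite lo_trs.
Qed.

(** The case left over by the other gluings: the second half is a cubic plus two points, moved to
    the line [ln6], and [g] is the difference of the halves. *)
Definition line_fun (c g : BF 6) := pr (xr ln6 (xr c g)) (xr ln6 c).
Lemma line_plane c g P : lo 4 c -> lo 3 g -> L 40 (xr (line_fun c g) (dl P)).
Proof.
move=> lc lg; have lC : lo 4 (pr (xr c g) c).
  by rewrite lo_pr lo_xr ?(loW _ lg) // xrAC xrr x0r.
have := L40_plane_point P lC; rewrite xrA.
have -> : plane (pz 5) = pr ln6 ln6 by rewrite /plane /quad -org_dl.
by rewrite xr_pr (xrC (xr c g)) (xrC c ln6).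
Qed.

(** A nonzero quadratic form in five variables keeps a nonzero cubic part after multiplication by a
    suitable coordinate. *)
Lemma mul_quadric (h : BF 5) : lo 3 h -> (forall i, i < 5 -> lo 3 (mix i (zr 5) h)) -> lo 2 h.
Proof.
move=> lh H; have := lo_cf lh; set v := cf 2 h => l.
have ok : allb 10 (fun v => let k := comb v (mons 5 2) in
    lo 2 k || has (fun i => ~~ lo 3 (mix i (zr 5) k)) (iota 0 5)) by vm_compute.
have := allbP ok (v := v) (size_cf 2 h) => /orP[k2|/hasP[i]].
  by rewrite -(xrK h (comb v (mons 5 2))) lo_xr.
rewrite mem_iota => /andP[_ i5] /negP[].
have -> : mix i (zr 5) (comb v (mons 5 2)) = xr (mix i (zr 5) h) (mix i (zr 5) (xr h (comb v (mons 5 2)))).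
  by rewrite -mix_xr xrr xKr.
by apply: lo_xr; [exact: H | exact: lo_mix0].
Qed.

Section Step.
Variables (c g : BF 6) (P : pt 7).
Hypotheses (lc : lo 4 c) (lg : lo 4 g).
Lemma org_odd (k : BF 5) : lo 4 k -> odd (wt (xr (org 5) k)).
Proof. by move=> lk; rewrite odd_wt_xr org_dl wt_dl (negbTE (lo_odd _ lk)). Qed.
Lemma odd_pair (k1 k2 : BF 5) : lo 4 k1 -> lo 4 k2 -> ~~ lo 5 (pr (xr (org 5) k1) (xr (org 5) k2)).
Proof. by move=> /org_odd o1 _; rewrite lo_pr lo_even o1. Qed.
Lemma odd_pair6 (k1 k2 : BF 5) : lo 4 k1 -> lo 4 k2 -> lo 6 (pr (xr (org 5) k1) (xr (org 5) k2)).
Proof.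
move=> l1 l2; rewrite lo_pr lo_full andTb.
have -> : xr (xr (org 5) k1) (xr (org 5) k2) = xr k1 k2 by xring.
by apply: (@loW _ 4) (lo_xr l1 l2).
Qed.
Lemma L40_odd_pairs (k1 k2 k3 k4 : BF 5) : lo 4 k1 -> lo 4 k2 -> lo 4 k3 -> lo 4 k4 ->
  ~~ lo 3 (xr k1 k2) -> ~~ lo 3 (xr k3 k4) -> forall Q,
  L 40 (xr (pr (pr (xr (org 5) k1) (xr (org 5) k2)) (pr (xr (org 5) k3) (xr (org 5) k4))) (dl Q)).
Proof.
move=> l1 l2 l3 l4 n1 n2 Q; apply: glue_ntp2; by [exact: odd_pair6|exact: odd_pair|exact: ntp_odd].
Qed.
Let c0 := lh c. Let c1 := rh c. Let g0 := lh g. Let g1 := rh g.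
Let lcs : [/\ lo 4 c0, lo 4 c1 & lo 3 (xr c0 c1)].
Proof. by have [? ?] := lo_lr lc; split=> //; move: lc; rewrite {1}(pr_eta c) lo_pr => /andP[]. Qed.
Let lgs : [/\ lo 4 g0, lo 4 g1 & lo 3 (xr g0 g1)].
Proof. by have [? ?] := lo_lr lg; split=> //; move: lg; rewrite {1}(pr_eta g) lo_pr => /andP[]. Qed.
Let eF : line_fun c g = pr (pr (xr (org 5) (xr c0 g0)) (xr (org 5) (xr c1 g1))) (pr (xr (org 5) c0) (xr (org 5) c1)).
Proof. by rewrite /line_fun /ln6 (pr_eta c) (pr_eta g). Qed.
(** Splitting along the second coordinate separates the two points of each line. The four quarters
    are then cubics plus the origin, and by [ntp_odd] neither half is a cubic plus two points. *)
Lemma line_fun_split : ~~ lo 3 g0 -> L 40 (xr (line_fun c g) (dl P)).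
Proof.
have [l1 l2 l3] := lcs; have [l4 l5 l6] := lgs => n0; apply: (@L_act _ [:: Sw]); rewrite act_xr.
have [Q ->] := dl_act [:: Sw] P; rewrite eF.
have -> : act [:: Sw] (pr (pr (xr (org 5) (xr c0 g0)) (xr (org 5) (xr c1 g1))) (pr (xr (org 5) c0) (xr (org 5) c1))) =
  pr (pr (xr (org 5) (xr c0 g0)) (xr (org 5) c0)) (pr (xr (org 5) (xr c1 g1)) (xr (org 5) c1)) by [].
apply: (L40_odd_pairs (lo_xr l1 l4) l1 (lo_xr l2 l5) l2); first by rewrite xrAC xrr x0r.
by rewrite xrAC xrr x0r; apply: contra n0 => n1; rewrite -(xrK g0 g1) lo_xr.
Qed.
(** With the [i]-th remaining coordinate added to the top one, the quarters of each new half differ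
    by its product with [g0 + g1], up to quadratics, so [ntp_odd] applies again. *)
Lemma line_fun_mix i : lo 3 g0 -> i < 5 -> ~~ lo 3 (mix i (zr 5) (xr g0 g1)) -> L 40 (xr (line_fun c g) (dl P)).
Proof.
have [l1 l2 l3] := lcs; have [l4 l5 l6] := lgs => n0 i5 nh.
have n1 : lo 3 g1 by rewrite -(xKr g0 g1) lo_xr.
apply: (@L_act _ [:: Mx i.+1]); rewrite act_xr.
have [Q ->] := dl_act [:: Mx i.+1] P; rewrite eF.
set a := xr (org 5) c0; set b := xr (org 5) c1.
have m1 (k d : BF 5) : mix i (xr (org 5) (xr k d)) (xr (org 5) k) = xr (org 5) (xr k (xr d (mix i (zr 5) d))).
  rewrite mixE; have -> : xr (xr (org 5) (xr k d)) (xr (org 5) k) = d by xring.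
  by xring.
have m2 (k d : BF 5) : mix i (xr (org 5) k) (xr (org 5) (xr k d)) = xr (org 5) (xr k (mix i (zr 5) d)).
  rewrite mixE; have -> : xr (xr (org 5) k) (xr (org 5) (xr k d)) = d by xring.
  by xring.
have -> : act [:: Mx i.+1] (pr (pr (xr (org 5) (xr c0 g0)) (xr (org 5) (xr c1 g1))) (pr a b)) =
  pr (pr (mix i (xr (org 5) (xr c0 g0)) a) (mix i (xr (org 5) (xr c1 g1)) b))
     (pr (mix i a (xr (org 5) (xr c0 g0))) (mix i b (xr (org 5) (xr c1 g1)))) by [].
rewrite !m1 !m2.
have lm (k : BF 5) : lo 3 k -> lo 4 (mix i (zr 5) k) by move=> lk; apply: lo_mix0.
have e : mix i (zr 5) (xr g0 g1) = xr (mix i (zr 5) g0) (mix i (zr 5) g1) by rewrite -mix_xr xrr.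
apply: (L40_odd_pairs (lo_xr l1 (lo_xr l4 (lm _ n0))) (lo_xr l2 (lo_xr l5 (lm _ n1)))
  (lo_xr l1 (lm _ n0)) (lo_xr l2 (lm _ n1))); apply: contra nh; rewrite e => h.
  have -> : xr (mix i (zr 5) g0) (mix i (zr 5) g1) =
    xr (xr (xr c0 (xr g0 (mix i (zr 5) g0))) (xr c1 (xr g1 (mix i (zr 5) g1)))) (xr (xr c0 c1) (xr g0 g1)) by xring.
  by apply: lo_xr h _; apply: lo_xr l3 l6.
have -> : xr (mix i (zr 5) g0) (mix i (zr 5) g1) =
  xr (xr (xr c0 (mix i (zr 5) g0)) (xr c1 (mix i (zr 5) g1))) (xr c0 c1) by xring.
exact: lo_xr h l3.
Qed.
(** If none of these hyperplanes serves, [g] is quadratic, and the function is a cubic plus a plane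
    and a point. *)
Lemma line_fun_cubic : L 40 (xr (line_fun c g) (dl P)).
Proof.
have [l4 l5 l6] := lgs; case: (boolP (lo 3 g0)) => n0; last exact: line_fun_split.
have [/allP al|/allPn[i]] := boolP (all (fun i => lo 3 (mix i (zr 5) (xr g0 g1))) (iota 0 5)).
  apply: line_plane => //; rewrite (pr_eta g) lo_pr n0.
  by apply: mul_quadric => // i i5; apply: al; rewrite mem_iota.
by rewrite mem_iota => /andP[_ i5] ni; apply: line_fun_mix n0 i5 ni.
Qed.
End Step.

Definition ln5 : BF 5 := pr (org 4) (org 4).
Lemma ln5_lo : lo 5 ln5 && ~~ lo 4 ln5. Proof. by vm_compute. Qed.
Lemma ln6_lo : lo 6 ln6. Proof. by vm_compute. Qed.
Lemma res_ln6 i : i < 5 -> res i.+1 ln6 = ln5 /\ res1 i.+1 ln6 = zr 5.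
Proof.
move=> i5; have [e1 e2] := @res_org 4 i i5; rewrite /ln6 /ln5 resS res1S e1 e2.
by split.
Qed.
(** The second half has even weight, so it would contain both points or none; accordingly [g + ln5]
    or [ln5] would be a cubic. *)
Lemma ntp_line (k g : BF 5) : lo 4 k -> ~~ lo 4 g -> ~~ lo 4 (xr g ln5) ->
  ~ tp (pr (xr ln5 (xr k g)) (xr ln5 k)).
Proof.
move=> lk ng ngl [x [y]]; have /andP[_ nl] := ln5_lo.
have ev u : lo 4 (xr (xr ln5 k) (dl u)) -> False.
  by move=> /(lo_odd (isT : 4 <= 5)); rewrite !odd_wt_xr wt_dl (negbTE (lo_odd _ lk)) //.
have ex z1 z2 : lo 4 (xr (pr (xr ln5 (xr k g)) (xr ln5 k)) (pr (dl z1) (dl z2))) -> False.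
  rewrite xr_pr lo_pr => /andP[h1 h2]; apply: (ev z2).
  rewrite -(xKr (xr (xr ln5 (xr k g)) (dl z1)) (xr (xr ln5 k) (dl z2))).
  exact: lo_xr h1 (loW (isT : 3 <= 4) h2).
rewrite (px_eta x) (px_eta y); move: x.1 x.2 y.1 y.2 => [] u [] v.
- rewrite dl11 xr_pr xr0 lo_pr => /andP[h _]; case/negP: ngl.
  have -> : xr g ln5 = xr (xr ln5 (xr k g)) k by xring.
  exact: lo_xr.
- by rewrite (xrC (dl _)) dl01; exact: ex.
- by rewrite dl01; exact: ex.
rewrite dl00 xr_pr xr0 lo_pr => /andP[h1 h2]; case/negP: nl.
set A := xr _ _ in h1 h2.
have -> : ln5 = xr (xr A (xr A (xr ln5 k))) k by xring.
by apply: (lo_xr _ lk); apply: lo_xr h1 (loW (isT : 3 <= 4) h2).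
Qed.

Section LinePoint.
Variables (c g : BF 6).
Hypotheses (lc : lo 4 c) (lg : lo 5 g).
Lemma line_fun_lo : lo 6 (line_fun c g).
Proof.
rewrite /line_fun lo_pr; apply/andP; split.
  by apply: (lo_xr ln6_lo); apply: lo_xr (loW _ lc) (loW _ lg).
by have -> : xr (xr ln6 (xr c g)) (xr ln6 c) = g by xring.
Qed.
(** Both copies of the line lie where the chosen coordinate is 0, and [ntp_line] applies to that
    half. If [x] is on the other side, parity shows that the half there does not become a cubic by
    adding [x] and one more point. *)
Lemma line_point_res x i : i < 5 -> ~~ lo 4 (res i.+1 g) -> ~~ lo 4 (xr (res i.+1 g) ln5) ->
  L 40 (xr (line_fun c g) (dl (px true x))).
Proof.
move=> i5 ng ngl; have [e0 e1] := res_ln6 i5.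
have i6 : i.+1 <= 5 by []. 
have [lc0 lc1 _] := lo_res01 i6 lc.
have [l60 l61 l5] := @lo_res01 6 6 i.+2 _ i6 line_fun_lo.
have E0 : res i.+2 (line_fun c g) = pr (xr ln5 (xr (res i.+1 c) (res i.+1 g))) (xr ln5 (res i.+1 c)).
  by rewrite /line_fun resS -!res_xr e0.
have E1 : res1 i.+2 (line_fun c g) = pr (xr (res1 i.+1 c) (res1 i.+1 g)) (res1 i.+1 c).
  by rewrite /line_fun res1S -!res1_xr e1 !x0r.
have nt : ~ tp (res i.+2 (line_fun c g)) by rewrite E0; apply: ntp_line.
have n0 : ~~ lo 5 (res i.+2 (line_fun c g)).
  rewrite E0 lo_pr negb_and; apply/orP; right.
  by have -> : xr (xr ln5 (xr (res i.+1 c) (res i.+1 g))) (xr ln5 (res i.+1 c)) = res i.+1 g by xring.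
have n1 : ~~ lo 5 (res1 i.+2 (line_fun c g)).
  by apply: contra n0 => l; rewrite -(xrK (res _ _) (res1 i.+2 (line_fun c g))) lo_xr.
apply: (@L_act _ (up i.+2)); rewrite act_xr up_res01 // up_res01 // dl1 resS res1S.
have [z0 z1] := @res_zr 5 i.+1 i6; rewrite z0 z1.
have [y [[-> ->]|[-> ->]]] := res_dl x i6.
  rewrite -dl1 xr_pr; have -> : pr (zr 5) (zr 5) = zr 6 by [].
  by rewrite xr0; apply: L_swap_pr; apply: glue_ntp_in.
rewrite -dl1 xr_pr; have -> : pr (zr 5) (zr 5) = zr 6 by [].
rewrite xr0; apply: glue_ntp_out => // s; apply/negP.
have od : lo 4 (xr (res1 i.+1 c) (dl y)) -> False.
  by move=> /(lo_odd (isT : 4 <= 5)); rewrite odd_wt_xr wt_dl (negbTE (lo_odd _ lc1)).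
rewrite -xrA E1 (px_eta s); case: s.1.
  rewrite dl11 xr_pr xr0 lo_pr => /andP[h _]; case/negP: n1; rewrite E1 lo_pr; apply/andP; split.
    exact: loW h.
  exact: lo_xr h lc1.
rewrite (xrC (dl _)) dl01 xr_pr lo_pr => /andP[h1 h2]; apply: od.
set A := xr _ _ in h1 h2; rewrite -(xKr A (xr (res1 i.+1 c) (dl y))).
exact: lo_xr h1 (loW (isT : 3 <= 4) h2).
Qed.
End LinePoint.

Lemma shear0 n (z : pt n) : exists w, forall a b : BF n, act w (pr a b) = pr (trs z a) b.
Proof.
have [w [_ ew]] := lin_shear z; exists ([:: Tr] ++ w ++ [:: Tr]) => a b.
by rewrite !act_cat act_tr ew act_tr.
Qed.
Lemma ones_lo : allb 2 (fun v => let b i := nth false v i in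
  ~~ lo 5 (pr (dlb (b 0) (ones 5)) (dlb (b 1) (ones 5))) || ~~ b 0 && ~~ b 1).
Proof. by vm_compute. Qed.
Lemma flat_quartic (g : BF 6) : lo 5 g -> (forall i, i < 5 -> lo 4 (res i.+1 g)) -> lo 4 g.
Proof.
move=> lg H; have [b1 [b2 l]] := @flat_res 4 4 g H.
have lp : lo 5 (pr (dlb b1 (ones 5)) (dlb b2 (ones 5))).
  by rewrite -(xKr g (pr _ _)); apply: lo_xr lg (loW _ l).
have := allbP ones_lo (v := [:: b1; b2]) erefl => /orP[/negP[]//|/andP[/negPf e1 /negPf e2]].
by move: l; rewrite /= in e1 e2; rewrite e1 e2 [dlb _ _]/(zr 5) [pr _ _]/(zr 6) xr0.
Qed.
Lemma line_point c g x : lo 4 c -> lo 5 g -> L 40 (xr (line_fun c g) (dl (px true x))).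
Proof.
move=> lc lg; have [/allP al|/allPn[i]] := boolP
    (all (fun i => lo 4 (res i.+1 g) || lo 4 (xr (res i.+1 g) ln5)) (iota 0 5)); last first.
  by rewrite mem_iota negb_or => /andP[_ i5] /andP[ng ngl]; apply: line_point_res i5 ng ngl.
(* Shearing by [z] moves the line off the restriction in the selected directions, which adds [ln5]
   to the difference exactly where it is missing. So all restrictions of the new difference [g'] are
   cubics, and hence [g'] is one. *)
pose z := mkpt 6 (fun j => if j is i.+1 then ~~ lo 4 (res i.+1 g) else false).
have [w ew] := shear0 z; apply: (@L_act _ w).
pose g' := xr (xr ln6 (trs z ln6)) (xr (xr c (trs z c)) (trs z g)).
have -> : act w (xr (line_fun c g) (dl (px true x))) = xr (line_fun c g') (dl (px true x)).
  rewrite dl1 /line_fun xr_pr xr0 ew xr_pr xr0; congr pr.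
  by rewrite /g' !trs_xr; xring.
have lg' : lo 5 g'.
  apply: lo_xr; first exact: (lo_dtrs z ln6_lo).
  by apply: lo_xr; [apply: loW (lo_dtrs z lc) | rewrite lo_trs].
apply: line_fun_cubic => //; apply: flat_quartic => // i i5.
have i6 : i.+1 <= 5 by [].
have [e0 e1] := res_ln6 i5; have [z' ez] := @res_trs 5 i.+1 z i6.
have /andP[l5 _] := ln5_lo.
have -> : res i.+1 g' = xr (xr ln5 (res i.+1 (trs z (xr ln6 g)))) (res i.+1 (xr c (trs z c))).
  by rewrite /g' trs_xr -!res_xr e0; xring.
have lcc : lo 4 (res i.+1 (xr c (trs z c))).
  have lz : lo 4 (trs z c) by rewrite lo_trs.
  by have [] := lo_res01 i6 (lo_xr lc lz).
have ezi : zi i.+1 z = ~~ lo 4 (res i.+1 g) by exact: zi_mkpt.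
apply: (lo_xr _ lcc); rewrite ez ezi.
have := al i; rewrite mem_iota i5 => /(_ isT).
have [lr0 lr1 lr] := lo_res01 i6 lg.
case: ifP => [/negPf n|/negbFE h _].
  rewrite n => h; rewrite -res1_xr e1 x0r.
  have -> : xr ln5 (trs z' (res1 i.+1 g)) = xr (xr ln5 (trs z' ln5)) (trs z' (xr (res1 i.+1 g) ln5)).
    by rewrite trs_xr; xring.
  apply: lo_xr; first exact: (lo_dtrs z' l5).
  rewrite lo_trs; have -> : xr (res1 i.+1 g) ln5 = xr (xr (res i.+1 g) (res1 i.+1 g)) (xr (res i.+1 g) ln5) by xring.
  exact: lo_xr lr h.
rewrite -res_xr e0 trs_xr xrA; apply: lo_xr; first exact: (lo_dtrs z' l5).
by rewrite lo_trs.
Qed.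

Lemma L40_septic (f : BF 7) : odd (wt f) -> L 40 f.
Proof.
move=> od; have [P l6] := odd_split od; rewrite -(xrK f (dl P)).
move: (xr f (dl P)) l6 => {od}f l6.
case: (boolP (lo 5 f)) => l5; first exact: L40_quartic_dl.
have [|i le nl] := @res_lo 6 5 f _ l6 l5; first by [].
apply: (@L_act _ (up i)); rewrite act_xr; have [Q ->] := dl_act (up i) P.
have := l6; rewrite -(lo_actE (up i)) (up_pr f le).
move: (res i f) (rh _) nl => {l6 l5 le}a b na; rewrite lo_pr => /andP[la lab].
have lb : lo 6 b by rewrite -(xKr a b) lo_xr // (loW _ lab).
have nb : ~~ lo 5 b by apply: contra na => lb5; rewrite -(xrK a b) lo_xr.
have [t [x ->]] : exists t (x : pt 6), Q = px t x by case: Q => t x; exists t, x.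
wlog : a b t la lb na nb lab / t.
  move=> H; case: t; first exact: H.
  apply: (@L_act _ [:: Tr]); rewrite act_xr act_tr.
  have -> : act [:: Tr] (dl (px false x)) = dl (px true x) by rewrite dl0 act_tr dl1.
  by apply: H; rewrite // xrC.
case: t => // _; rewrite dl1 xr_pr xr0.
have tpb : tp b -> L 40 (pr a (xr b (dl x))).
  move=> /(@tpE 5 b isT)/(_ nb)[c [u [v [lc nuv eb]]]].
  have [w ew] := two_points nuv; apply: (@L_act _ [seq Dn m | m <- w]).
  have -> : pr a (xr b (dl x)) = xr (pr a b) (dl (px true x)) by rewrite dl1 xr_pr xr0.
  rewrite act_xr; have -> : act [seq Dn m | m <- w] (dl (px true x)) = pr (zr 6) (act w (dl x)).
    by rewrite dl1 act_pr (wt0 (f := act w (zr 6))) // wt_act wt_zr.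
  have [y ->] := dl_act w x; rewrite -dl1 act_pr eb act_xr ew (xrC _ ln6).
  have -> : act w a = xr ln6 (xr (act w c) (act w (xr a b))).
    by rewrite act_xr eb !act_xr -act_xr ew; xring.
  by apply: line_point; rewrite lo_actE.
case: (quintic6 lb nb) => [Lb|[t _ _]]; last exact: tpb.
case: (odd_quintic x lb) => [Ub|[s ls]]; first exact: glue_point.
by apply: tpb; exists x, s; rewrite xrA.
Qed.
Theorem L40 (f : BF 7) : L 40 f.
Proof.
case: (boolP (lo 7 f)) => l7; last by apply: L40_septic; rewrite lo_even negbK in l7.
case: (boolP (lo 6 f)) => l6; last exact: L40_sextic.
case: (boolP (lo 5 f)) => l5; last exact: L40_quintic.
exact: L40_quartic.
Qed.

(** * A cubic at distance 40 *)

Definition sg n (f : BF n) : Z := (zn (2 ^ n) - 2 * zn (wt f))%Z.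
Lemma sg_pr n (f g : BF n) : sg (pr f g) = (sg f + sg g)%Z.
Proof. by rewrite /sg wt_pr /zn expnS; lia. Qed.
Fixpoint psum n : (pt n -> Z) -> Z :=
  if n is m.+1 then fun F => (psum (fun x => F (px false x)) + psum (fun x => F (px true x)))%Z
  else fun F => F tt.
Lemma psum_le n (F G : pt n -> Z) : (forall x, (F x <= G x)%Z) -> (psum F <= psum G)%Z.
Proof. by elim: n F G => [|n IH] F G H /=; [exact: H | apply: Z.add_le_mono; apply: IH => x]. Qed.
Lemma psum_eq n (F G : pt n -> Z) : (forall x, F x = G x) -> psum F = psum G.
Proof. by elim: n F G => [|n IH] F G H //=; congr Z.add; apply: IH. Qed.
Lemma psum_add n (F G : pt n -> Z) : psum (fun x => F x + G x)%Z = (psum F + psum G)%Z.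
Proof. by elim: n F G => [|n IH] F G //=; rewrite !IH; lia. Qed.
Lemma psum_sg n (f g : BF n) : psum (fun x => sg (xr f (trs x g))) = (sg f * sg g)%Z.
Proof.
elim: n f g => [|n IH] f g; first by case: f g => [] [].
rewrite (pr_eta f) (pr_eta g); move: (lh f) (rh f) (lh g) (rh g) => a b c d.
have e0 (x : pt n) : sg (xr (pr a b) (trs (px false x) (pr c d))) = (sg (xr a (trs x c)) + sg (xr b (trs x d)))%Z.
  exact: (sg_pr (xr a (trs x c)) (xr b (trs x d))).
have e1 (x : pt n) : sg (xr (pr a b) (trs (px true x) (pr c d))) = (sg (xr a (trs x d)) + sg (xr b (trs x c)))%Z.
  exact: (sg_pr (xr a (trs x d)) (xr b (trs x c))).
transitivity (psum (fun x : pt n => sg (xr (pr a b) (trs (px false x) (pr c d)))) +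
  psum (fun x : pt n => sg (xr (pr a b) (trs (px true x) (pr c d)))))%Z; first by [].
rewrite (psum_eq e0) (psum_eq e1) (psum_add (fun x => sg (xr a (trs x c))) (fun x => sg (xr b (trs x d)))).
rewrite (psum_add (fun x => sg (xr a (trs x d))) (fun x => sg (xr b (trs x c)))) !IH !sg_pr; lia.
Qed.
Lemma sg_sqr n (f : BF n) : (sg f * sg f)%Z = psum (fun x => sg (dt x f)).
Proof. by rewrite -psum_sg. Qed.
Lemma sg_le n (f : BF n) : (sg f <= zn (2 ^ n))%Z.
Proof. by rewrite /sg /zn; lia. Qed.
Lemma lo1 n (f : BF n) : lo 1 f -> f = zr n \/ f = one n.
Proof.
elim: n f => [|n IH] f; first by case: f; [right | left].
rewrite (pr_eta f) lo_pr => /andP[/IH h /lo0/xr_eq0 <-]; case: h => ->; by [left | right].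
Qed.
Lemma sg_affine n (f : BF n) : lo 2 f -> ~~ lo 1 f -> sg f = 0%Z.
Proof.
elim: n f => [|n IH] f; first by case: f.
rewrite (pr_eta f) !lo_pr sg_pr => /andP[l0 /lo1[/xr_eq0 e|e]].
  by rewrite -e xrr lo_zr andbT => /(IH _ l0) ->.
have -> : rh f = xr (lh f) (one n) by rewrite -e xKr.
by rewrite /sg wt_one; lia.
Qed.

Fixpoint pcnt n : (pt n -> bool) -> nat :=
  if n is m.+1 then fun p => pcnt (fun x => p (px false x)) + pcnt (fun x => p (px true x))
  else fun p => p tt.
Lemma psum_cnt n (p : pt n -> bool) k : psum (fun x => if p x then k else 0)%Z = (k * zn (pcnt p))%Z.
Proof.
elim: n p => [|n IH] p; first by rewrite /=; case: (p tt) => /=; rewrite /zn; lia.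
by rewrite /= !IH /zn; lia.
Qed.
(** Written with [if] so that evaluation stops at the first mismatch. *)
Fixpoint eqt n (v : bool) : pt n -> BF n -> BF n -> bool :=
  if n is m.+1 then fun (x : bool * pt m) (f g : BF m * BF m) =>
    if eqt v x.2 f.1 (if x.1 then g.2 else g.1) then eqt v x.2 f.2 (if x.1 then g.1 else g.2) else false
  else fun _ a b => a (+) b == v.
Lemma eqtP n v (x : pt n) (f g : BF n) : xr f (trs x g) = (if v then one n else zr n) -> eqt v x f g.
Proof.
elim: n x f g => [|n IH] x f g; first by case: v => /= ->.
case: x f g => [s x] [f1 f2] [g1 g2]; have -> : (if v then one n.+1 else zr n.+1) =
  pr (if v then one n else zr n) (if v then one n else zr n) by case: v {IH}.
by case: s => /= -[/IH-> /IH->].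
Qed.
Definition dtc n (h : BF n) (b : pt n) : bool := if eqt false b h h then true else eqt true b h h.
Lemma dtcP n (h : BF n) b : lo 1 (dt b h) -> dtc h b.
Proof.
rewrite /dtc => /lo1[e|e]; first by rewrite (@eqtP n false b h h e).
by rewrite (@eqtP n true b h h e); case: ifP.
Qed.
Definition radn n (f : BF n) (a : pt n) := pcnt (dtc (dt a f)).
(** The integer square root loses nothing, since the sum of signs that it bounds is an integer. *)
Definition sgb n (f : BF n) : Z := psum (fun a => Z.sqrt (zn (2 ^ n) * zn (radn f a))).
Lemma dt_xr n (x : pt n) f g : dt x (xr f g) = xr (dt x f) (dt x g).
Proof. by rewrite /dt trs_xr xrACA. Qed.
(** A derivative of [f + q] is quadratic, and its own derivatives are affine, so their signs sum to
    zero unless they are constant. Adding [q] changes second derivatives by constants only. *)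
Lemma sg_bound n (f q : BF n) : lo 4 f -> lo 3 q -> (sg (xr f q) * sg (xr f q) <= sgb f)%Z.
Proof.
move=> lf lq; rewrite sg_sqr; apply: psum_le => a; set h := dt a (xr f q).
have lh : lo 3 h by apply: lo_dt; rewrite lo_xr // (loW _ lq).
have : (sg h * sg h <= zn (2 ^ n) * zn (radn f a))%Z.
  rewrite sg_sqr -psum_cnt; apply: psum_le => b.
  have e : lo 1 (dt b h) = lo 1 (dt b (dt a f)).
    rewrite /h (dt_xr a) (dt_xr b (dt a f)); apply: lo_xrl.
    exact: (lo_dt b (lo_dt a lq)).
  case: (boolP (lo 1 (dt b h))) => l; first by rewrite dtcP -?e //; apply: sg_le.
  by rewrite (sg_affine (lo_dt b lh) l); case: (dtc _ _); rewrite /zn; lia.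
move=> /Z.sqrt_le_mono; rewrite -Z.abs_square Z.sqrt_square; lia.
Qed.

(** The product of two cubics has degree at most 6, hence even weight in seven variables, so
    divisibility by 4 passes to sums. *)
Lemma wt4_xr (f g : BF 7) : lo 4 f -> lo 4 g -> 4 %| wt f -> 4 %| wt g -> 4 %| wt (xr f g).
Proof.
move=> lf lg df dg; have := wt_an f g; have /(lo_odd (leqnn _)) := lo_an lf lg => ev e.
have d4 : 4 %| (wt (an f g)).*2.
  by rewrite -(odd_double_half (wt (an f g))) (negbTE ev) add0n; apply/dvdnP; exists (wt (an f g))./2; lia.
by rewrite -(dvdn_addl _ d4) e dvdn_add.
Qed.
Lemma wt4_comb v (ms : seq (BF 7)) : all (fun m => lo 4 m && (4 %| wt m)) ms -> 4 %| wt (comb v ms).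
Proof.
move=> al; suff /andP[] : lo 4 (comb v ms) && (4 %| wt (comb v ms)) by [].
elim: ms v al => [|m ms IH] v; first by move=> _; rewrite [comb _ _]/(zr 7) lo_zr wt_zr.
case/andP=> /andP[lm dm] /IH {}IH; case: v => [|[] v]; last exact: IH.
  by rewrite comb_nil lo_zr wt_zr.
have /andP[l d] := IH v; rewrite [comb _ _]/(xr m (comb v ms)).
by apply/andP; split; [exact: lo_xr | exact: wt4_xr].
Qed.
Lemma mons_wt4 : all (fun d => all (fun m : BF 7 => lo 4 m && (4 %| wt m)) (mons 7 d)) (iota 0 4).
Proof. by vm_compute. Qed.
Lemma wt4_cubic (f : BF 7) : lo 4 f -> 4 %| wt f.
Proof.
have key d : d <= 4 -> forall g : BF 7, lo d g -> 4 %| wt g.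
  elim: d => [|d IH] d4 g; first by move=> /lo0->; rewrite wt_zr.
  move=> lg; have l := lo_cf lg; have := allP mons_wt4 d; rewrite mem_iota d4 => /(_ isT) al.
  rewrite -(xrK g (comb (cf d g) (mons 7 d))); apply: wt4_xr.
  - exact: (loW (ltnW d4) l).
  - by apply: lo_comb; apply: sub_all al => m /andP[].
  - by apply: IH => //; apply: ltnW.
  - exact: wt4_comb al.
exact: key.
Qed.
Definition f40 : BF 7 := sum_monom 7 [:: [:: 1; 2; 4]; [:: 2; 5; 6]; [:: 3; 4; 6]; [:: 1; 3; 4]; [:: 1; 3; 5]; [:: 4; 5; 7]].
Lemma f40_ok : lo 4 f40 && (sgb f40 <? 3136)%Z.
Proof. by vm_compute. Qed.
Lemma f40_far q : lo 3 q -> 40 <= wt (xr f40 q).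
Proof.
move=> lq; have /andP[l4 /Z.ltb_lt b] := f40_ok.
have := sg_bound l4 lq; rewrite /sg /zn.
have : 4 %| wt (xr f40 q) by exact: wt4_cubic (lo_xr l4 (loW (isT : 3 <= 4) lq)).
move: (wt _) (sgb _) b => w s b /dvdnP[k ->] h; case: leqP => // lt.
(* A weight of at most 36 makes the sum of signs at least 128 - 72 = 56, and 3136 is the square of
   56. *)
have : k <= 9 by lia.
have e7 : Z.of_nat (2 ^ 7) = 128%Z by [].
by rewrite e7 in h; nia.
Qed.

(** * Truth tables of polynomials *)

From mathcomp Require Import all_order all_algebra.
Import GRing.Theory.

Fixpoint tbl n : (pt n -> bool) -> BF n :=
  if n is m.+1 then fun p => pr (tbl (fun x => p (px false x))) (tbl (fun x => p (px true x)))
  else fun p => p tt.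
Lemma get_tbl n (p : pt n -> bool) x : get (tbl p) x = p x.
Proof. by elim: n p x => [|n IH] p; [case | case=> [[] x]; rewrite /= IH]. Qed.
Lemma eq_tbl n (p q : pt n -> bool) : p =1 q -> tbl p = tbl q.
Proof. by move=> e; apply: getP => x; rewrite !get_tbl e. Qed.
Lemma wt_tbl n (p : pt n -> bool) : wt (tbl p) = count p (pts n).
Proof.
elim: n p => [|n IH] p; first by rewrite /= addn0.
by rewrite [pts _]/(_ ++ _) count_cat !count_map -!IH.
Qed.
Lemma size_pts n : size (pts n) = 2 ^ n.
Proof. by elim: n => // n IH; rewrite size_cat !size_map IH expnS mul2n addnn. Qed.
Lemma tbl_xr n (p q : pt n -> bool) : xr (tbl p) (tbl q) = tbl (fun x => p x (+) q x).
Proof. by apply: getP => x; rewrite get_xr !get_tbl. Qed.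
Lemma get_an n (f g : BF n) x : get (an f g) x = get f x && get g x.
Proof. by elim: n f g x => [|n IH] f g //= [[] x]; rewrite IH. Qed.
Lemma tbl_an n (p q : pt n -> bool) : an (tbl p) (tbl q) = tbl (fun x => p x && q x).
Proof. by apply: getP => x; rewrite get_an !get_tbl. Qed.
Lemma lo_tbl_zi n k : lo 2 (tbl (fun x : pt n => zi k x)).
Proof.
elim: n k => [|n IH] k; first by [].
case: k => [|k]; last first.
  change (lo 2 (pr (tbl (fun x : pt n => zi k x)) (tbl (fun x : pt n => zi k x)))).
  by rewrite lo_pr IH xrr lo_zr.
change (lo 2 (pr (tbl (fun _ : pt n => false)) (tbl (fun _ : pt n => true)))).
have -> : tbl (fun _ : pt n => false) = zr n by apply: getP => x; rewrite get_tbl get0.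
have -> : tbl (fun _ : pt n => true) = one n.
  by elim: n {IH} => //= n IH; rewrite [RHS]/(pr (one n) (one n)) -IH.
by rewrite lo_pr lo_zr x0r lo_one.
Qed.

Definition vec n (x : pt n) : 'rV['F_2]_n := (\row_j (zi j x)%:R)%R.
Lemma F2_bool (a : 'F_2) : a = ((a != 0%R)%:R)%R.
Proof. by case: a => [[|[|]]] // i; apply: val_inj. Qed.
Lemma F2_neq0 (b : bool) : ((b%:R : 'F_2) != 0)%R = b.
Proof. by case: b. Qed.
Lemma F2_add (a b : 'F_2) : ((a + b != 0) = (a != 0) (+) (b != 0))%R.
Proof. by rewrite (F2_bool a) (F2_bool b); case: (a != 0)%R; case: (b != 0)%R. Qed.
Definition pvec n (v : 'rV['F_2]_n) : pt n :=
  mkpt n (fun j => if insub j is Some i then v 0%R i != 0%R else false).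
Lemma zi_inj n (x y : pt n) : (forall j, j < n -> zi j x = zi j y) -> x = y.
Proof.
elim: n x y => [|n IH] x y H; first by case: x {H}; case: y.
case: x y H => a x [b y] H; have -> : x = y by apply: IH => j lt; apply: (H j.+1 lt).
by have /= -> := H 0 isT.
Qed.
Lemma pvecK n (v : 'rV['F_2]_n) : vec (pvec v) = v.
Proof.
apply/rowP => j; rewrite mxE zi_mkpt // insubT //= => lt; rewrite -F2_bool; congr (v _ _).
exact: val_inj.
Qed.
Lemma vecK n (x : pt n) : pvec (vec x) = x.
Proof.
by apply: zi_inj => j lt; rewrite zi_mkpt // insubT mxE F2_neq0.
Qed.
Lemma vec_surj n (v : 'rV['F_2]_n) : exists x, v = vec x.
Proof. by exists (pvec v); rewrite pvecK. Qed.
Lemma mem_map_pts n (T : eqType) (h : pt n -> T) x : h x \in [seq h y | y <- pts n].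
Proof.
elim: n h x => [|n IH] h x; first by case: x; rewrite inE.
rewrite map_cat mem_cat -!map_comp; case: x => [[] x].
  by apply/orP; right; apply: (IH (fun y => h (true, y))).
by apply/orP; left; apply: (IH (fun y => h (false, y))).
Qed.
Lemma card_vec n (p : pred 'rV['F_2]_n) : #|[set v | p v]| = wt (tbl (fun x => p (vec x))).
Proof.
have sub : {subset enum 'rV['F_2]_n <= [seq vec x | x <- pts n]}.
  by move=> v _; have [x ->] := vec_surj v; apply: mem_map_pts.
have sz : size [seq vec x | x <- pts n] <= size (enum 'rV['F_2]_n).
  by rewrite size_map size_pts -cardE card_mx card_Fp // mul1n.
(* The list reaches every vector and is no longer than their number, so it has no repetitions. *)
have uq := leq_size_uniq (enum_uniq _) sub sz.
rewrite wt_tbl -[RHS](count_map (@vec n) p) -size_filter.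
rewrite -(card_uniqP (filter_uniq p uq)); apply: eq_card => v.
rewrite inE mem_filter; have -> : v \in [seq vec x | x <- pts n].
  by have [x ->] := vec_surj v; apply: mem_map_pts.
by rewrite andbT.
Qed.

Definition tab n (f : boolfun n) : BF n := tbl (fun x => f (vec x) != 0%R).
Lemma tab_surj n (p : BF n) : exists f, tab f = p.
Proof.
exists [ffun v => ((get p (pvec v))%:R)%R].
by apply: getP => x; rewrite get_tbl ffunE F2_neq0 vecK.
Qed.
Lemma tab_add n (f g : boolfun n) : tab (f + g)%R = xr (tab f) (tab g).
Proof. by rewrite tbl_xr; apply: eq_tbl => x; rewrite ffunE F2_add. Qed.
Lemma tab0 n : tab (0%R : boolfun n) = zr n.
Proof. by apply: getP => x; rewrite get_tbl ffunE get0. Qed.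
Lemma hdist_tab n (f g : boolfun n) : hdist f g = wt (xr (tab f) (tab g)).
Proof.
rewrite /hdist (card_vec (fun v => f v != g v)) tbl_xr; congr wt; apply: eq_tbl => x.
rewrite (F2_bool (f _)) (F2_bool (g _)) !F2_neq0.
by case: (f _ != 0)%R; case: (g _ != 0)%R.
Qed.

Definition mono n (K : {set 'I_n}) : boolfun n := [ffun v : 'rV_n => \prod_(k in K) v 0 k]%R.
Lemma prod_neq0 n (s : seq 'I_n) (F : 'I_n -> 'F_2) :
  ((\prod_(k <- s) F k)%R != 0%R) = all (fun k => F k != 0%R) s.
Proof.
elim: s => [|k s IH]; first by rewrite big_nil.
by rewrite big_cons mulf_eq0 negb_or IH.
Qed.
Lemma tab_mono n (K : {set 'I_n}) : tab (mono K) = tbl (fun x => all (fun k => zi k x) [seq val k | k <- enum K]).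
Proof.
apply: eq_tbl => x; rewrite ffunE -big_enum prod_neq0 all_map; apply: eq_all => k /=.
by rewrite mxE F2_neq0.
Qed.
Lemma lo_tab_mono n (K : {set 'I_n}) : lo #|K|.+1 (tab (mono K)).
Proof.
rewrite tab_mono cardE -(size_map val); elim: (map _ _) => [|k s IH].
  have -> : tbl (fun x : pt n => all (fun k => zi k x) [::]) = one n.
    by elim: n {K} => //= n IH; rewrite [RHS]/(pr (one n) (one n)) -IH.
  exact: lo_one.
by have := lo_an (lo_tbl_zi n k) IH; rewrite tbl_an.
Qed.
Lemma lo_tab n r (g : boolfun n) : g \in RM r n -> lo r.+1 (tab g).
Proof.
rewrite inE => /bigmax_leqP H; rewrite -(anfK g); set a := anf g in H *.
have -> : anf_eval a = (\sum_(K : {set 'I_n}) if a K != 0 then mono K else 0)%R.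
  apply/ffunP => v; rewrite ffunE sum_ffunE; apply: eq_bigr => K _.
  case: ifP => [ne|/negbFE/eqP->]; last by rewrite ffunE mul0r.
  by rewrite ffunE (F2_bool (a K)) ne mul1r.
elim/big_ind: _ => [|f h lf lh|K _]; first by rewrite tab0 lo_zr.
  by rewrite tab_add lo_xr.
case: ifP => [ne|_]; last by rewrite tab0 lo_zr.
by apply: loW (lo_tab_mono K); apply: H.
Qed.

Lemma anf_add n (f g : boolfun n) : anf (f + g)%R = (anf f + anf g)%R.
Proof.
apply: (@anf_eval_inj n); rewrite anfK; apply/ffunP => v; rewrite !ffunE.
rewrite -{1}(anfK f) -{1}(anfK g) !ffunE -big_split; apply: eq_bigr => K _.
by rewrite !ffunE mulrDl.
Qed.
Lemma RM_add r n (f g : boolfun n) : f \in RM r n -> g \in RM r n -> (f + g)%R \in RM r n.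
Proof.
rewrite !inE => /bigmax_leqP F /bigmax_leqP G; apply/bigmax_leqP => K.
rewrite anf_add ffunE => ne; case: (eqVneq (anf f K) 0%R) => [e|]; last exact: F.
by apply: G; rewrite e add0r in ne.
Qed.
Lemma RM_mono n (K : {set 'I_n}) r : #|K| <= r -> mono K \in RM r n.
Proof.
move=> le; rewrite inE; apply/bigmax_leqP => K'.
have -> : mono K = anf_eval [ffun K' => (K' == K)%:R%R].
  apply/ffunP => v; rewrite !ffunE (bigD1 K) //= [X in (_ + X)%R]big1 => [|K'' /negPf ne].
    by rewrite ffunE eqxx mul1r addr0.
  by rewrite ffunE ne mul0r.
by rewrite anf_evalK ffunE F2_neq0 => /eqP->.
Qed.

(** Candidate index lists for the monomials of degree at most 2; [mons_mono] selects the right one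
    by comparing truth tables. *)
Definition sets2 d : seq (seq nat) :=
  match d with 0 => [:: [::]] | 1 => [seq [:: j] | j <- iota 0 7] | _ => [seq [:: j; k] | j <- iota 0 7, k <- iota 0 7] end.
Lemma mons_mono : all (fun d => all (fun m => has (fun s =>
    [&& size s == d, all (gtn 7) s & wt (xr m (tbl (fun x : pt 7 => all (fun k => zi k x) s))) == 0]) (sets2 d))
  (mons 7 d)) (iota 0 3).
Proof. by vm_compute. Qed.
Lemma mons_tab d m : d < 3 -> List.In m (mons 7 d) -> exists2 g, g \in RM 2 7 & tab g = m.
Proof.
move=> d3 mm; have := allP mons_mono d; rewrite mem_iota d3 => /(_ isT) al.
have := all_In al mm; case/has_In=> s _ /and3P[/eqP sz /allP s7 /eqP/wt0/xr_eq0 ->].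
pose K := [set i : 'I_7 | val i \in s]; exists (mono K).
  apply: RM_mono; apply: leq_trans (_ : size s <= 2); last by rewrite sz.
  rewrite cardE -(size_map val); apply: uniq_leq_size; first by rewrite map_inj_uniq ?enum_uniq //; apply: val_inj.
  by move=> k /mapP[i]; rewrite mem_enum inE => ? ->.
rewrite tab_mono; apply: eq_tbl => x; apply/allP/allP => H k.
  by move=> ks; have k7 := s7 k ks; apply: H; apply/mapP; exists (Ordinal k7); rewrite ?mem_enum ?inE.
by move/mapP=> [i]; rewrite mem_enum inE => /H h ->.
Qed.
Lemma comb_tab d v : d < 3 -> exists2 g, g \in RM 2 7 & tab g = comb v (mons 7 d).
Proof.
move=> d3; have : forall m, List.In m (mons 7 d) -> exists2 g, g \in RM 2 7 & tab g = m.
  by move=> m; apply: mons_tab.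
elim: (mons 7 d) v => [|m ms IH] v H; first by exists 0%R; [exact: RM0 | rewrite tab0].
have {}IH u := IH u (fun m' mm => H m' (or_intror mm)).
case: v => [|[] v]; last exact: IH.
  by exists 0%R; [exact: RM0 | rewrite tab0 comb_nil].
have [g gR eg] := IH v; have [h hR eh] := H m (or_introl erefl).
by exists (h + g)%R; [exact: RM_add | rewrite tab_add eg eh].
Qed.
Lemma RM_tab (q : BF 7) : lo 3 q -> exists2 g, g \in RM 2 7 & tab g = q.
Proof.
have key d : d <= 3 -> forall q : BF 7, lo d q -> exists2 g, g \in RM 2 7 & tab g = q.
  elim: d => [|d IH] d3 p; first by move=> /lo0->; exists 0%R; [exact: RM0 | rewrite tab0].
  move=> /lo_cf /(IH (ltnW d3))[g gR eg]; have [h hR eh] := comb_tab (cf d p) d3.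
  by exists (g + h)%R; [exact: RM_add | rewrite tab_add eg eh xrK].
exact: key.
Qed.

Theorem theorem11 : covering_radius 2 7 = 40.
Proof.
apply/eqP; rewrite eqn_leq; apply/andP; split.
  apply/bigmax_leqP => f _; rewrite /nl; case: arg_minnP => [|g0 _ min]; first exact: RM0.
  have [q lq le] := L40 (tab f); have [g gR eg] := RM_tab lq.
  by apply: leq_trans (min g gR) _; rewrite hdist_tab eg.
have [f ef] := tab_surj f40; apply: (leq_trans _ (leq_bigmax_cond f isT)).
rewrite /nl; case: arg_minnP => [|g gR _]; first exact: RM0.
by rewrite hdist_tab ef; apply: f40_far; apply: lo_tab gR.
Qed.
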